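(* Let $(W_1,S_1)$ and $(W_2,S_2)$ be Coxeter systems of finite rank with sets of reflections $T_1,T_2$, let $S_1=\{s_1,\dots,s_k\}$, $S_2=\{s_{k+1},\dots,s_n\}$, $h_1=s_1\cdots s_k$, $h_2=s_{k+1}\cdots s_n$. Let $(W,S)$ be the Coxeter system with $W=W_1*W_2$ and $S=S_1\sqcup S_2$, with set of reflections $T$, and let $h=h_1h_2=s_1\cdots s_n$. If $(W_1,T_1,h_1)$ and $(W_2,T_2,h_2)$ are pan-transitive, then so is $(W,T,h)$.
   Context: A Coxeter system $(W,S)$: $W=\langle S\mid (ss')^{m(s,s')}=1\text{ whenever } m(s,s')\neq\infty\rangle$ with $m$ symmetric, $m(s,s)=1$, $m(s,s')\in\{2,3,\dots,\infty\}$ for $s\neq s'$; its set of reflections is the set of all conjugates of elements of $S$. The free product $W_1*W_2$ with generating set $S_1\sqcup S_2$ is the Coxeter system with $m(s,s')=\infty$ for $s\in S_1,s'\in S_2$. For a group $G$ with generating set $X$ and $a\in G$: $\ell_X(a)$ is the minimal $k$ with $a=x_1\cdots x_k$, $x_i\in X\cup X^{-1}$; $\mathrm{Red}_X(a)$ is the set of such tuples of length $\ell_X(a)$; $a\le_X b$ iff $\ell_X(a)+\ell_X(a^{-1}b)=\ell_X(b)$; $[1,b]_X=\{a:a\le_X b\}$. The braid group $B_m$ (generators $\sigma_1,\dots,\sigma_{m-1}$) acts on $G^m$ by the Hurwitz action $\sigma_i\cdot(g_1,\dots,g_m)=(g_1,\dots,g_{i-1},g_ig_{i+1}g_i^{-1},g_i,g_{i+2},\dots,g_m)$,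 which preserves $\mathrm{Red}_X(a)$ when $X$ is conjugation-closed and $m=\ell_X(a)$. For a Coxeter system with reflections $T$ and Coxeter element $c$ (a product of all simple reflections in some order), the triple $(W,T,c)$ is pan-transitive if for every $a\in[1,c]_T$ the Hurwitz action of $B_{\ell_T(a)}$ on $\mathrm{Red}_T(a)$ is transitive. *)

(* Defs.v *)
(* Coxeter groups given by their presentation, realized as
   words in the simple generators modulo the congruence generated by the
   Coxeter relators. *)
From mathcomp Require Import all_boot.
From Stdlib Require Import Relations.
Set Implicit Arguments. Unset Strict Implicit. Unset Printing Implicit Defensive.

Section Coxeter.
Variable I : finType.
(* Coxeter matrix; the value 0 encodes m(s,t) = infinity. *)
Variable m : I -> I -> nat.

Definition coxeter_matrix : Prop :=
  (forall s t, m s t = m t s) /\ (forall s, m s s = 1) /\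
  (forall s t, s != t -> m s t != 1).

Definition relator (s t : I) : seq I := flatten (nseq (m s t) [:: s; t]).

Inductive coxeq : seq I -> seq I -> Prop :=
| ce_rel u v s t : 0 < m s t -> coxeq (u ++ relator s t ++ v) (u ++ v)
| ce_refl u : coxeq u u
| ce_sym u v : coxeq u v -> coxeq v u
| ce_trans u v w : coxeq u v -> coxeq v w -> coxeq u w.

(* inverse of a group element (generators are involutions) *)
Definition winv (w : seq I) : seq I := rev w.

Definition is_refl (x : seq I) : Prop :=
  exists (w : seq I) (s : I), coxeq x (w ++ s :: winv w).

Definition factT (a : seq I) (ts : seq (seq I)) : Prop :=
  (forall t, t \in ts -> is_refl t) /\ coxeq (flatten ts) a.

Definition lenT (a : seq I) (n : nat) : Prop :=
  (exists ts, size ts = n /\ factT a ts) /\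
  (forall ts, factT a ts -> n <= size ts).

Definition redT (a : seq I) (ts : seq (seq I)) : Prop :=
  factT a ts /\ lenT a (size ts).

Definition leT (a b : seq I) : Prop :=
  exists la lab lb, [/\ lenT a la, lenT (winv a ++ b) lab, lenT b lb
                      & la + lab = lb].

(* Hurwitz move sigma_i (0-based: acts on positions i, i+1) *)
Definition hurwitz (i : nat) (ts : seq (seq I)) : seq (seq I) :=
  let gi := nth [::] ts i in let gj := nth [::] ts i.+1 in
  take i ts ++ [:: gi ++ gj ++ winv gi; gi] ++ drop i.+2 ts.

Definition tupeq (ts us : seq (seq I)) : Prop :=
  size ts = size us /\ forall i, i < size ts -> coxeq (nth [::] ts i) (nth [::] us i).

Definition hstep (ts us : seq (seq I)) : Prop :=
  (exists i, i.+1 < size ts /\ us = hurwitz i ts) \/ tupeq ts us.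

(* same orbit under the Hurwitz action of the braid group B_(size ts):
   equivalence closure of the generator moves sigma_i (and equality in W^k) *)
Definition hurwitz_orbit : relation (seq (seq I)) := clos_refl_sym_trans _ hstep.

Definition pan_transitive (c : seq I) : Prop :=
  forall a, leT a c ->
  forall ts us, redT a ts -> redT a us -> hurwitz_orbit ts us.

End Coxeter.

Definition coxeter_word (I : finType) (c : seq I) : bool := perm_eq c (enum I).

Definition free_prod_matrix (I1 I2 : finType) (m1 : I1 -> I1 -> nat)
  (m2 : I2 -> I2 -> nat) (x y : I1 + I2) : nat :=
  match x, y with
  | inl a, inl b => m1 a b
  | inr a, inr b => m2 a b
  | _, _ => 0
  end.

(* Main.v *)
(* A reduced factorization of an element of [A * B], written as a word whose letters are elements of [A]
   or [B], is read off a planar diagram, which puts the letters into noncrossing classes. For [a] below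
   [h = al be], gluing the diagrams of [a] and [a^-1 h] shows that the first letter [z] of [a] satisfies
   [al = z v] with additive lengths, and that [a] lifts to the free product [(A * B) * A], in which [z] and
   [v] live in different copies of [A]. The lift does not depend on the factorization. Conjugating it by [z]
   gives an element below [(v be) z] in the free product of [A * B] and [A], and one inducts on the length
   of [h] and on the number of letters of [a] that lie in the first factor. If [z = al], the word is first
   rotated by conjugation; a word all of whose letters are [al] or [be] is a power of [h], hence too long.
   Independence of the lift needs the property [indep] of [al] and [be]. For a Coxeter element it holds
   because a reduced factorization has linearly independent roots: this is true of the simple reflections in
   a complex reflection representation, and is preserved by Hurwitz moves. *)
Require Import Defs.
From HB Require Import structures.
From mathcomp Require Import all_boot.
From mathcomp Require Import boolp.
From mathcomp Require Import zify.
Set Implicit Arguments. Unset Strict Implicit. Unset Printing Implicit Defensive.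

(** A homomorphism may be chosen separately on each class of a diagram. Sending classes into
    different coordinates of a direct product turns a reading of [h] into a factorization there;
    length is additive on direct products, so each choice yields an inequality between lengths, and
    additivity is read off the tight ones. The obstacle is to know which classes may be separated.
    In the glued diagram each letter of [a] faces its inverse in [a^-1 h]; join their two classes by
    an edge. Cancelling the pairs from the inside out shows that this graph is a forest, so removing
    an edge separates its ends while every other pair still telescopes away. Removing the edge of
    the first letter isolates [z]; removing a second edge shows that a letter grouped with [z] is,
    up to conjugation and inversion, below [z]. The lift replaces [al] by [v be] with [v] merely
    below [al], so the induction runs over arbitrary groups with a conjugation-closed generating
    set, and [indep] travels along as a hypothesis. Transitivity for the lift suffices, because
    folding the two copies of [A] maps Hurwitz moves to Hurwitz moves. *)

Local Open Scope group_scope.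

(** * Conjugation and Hurwitz equivalence of tuples in a group *)

Section Groups.
Variable G : groupType.
Implicit Types (g x y z : G) (s t p q : seq G).

Definition cj g x := g * x * g^-1.
Definition gp s : G := foldr *%g 1 s.

Lemma cjM g x y : cj g (x * y) = cj g x * cj g y.
Proof. by rewrite /cj !mulgA mulgVK. Qed.

Lemma cj1 x : cj 1 x = x.
Proof. by rewrite /cj mul1g invg1 mulg1. Qed.

Lemma cjg1 g : cj g 1 = 1.
Proof. by rewrite /cj mulg1 mulgV. Qed.

Lemma cjV g x : cj g x^-1 = (cj g x)^-1.
Proof. by rewrite /cj !invgM invgK mulgA. Qed.

Lemma cjJ g h x : cj g (cj h x) = cj (g * h) x.
Proof. by rewrite /cj invgM !mulgA. Qed.

Lemma cjK g : cancel (cj g) (cj g^-1).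
Proof. by move=> x; rewrite cjJ mulVg cj1. Qed.

Lemma cjKV g : cancel (cj g^-1) (cj g).
Proof. by move=> x; rewrite cjJ mulgV cj1. Qed.

Lemma gp_cat s t : gp (s ++ t) = gp s * gp t.
Proof. by elim: s => [|x s IH] /=; rewrite ?mul1g // IH mulgA. Qed.

Lemma gp_cons x s : gp (x :: s) = x * gp s.
Proof. by []. Qed.

Lemma gp1 x : gp [:: x] = x.
Proof. exact: mulg1. Qed.

Lemma gp_cj g s : gp (map (cj g) s) = cj g (gp s).
Proof. by elim: s => [|x s IH] /=; rewrite ?cjg1 // IH cjM. Qed.

Inductive heq : seq G -> seq G -> Prop :=
| heq_step p x y q : heq (p ++ x :: y :: q) (p ++ cj x y :: x :: q)
| heq_refl s : heq s s
| heq_sym s t : heq s t -> heq t s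
| heq_trans s t u : heq s t -> heq t u -> heq s u.

Lemma heq_size s t : heq s t -> size s = size t.
Proof. by elim=> [p x y q|//|//|? ? ? _ -> _ -> //]; rewrite !size_cat. Qed.

Lemma heq_gp s t : heq s t -> gp s = gp t.
Proof.
elim=> [p x y q|//|//|? ? ? _ -> _ -> //].
by rewrite !gp_cat /= /cj !mulgA mulgVK.
Qed.

Lemma heq_cat s t p q : heq s t -> heq (p ++ s ++ q) (p ++ t ++ q).
Proof.
elim=> [p' x y q'|u|u v _ H|u v w _ H1 _ H2].
- have E a b : p ++ (p' ++ a :: b :: q') ++ q = (p ++ p') ++ a :: b :: (q' ++ q).
    by rewrite -!catA.
  by rewrite !E; apply: heq_step.
- exact: heq_refl.
- exact: heq_sym.
- exact: heq_trans H1 H2.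
Qed.

Lemma heq_catl s t p : heq s t -> heq (p ++ s) (p ++ t).
Proof. by move=> /(@heq_cat _ _ p [::]); rewrite !cats0. Qed.

Lemma heq_catr s t q : heq s t -> heq (s ++ q) (t ++ q).
Proof. exact: (@heq_cat _ _ [::]). Qed.

Lemma heq_cat2 s t s' t' : heq s s' -> heq t t' -> heq (s ++ t) (s' ++ t').
Proof. by move=> H1 H2; apply: (heq_trans (heq_catr _ H1)); apply: heq_catl. Qed.

(** A move replaces an entry by its conjugate by a neighbour and is undone the same way, so a
    property closed under such conjugations survives in both directions. *)
Lemma heq_sub s t (P : G -> Prop) :
    (forall x y, P x -> P y -> P (cj x y)) -> (forall x y, P x -> P y -> P (cj x^-1 y)) ->
  heq s t -> (forall x, x \in s -> P x) <-> (forall x, x \in t -> P x).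
Proof.
move=> Pc Pv; elim=> [p x y q|//|? ? _ <- //|? ? ? _ -> _ -> //].
have ss a b c d : (forall z, z \in p ++ a :: b :: q -> P z) ->
    (P a -> P b -> P c /\ P d) -> forall z, z \in p ++ c :: d :: q -> P z.
  move=> H Hcd z.
  have [Pa Pb] : P a /\ P b by split; apply: H; rewrite mem_cat !inE eqxx ?orbT.
  have [Pc' Pd] := Hcd Pa Pb.
  rewrite mem_cat !inE => /or4P[Hz|/eqP->|/eqP->|Hz] //;
  by apply: H; rewrite mem_cat !inE Hz ?orbT.
split=> H; apply: ss H _ => Px Py; split=> //; first exact: Pc.
by have := Pv _ _ Py Px; rewrite cjK.
Qed.

Lemma heq_block1 s y : heq (s ++ [:: y]) (cj (gp s) y :: s).
Proof.
elim: s => [|x s IH] /=; first by rewrite cj1; apply: heq_refl.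
apply: heq_trans (heq_catl [:: x] IH) _.
rewrite -cjJ; exact: (heq_step [::]).
Qed.

(** The entries of [t] cross [s] one at a time, each picking up conjugation by the whole product of
    [s]. *)
Lemma heq_block s t : heq (s ++ t) (map (cj (gp s)) t ++ s).
Proof.
elim: t s => [|y t IH] s; first by rewrite cats0; apply: heq_refl.
rewrite -cat1s catA; apply: heq_trans (heq_catr t (heq_block1 s y)) _.
exact: heq_catl [:: _] (IH s).
Qed.

Lemma heq_block' s t : heq (s ++ t) (t ++ map (cj (gp t)^-1) s).
Proof.
apply: heq_sym; apply: heq_trans (heq_block _ _) _.
rewrite mapK; [exact: heq_refl | exact: cjKV].
Qed.

End Groups.

Section Morphisms.
Variables (G H : groupType) (f : G -> H).
Hypothesis fM : {morph f : x y / x * y}.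

Lemma morph1 : f 1 = 1.
Proof. by apply: (mulgI (f 1)); rewrite -fM !mulg1. Qed.

Lemma morphV x : f x^-1 = (f x)^-1.
Proof. by apply: (mulgI (f x)); rewrite -fM !mulgV morph1. Qed.

Lemma morphcj g x : f (cj g x) = cj (f g) (f x).
Proof. by rewrite /cj !fM morphV. Qed.

Lemma morph_gp s : f (gp s) = gp (map f s).
Proof. by elim: s => [|x s IH] /=; rewrite ?morph1 ?fM ?IH. Qed.

Lemma heq_map s t : heq s t -> heq (map f s) (map f t).
Proof.
elim=> [p x y q|u|u v _ Huv|u v w _ H1 _ H2].
- rewrite !map_cat /= morphcj; exact: heq_step.
- exact: heq_refl.
- exact: heq_sym.
- exact: heq_trans H1 H2.
Qed.

End Morphisms.

Lemma heq_cj (G : groupType) (g : G) s t : heq s t -> heq (map (cj g) s) (map (cj g) t).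
Proof. by apply: heq_map => x y; exact: cjM. Qed.

Lemma map_eq_cat (T U : Type) (f : T -> U) s p q : map f s = p ++ q ->
  exists p' q', [/\ s = p' ++ q', map f p' = p & map f q' = q].
Proof.
elim: p s => [|x p IH] [|y s] //= H; try by exists [::], [::].
  by exists [::], (y :: s).
case: H => <- /IH [p' [q' [-> <- <-]]]; by exists (y :: p'), q'.
Qed.

(** Moves are written with group operations only, so each move of the image tuple is the image of
    the same move upstairs. Both directions are proved together because [heq] is symmetric. *)
Lemma heq_lift (G H : groupType) (f : G -> H) s t (s' : seq G) :
  {morph f : x y / x * y} -> heq s t -> map f s' = s -> exists2 t', heq s' t' & map f t' = t.
Proof.
move=> fM Hst.
have: (forall s', map f s' = s -> exists2 t', heq s' t' & map f t' = t) /\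
      (forall t', map f t' = t -> exists2 s', heq t' s' & map f s' = s).
  elim: Hst => {s t s'} [p x y q|u|u v _ [H1 H2]|u v w _ [H1 H2] _ [H3 H4]].
  - split=> s' /map_eq_cat [p' [[|a [|b q']] [-> <-]]] //=.
      case=> <- <- <-; exists (p' ++ cj a b :: a :: q'); first exact: heq_step.
      by rewrite map_cat /= morphcj.
    case=> e e2 <-; exists (p' ++ b :: cj b^-1 a :: q').
      apply: heq_sym; rewrite -{2}(cjKV b a); exact: heq_step.
    by rewrite map_cat /= (morphcj fM) (morphV fM) e e2 cjK.
  - by split=> s' E; exists s' => //; apply: heq_refl.
  - by split.
  - split=> s'.
      move=> /H1 [t' h1 /H3 [r h2 e]]; exists r => //; exact: heq_trans h1 h2.
    move=> /H4 [t' h1 /H2 [r h2 e]]; exists r => //; exact: heq_trans h1 h2.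
by case=> h _; apply: h.
Qed.

(** * Groups with reflections: length, absolute order, transitivity and independence *)

Record rsys := Rsys {
  gt :> groupType;
  refl : gt -> Prop;
  reflJ : forall g t, refl t -> refl (cj g t);
  reflV : forall t, refl t -> refl t^-1;
  refl_gen : forall x, exists s, (forall t, t \in s -> refl t) /\ gp s = x }.

Section Length.
Variable G : rsys.
Implicit Types (g x y z a b c v : G) (s t : seq G).

Definition rfac x s := (forall r, r \in s -> refl r) /\ gp s = x.

Lemma rfac_size_ex x : exists n, `[< exists2 s, rfac x s & size s = n >].
Proof. by have [s Hs] := refl_gen x; exists (size s); apply/asboolP; exists s. Qed.

Definition len x := ex_minn (rfac_size_ex x).
Definition Red x s := rfac x s /\ size s = len x.
Definition le a c := len a + len (a^-1 * c) = len c.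
(** This is Hurwitz transitivity on the reduced factorizations of [a]; [pant] is then
    pan-transitivity. *)
Definition single a := forall s t, Red a s -> Red a t -> heq s t.
Definition pant c := forall a, le a c -> single a.
(** The subgroup generated by the reflections below [z]. Inverses appear because reflections of a
    general system need not be involutions. *)
Definition inH z x := exists s, (forall r, r \in s -> refl r /\ (le r z \/ le r^-1 z)) /\ gp s = x.
(** This excludes that one letter is grouped with [z] by one factorization and with [v] by another:
    it would lie in the subgroup of [v] and yet have a conjugate below [z]. *)
Definition indep c := forall z v, c = z * v -> len z + len v = len c ->
  forall g x, inH z g -> inH v x -> le (cj g x) z -> x = 1.

Lemma len_red x : exists s, Red x s.
Proof. by rewrite /Red /len; case: ex_minnP => n /asboolP [s Hs <-] _; exists s. Qed.

Lemma len_min x s : rfac x s -> len x <= size s.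
Proof.
rewrite /len; case: ex_minnP => n _ H Hs; apply: H; apply/asboolP; by exists s.
Qed.

Lemma rfac_cat x y s t : rfac x s -> rfac y t -> rfac (x * y) (s ++ t).
Proof.
move=> [Hs <-] [Ht <-]; split; last by rewrite gp_cat.
by move=> r; rewrite mem_cat => /orP[/Hs|/Ht].
Qed.

Lemma rfac_cj g x s : rfac x s -> rfac (cj g x) (map (cj g) s).
Proof.
by case=> Hs <-; split; [move=> t /mapP[r /Hs Hr ->]; apply: reflJ|rewrite gp_cj].
Qed.

Lemma rfac_heq x s t : heq s t -> rfac x s -> rfac x t.
Proof.
move=> Hst [Hs <-]; split; last by rewrite (heq_gp Hst).
have P1 (a b : G) : refl a -> refl b -> refl (cj a b) by move=> _; apply: reflJ.
have P2 (a b : G) : refl a -> refl b -> refl (cj a^-1 b) by move=> _; apply: reflJ.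
by apply/(heq_sub P1 P2 Hst).
Qed.

Lemma Red_heq x s t : heq s t -> Red x s -> Red x t.
Proof. by move=> H [h1 h2]; split; [apply: rfac_heq H h1|rewrite -(heq_size H)]. Qed.

Lemma Red_gp x s : Red x s -> gp s = x.
Proof. by do 2 case. Qed.

Lemma lenM x y : len (x * y) <= len x + len y.
Proof.
have [s [Hs <-]] := len_red x; have [t [Ht <-]] := len_red y.
by rewrite -size_cat; apply: len_min; apply: rfac_cat.
Qed.

Lemma len1 : len 1 = 0.
Proof. by apply/eqP; rewrite -leqn0; apply: (@len_min _ [::]). Qed.

Lemma len_eq0 x : len x = 0 -> x = 1.
Proof. by have [[|t s] [[_ <-] <-]] := len_red x. Qed.

Lemma lenJ g x : len (cj g x) = len x.
Proof.
have H h y : len (cj h y) <= len y.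
  have [s [Hs <-]] := len_red y; rewrite -(size_map (cj h) s).
  by apply: len_min; apply: rfac_cj.
apply/eqP; rewrite eqn_leq H /= -{1}(cjK g x); exact: H.
Qed.

Lemma lenV x : len x^-1 = len x.
Proof.
have H y : len y^-1 <= len y.
  have [s [[Hs <-] <-]] := len_red y.
  have -> : size s = size (map inv (rev s)) by rewrite size_map size_rev.
  apply: len_min; split.
    by move=> t /mapP[r]; rewrite mem_rev => /Hs Hr ->; apply: reflV.
  elim: s {Hs} => [|r s IH] /=; first by rewrite invg1.
  by rewrite rev_cons map_rcons -cats1 gp_cat IH gp1 invgM.
by apply/eqP; rewrite eqn_leq H /= -{1}(invgK x) H.
Qed.

Lemma lenC x y : len (x * y) = len (y * x).
Proof. by rewrite -(lenJ y); congr len; rewrite /cj !mulgA mulgK. Qed.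

Lemma Red_cat x y s t : len (x * y) = (len x + len y)%N -> Red x s -> Red y t -> Red (x * y) (s ++ t).
Proof.
move=> E [h1 h2] [h3 h4]; split; first exact: rfac_cat.
by rewrite size_cat h2 h4 E.
Qed.

Lemma Red_split x s t : Red x (s ++ t) ->
  [/\ Red (gp s) s, Red (gp t) t & (len (gp s) + len (gp t))%N = len x].
Proof.
case=> [[H <-]]; rewrite gp_cat size_cat => E.
have Hs : rfac (gp s) s by split=> // r Hr; apply: H; rewrite mem_cat Hr.
have Ht : rfac (gp t) t by split=> // r Hr; apply: H; rewrite mem_cat Hr orbT.
have := len_min Hs; have := len_min Ht; have := lenM (gp s) (gp t); rewrite -E.
move=> h1 h2 h3; have [e1 e2]: size s = len (gp s) /\ size t = len (gp t) by lia.
by split; rewrite // -?e1 -?e2.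
Qed.

Lemma Red_cj g x s : Red x s -> Red (cj g x) (map (cj g) s).
Proof. by case=> H E; split; [apply: rfac_cj|rewrite size_map lenJ]. Qed.

Lemma le_factorl z v : len (z * v) = (len z + len v)%N -> le z (z * v).
Proof. by rewrite /le mulKg => ->. Qed.

Lemma le_factorr z v : len (z * v) = (len z + len v)%N -> le v (z * v).
Proof. by rewrite /le => ->; rewrite lenC -mulgA mulgV mulg1 addnC. Qed.

Lemma le_cj g a c : le (cj g a) (cj g c) <-> le a c.
Proof. by rewrite /le -cjV -cjM !lenJ. Qed.

Lemma le_trans a b c : le a b -> le b c -> le a c.
Proof.
rewrite /le => h1 h2.
have e : a^-1 * c = a^-1 * b * (b^-1 * c) by rewrite -mulgA mulVKg.
have := lenM (a^-1 * b) (b^-1 * c); rewrite -e => h3.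
have := lenM a (a^-1 * c); rewrite mulVKg => h4; lia.
Qed.

Lemma le_refl a : le a a.
Proof. by rewrite /le mulVg len1 addn0. Qed.

Lemma single_cj g a : single (cj g a) <-> single a.
Proof.
have H h b : single (cj h b) -> single b.
  move=> S s t Hs Ht.
  have /(heq_cj h^-1) := S _ _ (Red_cj h Hs) (Red_cj h Ht).
  by rewrite -!map_comp (eq_map (cjK h)) (eq_map (cjK h)) !map_id.
by split; [apply: H|move=> S; apply: (H g^-1); rewrite cjK].
Qed.

Lemma pant_le z c : le z c -> pant c -> pant z.
Proof. by move=> h P a ha; apply: P; apply: le_trans ha h. Qed.

Lemma inH_le z c x : le z c -> inH z x -> inH c x.
Proof.
move=> h [s [Hs <-]]; exists s; split=> // t /Hs[? ht]; split=> //.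
by case: ht => ht; [left|right]; exact: le_trans ht h.
Qed.

Lemma inHM z x y : inH z x -> inH z y -> inH z (x * y).
Proof.
move=> [s [Hs <-]] [t [Ht <-]]; exists (s ++ t); split; last by rewrite gp_cat.
by move=> r; rewrite mem_cat => /orP[/Hs|/Ht].
Qed.

Lemma inH1 z : inH z 1.
Proof. by exists [::]. Qed.

Lemma inH_gp z s : (forall x, x \in s -> inH z x) -> inH z (gp s).
Proof.
elim: s => [|x s IH] H; first exact: inH1.
apply: inHM; first by apply: H; exact: mem_head.
by apply: IH => y hy; apply: H; rewrite inE hy orbT.
Qed.

Lemma inHV z x : inH z x -> inH z x^-1.
Proof.
case=> s [Hs <-]; elim: s Hs => [|x' s IH] Hs; first by rewrite invg1; exact: inH1.
rewrite gp_cons invgM; apply: inHM.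
  by apply: IH => y hy; apply: Hs; rewrite inE hy orbT.
have [h1 h2] := Hs x' (mem_head _ _); exists [:: x'^-1]; split; last exact: gp1.
by move=> r; rewrite inE => /eqP->; split; [exact: reflV|rewrite invgK; case: h2; [right|left]].
Qed.

Lemma inH_refl z r : refl r -> le r z -> inH z r.
Proof. by move=> h1 h2; exists [:: r]; split; [move=> y; rewrite inE => /eqP->; auto|exact: gp1]. Qed.

(** A splitting [z = z1 v1] extends to the splitting of [c] into [z1] and [v1 (z^-1 c)], and [v1]
    lies below the second part. *)
Lemma indep_le z c : le z c -> indep c -> indep z.
Proof.
move=> hz H z1 v1 e l g x hg hx hl.
have e2 : v1 * (z^-1 * c) = z1^-1 * c by rewrite e invgM !mulgA mulgV mul1g.
have z1z : le z1 z by rewrite /le e mulKg -e.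
have z1c := le_trans z1z hz.
apply: (H z1 (v1 * (z^-1 * c)) _ _ g x) => //.
- by rewrite e2 mulVKg.
- by rewrite e2.
apply: inH_le hx; apply: le_factorl; rewrite e2; move: z1c hz l; rewrite /le; lia.
Qed.

Lemma le_Red a c s t : le a c -> Red a s -> Red (a^-1 * c) t -> Red c (s ++ t).
Proof.
by move=> h hs ht; rewrite -[c](mulVKg a); apply: Red_cat; rewrite // mulVKg.
Qed.

End Length.

(** * The free product of two groups, realized by reduced words *)

Section Letters.
Variables A B : groupType.
Local Notation D := (A + B)%type.
Implicit Types (x y z : D) (u v w : seq D).

Definition isl x := if x is inl _ then true else false.
Definition same x y := isl x == isl y.
Definition dmul x y : D := match x, y with
  | inl a, inl b => inl (a * b) | inr a, inr b => inr (a * b) | _, _ => x end.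
Definition dinv x : D := match x with inl a => inl a^-1 | inr b => inr b^-1 end.
Definition done x : D := match x with inl _ => inl 1 | inr _ => inr 1 end.
Definition triv x := match x with inl a => a == 1 | inr b => b == 1 end.

Lemma isl_dmul x y : isl (dmul x y) = isl x.
Proof. by case: x y => [a|a] [b|b]. Qed.
Lemma isl_dinv x : isl (dinv x) = isl x.
Proof. by case: x. Qed.
Lemma isl_done x : isl (done x) = isl x.
Proof. by case: x. Qed.
Lemma same_refl x : same x x.
Proof. exact: eqxx. Qed.

Lemma dmulA x y z : same x y -> same y z -> dmul x (dmul y z) = dmul (dmul x y) z.
Proof. by case: x y z => [a|a] [b|b] [c|c] //= _ _; rewrite mulgA. Qed.
Lemma dmul1 x y : same x y -> dmul (done x) y = y.
Proof. by case: x y => [a|a] [b|b] //= _; rewrite mul1g. Qed.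
Lemma dmulr1 x y : same x y -> dmul x (done y) = x.
Proof. by case: x y => [a|a] [b|b] //= _; rewrite mulg1. Qed.
Lemma dmul_triv x y : same x y -> triv x -> dmul x y = y.
Proof. by case: x y => [a|a] [b|b] //= _ /eqP ->; rewrite mul1g. Qed.
Lemma dmul_triv' x y : same x y -> triv y -> dmul x y = x.
Proof. by case: x y => [a|a] [b|b] //= _ /eqP ->; rewrite mulg1. Qed.
Lemma dmulV x : dmul (dinv x) x = done x.
Proof. by case: x => a /=; rewrite mulVg. Qed.
Lemma dinvK : involutive dinv.
Proof. by case=> a /=; rewrite invgK. Qed.
Lemma triv_done x : triv (done x).
Proof. by case: x => a /=. Qed.
Lemma triv_dinv x : triv (dinv x) = triv x.
Proof. by case: x => a /=; rewrite invg_eq1. Qed.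

Definition alt w := sorted (fun x y => ~~ same x y) w.
Definition reduced w := all (fun x => ~~ triv x) w && alt w.

(** Left multiplication of a reduced word by one letter. As in van der Waerden's argument, letters
    act on normal forms, and associativity of the product reduces to [act_mul]. *)
Definition act x w := if triv x then w else
  if w is y :: w' then
    if same x y then (if triv (dmul x y) then w' else dmul x y :: w') else x :: w
  else [:: x].

Lemma reduced_tail x w : reduced (x :: w) -> reduced w.
Proof. by move=> /andP[/= /andP[_ h]] /path_sorted h'; rewrite /reduced h. Qed.

Lemma reduced_act x w : reduced w -> reduced (act x w).
Proof.
rewrite /act; case: ifP => // tx; case: w => [|y w]; first by rewrite /reduced /= tx.
move=> h; case: ifP => sxy; last by move: h; rewrite /reduced /= tx sxy.
case: ifP => txy; first exact: reduced_tail h.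
move: h; rewrite /reduced /= txy => /andP[/andP[_ ->]] /=.
by case: w => //= z w; rewrite /same isl_dmul (eqP sxy).
Qed.

(* The normal form of a word relative to the side of [x]: a possibly trivial head on that side. *)
Definition consn x w := if triv x then w else x :: w.
Definition headn x w := if w is y :: _ then ~~ same x y else true.

Lemma act_consn x h w : same x h -> headn x w -> act x (consn h w) = consn (dmul x h) w.
Proof.
rewrite /consn /act => s hn; case th: (triv h); last first.
  rewrite s; case tx: (triv x) => //.
  by rewrite dmul_triv // th.
rewrite dmul_triv' //; case: ifP => // tx.
by case: w hn => //= y w /negbTE ->.
Qed.

Lemma consn_split x w : reduced w ->
  exists h w', [/\ same x h, headn x w', reduced w' & w = consn h w'].
Proof.
case: w => [|y w] rw; first by exists (done x), [::]; rewrite /consn triv_done /same isl_done.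
case sxy: (same x y); last first.
  by exists (done x), (y :: w); rewrite /consn triv_done /same isl_done /= sxy.
exists y, w; rewrite /consn; move: (rw) => /andP[/andP[/negbTE -> _] a]; split=> //.
  case: w a {rw} => //= z w /andP[]; by rewrite /same (eqP sxy).
exact: reduced_tail rw.
Qed.

Lemma act_mul x y w : reduced w -> same x y -> act (dmul x y) w = act x (act y w).
Proof.
move=> rw s; have [h [w' [syh hn _ ->]]] := consn_split y rw.
have hnx z : isl z = isl y -> headn z w' by case: (w') hn => //= u v; rewrite /same => + ->.
rewrite !act_consn //; rewrite ?dmulA //; try by apply: hnx; rewrite ?isl_dmul (eqP s).
  by rewrite /same isl_dmul.
by rewrite /same isl_dmul (eqP s).
Qed.

Lemma act_triv x w : triv x -> act x w = w.
Proof. by rewrite /act => ->. Qed.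

Lemma act_cons x w : reduced (x :: w) -> act x w = x :: w.
Proof.
rewrite /reduced /act /= => /andP[/andP[/negbTE-> _]].
by case: w => //= y w /andP[/negbTE->].
Qed.

Lemma actV x w : reduced w -> act (dinv x) (act x w) = w.
Proof.
by move=> rw; rewrite -act_mul ?dmulV ?act_triv ?triv_done // /same isl_dinv.
Qed.

Lemma reduced_foldr u w : reduced w -> reduced (foldr act w u).
Proof. by move=> h; elim: u => //= x u IH; apply: reduced_act. Qed.

Lemma foldr_act x v w : reduced v -> reduced w -> foldr act w (act x v) = act x (foldr act w v).
Proof.
move=> rv rw; have [h [v' [sxh hn _ ->]]] := consn_split x rv.
rewrite act_consn // /consn; have R := reduced_foldr v' rw.
have E : foldr act w (if triv h then v' else h :: v') = act h (foldr act w v').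
  by case: ifP => // th; rewrite act_triv.
have E' : foldr act w (if triv (dmul x h) then v' else dmul x h :: v') = act (dmul x h) (foldr act w v').
  by case: ifP => // th; rewrite act_triv.
by rewrite E E' act_mul.
Qed.

Record fpt := Fp {nf : seq D; nf_red : reduced nf}.
HB.instance Definition _ := [isSub for nf].
HB.instance Definition _ := [Choice of fpt by <:].

Definition fpmul (u v : fpt) := Fp (reduced_foldr (nf u) (nf_red v)).
Definition fp1 := @Fp [::] isT.
Definition winv w := rev (map dinv w).
Lemma reduced_winv w : reduced w -> reduced (winv w).
Proof.
rewrite /reduced /winv /alt all_rev all_map rev_sorted => /andP[h1 h2].
apply/andP; split; first by apply: sub_all h1 => x; rewrite /= triv_dinv.
rewrite sorted_map; apply: sub_sorted h2 => x y /=.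
by rewrite /same !isl_dinv eq_sym.
Qed.
Definition fpinv (u : fpt) := Fp (reduced_winv (nf_red u)).

Lemma fpmulA : associative fpmul.
Proof.
move=> [u ru] [v rv] [w rw]; apply: val_inj => /=.
elim: u {ru} => //= x u ->; rewrite foldr_act //; exact: reduced_foldr.
Qed.
Lemma fpmul1 : left_id fp1 fpmul.
Proof. by move=> [u ru]; apply: val_inj. Qed.
Lemma fpmulr1 : right_id fp1 fpmul.
Proof.
move=> [u ru]; apply: val_inj => /=; elim: u ru => //= x u IH ru.
by rewrite IH ?act_cons // (reduced_tail ru).
Qed.
Lemma fpmulV : left_inverse fp1 fpinv fpmul.
Proof.
move=> [u ru]; apply: val_inj => /=; elim: u ru => //= x u IH ru.
have ru' := reduced_tail ru.
by rewrite /winv /= rev_cons foldr_rcons -{1}(act_cons ru) actV // IH.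
Qed.
Lemma fpinvK : involutive fpinv.
Proof.
move=> [u ru]; apply: val_inj => /=.
by rewrite /winv map_rev revK -map_comp (eq_map (dinvK)) map_id.
Qed.
Lemma fpmulrV : right_inverse fp1 fpinv fpmul.
Proof. by move=> u; rewrite -{1}(fpinvK u) fpmulV. Qed.

HB.instance Definition _ := isGroup.Build fpt fpmulA fpmul1 fpmulr1 fpmulV fpmulrV.

Lemma reduced_inj x : reduced (act x [::]).
Proof. exact: reduced_act. Qed.
Definition inj x : fpt := Fp (reduced_inj x).

Lemma inj_mul x y : same x y -> inj (dmul x y) = inj x * inj y.
Proof.
move=> s; apply: val_inj => /=; rewrite act_mul //.
by rewrite foldr_act //; apply: reduced_act.
Qed.
Lemma inj_triv x : triv x -> inj x = 1.
Proof. by move=> t; apply: val_inj; rewrite /= act_triv. Qed.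
Lemma inj_inv x : inj (dinv x) = (inj x)^-1.
Proof.
apply: (mulIg (inj x)); rewrite mulVg -inj_mul ?dmulV ?inj_triv ?triv_done //.
by rewrite /same isl_dinv.
Qed.

Definition ev w : fpt := gp (map inj w).
Lemma ev_cat u v : ev (u ++ v) = ev u * ev v.
Proof. by rewrite /ev map_cat gp_cat. Qed.
Lemma ev_cons x w : ev (x :: w) = inj x * ev w.
Proof. by []. Qed.
Lemma ev1 x : ev [:: x] = inj x.
Proof. exact: gp1. Qed.

Lemma nf_injM x (u : fpt) : nf (inj x * u) = act x (nf u).
Proof. by rewrite /= foldr_act //; exact: nf_red. Qed.

Lemma nf_ev w : reduced w -> nf (ev w) = w.
Proof.
elim: w => // x w IH rw; rewrite ev_cons nf_injM IH ?act_cons //.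
exact: reduced_tail rw.
Qed.

Lemma ev_nf (u : fpt) : ev (nf u) = u.
Proof. by apply: val_inj; rewrite /= -/(nf _) nf_ev //; exact: nf_red. Qed.

Lemma ev_winv w : ev (winv w) = (ev w)^-1.
Proof.
elim: w => [|x w IH]; first by rewrite invg1.
by rewrite /winv /= rev_cons -cats1 ev_cat ev1 inj_inv -/(winv w) IH invgM.
Qed.

Lemma ev_eq1 w : ev w = 1 -> reduced w -> w = [::].
Proof. by move=> e /nf_ev <-; rewrite e. Qed.

Section Extension.
Variables (K : groupType) (f : D -> K).
Hypothesis fM : forall x y, same x y -> f (dmul x y) = f x * f y.
(** The universal property of the free product: homomorphisms on the two factors, combined in [f],
    extend to all of it. *)
Definition hom (u : fpt) : K := gp (map f (nf u)).

Lemma f_triv x : triv x -> f x = 1.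
Proof.
move=> t; apply: (mulgI (f x)); rewrite -fM ?same_refl //.
by rewrite dmul_triv ?mulg1 ?same_refl.
Qed.

Lemma f_inv x : f (dinv x) = (f x)^-1.
Proof.
apply: (mulIg (f x)); rewrite mulVg -fM; last by rewrite /same isl_dinv.
by rewrite dmulV f_triv ?triv_done.
Qed.

Lemma gp_act x w : gp (map f (act x w)) = f x * gp (map f w).
Proof.
rewrite /act; case: ifP => [t|_]; first by rewrite f_triv ?mul1g.
case: w => //= y w; case: ifP => // s; rewrite mulgA -fM //.
by case: ifP => // t; rewrite f_triv ?mul1g.
Qed.

Lemma homM : {morph hom : u v / u * v}.
Proof.
move=> [u ru] [v rv]; rewrite /hom /=; elim: u {ru} => /= [|x u IH]; rewrite ?mul1g //.
by rewrite gp_act IH mulgA.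
Qed.

Lemma hom_inj x : hom (inj x) = f x.
Proof. by rewrite /hom /= gp_act mulg1. Qed.

Lemma hom_ev w : hom (ev w) = gp (map f w).
Proof. by rewrite (morph_gp homM) -map_comp; congr gp; apply: eq_map => x; rewrite /= hom_inj. Qed.

End Extension.
End Letters.
Arguments done {A B}. Arguments inj {A B}. Arguments ev {A B}. Arguments isl {A B}.

(** * The free product as a group with reflections *)

Section System.
Variables A B : rsys.
Local Notation D := (A + B)%type.
Local Notation F := (fpt A B).

Definition drefl (x : D) := match x with inl a => refl a | inr b => refl b end.
Definition fprefl (t : F) := exists g x, drefl x /\ t = cj g (inj x).

Lemma fpreflJ g t : fprefl t -> fprefl (cj g t).
Proof. by case=> h [x [hx ->]]; exists (g * h), x; rewrite cjJ. Qed.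
Lemma fpreflV t : fprefl t -> fprefl t^-1.
Proof.
case=> h [x [hx ->]]; exists h, (dinv x); rewrite -cjV inj_inv; split=> //.
by case: x hx => a /=; apply: reflV.
Qed.

(** The product starts from [done x], so that a trivial letter with the empty factorization still
    remembers its side. *)
Definition dfac (x : D) (s : seq D) :=
  (forall y, y \in s -> drefl y /\ same x y) /\ foldr (@dmul A B) (done x) s = x.
Definition dlen (x : D) := match x with inl a => len a | inr b => len b end.

Lemma dfac_ex x : exists2 s, dfac x s & size s = dlen x.
Proof.
case: x => [a|b] /=.
- have [s [[Hs <-] <-]] := len_red a; exists (map inl s); last by rewrite size_map.
  split; first by move=> y /mapP[r /Hs ? ->].
  by elim: s {Hs} => //= x s ->.
- have [s [[Hs <-] <-]] := len_red b; exists (map inr s); last by rewrite size_map.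
  split; first by move=> y /mapP[r /Hs ? ->].
  by elim: s {Hs} => //= x s ->.
Qed.

Lemma same_foldr (x : D) s : isl (foldr (@dmul A B) (done x) s) = isl (head x s).
Proof. by case: s => [|y s] /=; rewrite ?isl_done ?isl_dmul. Qed.

Lemma dfac_fold (K : groupType) (f : D -> K) :
  (forall x y, same x y -> f (dmul x y) = f x * f y) ->
  forall x s, dfac x s -> gp (map f s) = f x.
Proof.
move=> fM x s [Hs E]; rewrite -{}[in RHS]E.
elim: s Hs => [|y s IH] Hs /=; first by rewrite (f_triv fM) ?triv_done.
rewrite fM ?IH //; first by move=> z hz; apply: Hs; rewrite inE hz orbT.
have [_ sy] := Hs y (mem_head _ _).
rewrite /same same_foldr -(eqP sy); case: s Hs {IH} => //= z s Hs.
by have [|_ ] := Hs z; rewrite ?inE ?eqxx ?orbT.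
Qed.

Lemma dfac_inj x s : dfac x s -> gp (map inj s) = inj x.
Proof. by apply: dfac_fold => ? ?; exact: inj_mul. Qed.

Lemma fprefl_inj x : drefl x -> fprefl (inj x).
Proof. by exists 1, x; rewrite cj1. Qed.

Lemma fprefl_gen (u : F) : exists s, (forall t, t \in s -> fprefl t) /\ gp s = u.
Proof.
rewrite -(ev_nf u); elim: (nf u) => [|x w [s [Hs E]]]; first by exists [::].
have [r Hr _] := dfac_ex x; exists (map inj r ++ s); split; last by rewrite gp_cat (dfac_inj Hr) E.
move=> t; rewrite mem_cat => /orP[|/Hs//] /mapP[y hy ->].
by apply: fprefl_inj; case: (Hr.1 y hy).
Qed.

Definition fp := Rsys fpreflJ fpreflV fprefl_gen.
End System.

(** Trivial entries are allowed so that a homomorphism which kills some reflections still gives a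
    length bound. *)
Lemma len_min1 (G : rsys) (s : seq G) :
  (forall t, t \in s -> refl t \/ t = 1) -> len (gp s) <= size s.
Proof.
elim: s => [|t s IH] H; first by rewrite len1.
rewrite gp_cons [size _]/=; have {}IH := IH (fun r hr => H r (@mem_behead _ (t :: s) r hr)).
have [h|->] := H t (mem_head _ _); last by rewrite mul1g leqW.
have : len t <= 1 by apply: (@len_min _ _ [:: t]); split; [move=> r; rewrite inE => /eqP->|exact: gp1].
have := lenM t (gp s); lia.
Qed.

Lemma len_hom (G H : rsys) (f : G -> H) : {morph f : x y / x * y} ->
  (forall t, refl t -> refl (f t) \/ f t = 1) -> forall x, len (f x) <= len x.
Proof.
move=> fM fT x; have [s [[Hs <-] <-]] := len_red x.
rewrite (morph_gp fM) -(size_map f); apply: len_min1.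
by move=> t /mapP[r /Hs/fT ? ->].
Qed.

Section CatCons.
Variable T : Type.
Implicit Types (p q r : seq T).
Lemma cat_cons_eq p a q p' b q' : p ++ a :: q = p' ++ b :: q' ->
  [\/ exists r, p' = p ++ a :: r /\ q = r ++ b :: q',
      [/\ p = p', a = b & q = q'] |
      exists r, p = p' ++ b :: r /\ q' = r ++ a :: q].
Proof.
elim: p p' => [|c p IH] [|c' p'] /= [].
- by move=> -> ->; apply: Or32.
- by move=> -> ->; apply: Or31; exists p'.
- by move=> <- <-; apply: Or33; exists p.
- move=> <- /IH [[r [-> ->]]|[-> -> ->]|[r [-> ->]]].
  + by apply: Or31; exists r.
  + by apply: Or32.
  + by apply: Or33; exists r.
Qed.
End CatCons.

(** * Noncrossing labels and the tuples read off planar diagrams *)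

Definition noncrossing (s : seq nat) := forall a b, subseq [:: a; b; a; b] s -> a = b.

Lemma subseq_del_fresh (T : eqType) (l : T) (t p q : seq T) :
  l \notin t -> subseq t (p ++ l :: q) -> subseq t (p ++ q).
Proof.
move=> lt h; have e : filter (predC1 l) t = t.
  by apply/all_filterP/allP => x xt; apply: contraNneq lt => <-.
rewrite -e; apply: (@subseq_trans _ (filter (predC1 l) (p ++ l :: q))).
  rewrite subseq_filter filter_all /=; apply: subseq_trans h; exact: filter_subseq.
rewrite filter_cat /= eqxx /= -filter_cat; exact: filter_subseq.
Qed.

Lemma subseq_dedup (T : eqType) (l : T) (t p q : seq T) :
  sorted (fun a b => a != b) t -> subseq t (p ++ l :: l :: q) -> subseq t (p ++ l :: q).
Proof.
elim: p t => [|z p IH] [|a t]; try by move=> *; apply: sub0seq.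
- rewrite /=; case: (a =P l) => [<-|/eqP/negbTE-> //]; case: t => [|b t] /=.
    by rewrite sub0seq.
  by rewrite [b == a]eq_sym => /andP[/negbTE->].
- move=> /= st; case: eqP => [_|_]; first by apply: IH; exact: path_sorted st.
  exact: IH.
Qed.

Lemma noncrossing_sub s t : subseq s t -> noncrossing t -> noncrossing s.
Proof. move=> st nc a b /subseq_trans/(_ st); exact: nc. Qed.

Section Reads.
Variables A B : rsys.
Local Notation D := (A + B)%type.
Local Notation F := (fp A B).
Local Notation lword := (seq (nat * D)).
Implicit Types (p q w : lword) (s : seq F) (l : nat) (x y : D).

Definition lev w : F := ev (map snd w).
Definition mapl (g : nat -> nat) w : lword := [seq (g z.1, z.2) | z <- w].

Lemma lev_cat p q : lev (p ++ q) = lev p * lev q.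
Proof. by rewrite /lev map_cat ev_cat. Qed.
Lemma lev_cons l x q : lev ((l, x) :: q) = inj x * lev q.
Proof. by []. Qed.
Lemma lev_mapl g w : lev (mapl g w) = lev w.
Proof. by rewrite /lev /mapl -map_comp. Qed.
Lemma labels_mapl g w : map fst (mapl g w) = map g (map fst w).
Proof. by rewrite /mapl -!map_comp. Qed.

(* [Reads w s]: the tuple [s] is read off from a planar diagram whose boundary is the word [w];
   letters with the same label lie on the same region of the diagram. *)
Inductive Reads : lword -> seq F -> Prop :=
| reads_nil : Reads [::] [::]
| reads_ins p q l x nu s : l \notin map fst (p ++ q) -> dfac x nu -> Reads (p ++ q) s ->
    Reads (p ++ (l, x) :: q) (map (cj (lev p)) (map inj nu) ++ s)
| reads_spl p q l x y s : same x y -> Reads (p ++ (l, dmul x y) :: q) s ->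
    Reads (p ++ (l, x) :: (l, y) :: q) s
| reads_heq w s t : heq s t -> Reads w s -> Reads w t.

Lemma reads_gp w s : Reads w s -> gp s = lev w.
Proof.
elim=> {w s} [|p q l x nu s _ nx _ IH|p q l x y s sxy _ ->|w s t h _ <-].
- by [].
- by rewrite gp_cat gp_cj (dfac_inj nx) IH !lev_cat lev_cons /cj !mulgA mulgVK.
- by rewrite !lev_cat !lev_cons inj_mul // !mulgA.
- by rewrite (heq_gp h).
Qed.

Lemma reads_refl w s : Reads w s -> forall t, t \in s -> refl t.
Proof.
move=> H; suff : rfac (gp s) s by case.
elim: H => {w s} [|p q l x nu s _ nx _ [IH _]|//|w s t h _ IH] //.
  split=> // t; rewrite mem_cat => /orP[|/IH//] /mapP[r /mapP[y hy ->] ->].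
  by apply: reflJ; apply: fprefl_inj; case: (nx.1 y hy).
by rewrite -(heq_gp h); apply: rfac_heq h IH.
Qed.

Lemma reads_relabel g w s : {in map fst w &, injective g} -> Reads w s -> Reads (mapl g w) s.
Proof.
move=> gi H; elim: H gi => {w s} [|p q l x nu s fr nx _ IH|p q l x y s sxy _ IH|w s t h _ IH] gi.
- exact: reads_nil.
- rewrite /mapl map_cat /= -(lev_mapl g p); apply: reads_ins => //.
  + rewrite -map_cat -/(mapl g _) labels_mapl; apply/mapP => -[k kin e].
    have kin' : k \in map fst (p ++ (l, x) :: q).
      by move: kin; rewrite !map_cat !mem_cat /= inE => /orP[->|->]; rewrite ?orbT.
    have lin : l \in map fst (p ++ (l, x) :: q).
      by rewrite map_cat mem_cat /= inE eqxx orbT.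
    by move: fr; rewrite (gi _ _ lin kin' e) kin.
  + rewrite -map_cat; apply: IH => a b ha hb; apply: gi; [move: ha|move: hb];
    by rewrite !map_cat !mem_cat /= inE => /orP[->|->]; rewrite ?orbT.
- rewrite /mapl map_cat /=; apply: reads_spl => //; rewrite -[(g l, _)]/((fun z => (g z.1, z.2)) (l, dmul x y)).
  rewrite -map_cons -map_cat; apply: IH => a b ha hb; apply: gi; [move: ha|move: hb];
  by rewrite !map_cat !mem_cat /= !inE => /or3P[->|->|->]; rewrite ?orbT.
- exact: reads_heq h (IH gi).
Qed.

(** The homomorphism [f l] may depend on the label: a class enters by one insertion and is
    afterwards only split, so its letters always multiply inside one factor. The last clause says
    that a map [psi] which undoes [f] on letters also recovers the tuple. *)
Lemma reads_lift (C : groupType) (T : C -> Prop) (f : nat -> D -> C) w s :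
  (forall g t, T t -> T (cj g t)) ->
  (forall l x y, same x y -> f l (dmul x y) = f l x * f l y) ->
  (forall l x, drefl x -> T (f l x)) -> Reads w s ->
  exists u : seq (C * F), [/\ map snd u = s, forall z, z \in u -> T z.1,
    gp (map fst u) = gp [seq f z.1 z.2 | z <- w] &
    forall psi : C -> F, {morph psi : x y / x * y} -> (forall l x, psi (f l x) = inj x) ->
      forall z, z \in u -> psi z.1 = z.2].
Proof.
move=> TJ fM fT; elim=> {w s} [|p q l x nu s _ nx _ [u [u1 u2 u3 u4]]|p q l x y s sxy _ [u [u1 u2 u3 u4]]
   |w s t h _ [u [u1 u2 u3 u4]]].
- by exists [::].
- pose fp := gp [seq f z.1 z.2 | z <- p].
  exists ([seq (cj fp (f l y), cj (lev p) (inj y)) | y <- nu] ++ u); split.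
  + by rewrite map_cat u1 -!map_comp.
  + move=> z; rewrite mem_cat => /orP[|/u2//] /mapP[y /nx.1[hy _] ->] /=.
    by apply: TJ; apply: fT.
  + rewrite !map_cat !gp_cat u3 !map_cat !gp_cat /= -/fp -map_comp.
    have -> : map (fst \o (fun y => (cj fp (f l y), cj (lev p) (inj y)))) nu = map (cj fp) (map (f l) nu).
      by rewrite -map_comp.
    by rewrite gp_cj (dfac_fold (fM l) nx) /cj !mulgA mulgVK.
  + move=> psi pM pf z; rewrite mem_cat => /orP[|/(u4 _ pM pf)//] /mapP[y _ ->] /=.
    rewrite (morphcj pM) pf; congr cj; rewrite /fp (morph_gp pM) /lev /ev -!map_comp.
    by congr gp; apply: eq_map => z'; rewrite /= pf.
- exists u; split=> //; by rewrite u3 !map_cat !gp_cat /= fM // !mulgA.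
- have sM : {morph (@snd C F) : a b / a * b} by [].
  (* Lifting along the second projection lets one braid act on the entries and on their images
     simultaneously. *)
  have [v huv hv] := heq_lift sM h u1.
  have ft : {morph (@fst C F) : a b / a * b} by [].
  exists v; split=> //.
  + have P1 (a b : (C * F)%type) : T a.1 -> T b.1 -> T (cj a b).1 by move=> _; apply: TJ.
    have P2 (a b : (C * F)%type) : T a.1 -> T b.1 -> T (cj a^-1 b).1 by move=> _; apply: TJ.
    by apply/(heq_sub P1 P2 huv).
  + by rewrite -u3 -!(morph_gp ft) (heq_gp huv).
  + move=> psi pM pf; pose Q (a : (C * F)%type) := psi a.1 = a.2.
    have P1 a b : Q a -> Q b -> Q (cj a b) by rewrite /Q /= !pM (morphV pM) => -> ->.
    have P2 a b : Q a -> Q b -> Q (cj a^-1 b) by rewrite /Q /= !pM !(morphV pM) => -> ->.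
    by apply/(heq_sub P1 P2 huv); apply: u4.
Qed.

Definition monotype w := forall l x y, (l, x) \in w -> (l, y) \in w -> same x y.

Lemma reads_mono w s : Reads w s -> monotype w.
Proof.
elim=> {w s} [|p q l x nu s fr nx _ IH|p q l x y s sxy _ IH|//] //.
- move=> k a b; have F' z : (l, z) \in p ++ q -> False.
    by move=> hz; move: fr; rewrite (map_f fst hz).
  rewrite !mem_cat !inE !xpair_eqE.
  have H c : [|| (k, c) \in p, (k == l) && (c == x) | (k, c) \in q] -> (k,c) \in p ++ q \/ (k = l /\ c = x).
    by rewrite mem_cat => /or3P[->|/andP[/eqP-> /eqP->]|->]; rewrite ?orbT; [left|right|left].
  move=> /H[ha|[e ->]] /H[hb|[e' ->]]; last exact: same_refl.
  + exact: IH ha hb.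
  + by move: ha; rewrite e' => /F'.
  + by move: hb; rewrite e => /F'.
- move=> k a b.
  have H c : (k, c) \in p ++ (l, x) :: (l, y) :: q -> exists2 d, (k, d) \in p ++ (l, dmul x y) :: q & same c d.
    rewrite mem_cat !inE => /or4P[h|/eqP[-> ->]|/eqP[-> ->]|h].
    + by exists c; rewrite ?mem_cat ?h ?same_refl.
    + by exists (dmul x y); rewrite ?mem_cat ?inE ?eqxx ?orbT // /same isl_dmul.
    + by exists (dmul x y); rewrite ?mem_cat ?inE ?eqxx ?orbT // /same isl_dmul (eqP sxy).
    + by exists c; rewrite ?mem_cat ?inE ?h ?orbT ?same_refl.
  move=> /H[c /IH hc sac] /H[d /hc]; rewrite /same => /eqP scd /eqP ->; by rewrite (eqP sac) scd.
Qed.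

(** A freshly inserted label occurs once, and a split only repeats a label next to itself; neither
    can create a pattern [a b a b]. *)
Lemma reads_nc w s : Reads w s -> noncrossing (map fst w).
Proof.
elim=> {w s} [a b //|p q l x nu s fr nx _ IH|p q l x y s sxy _ IH|//].
- move=> a b; rewrite map_cat /= => h.
  have cl : count_mem l (map fst p ++ l :: map fst q) = 1%N.
    rewrite count_cat /= eqxx addnCA -count_cat -map_cat.
    by rewrite (count_memPn fr).
  case: (eqVneq a b) => // nab; apply: IH; rewrite map_cat; apply: (subseq_del_fresh _ h).
  rewrite !inE; apply/negP => hl.
  have := leq_count_subseq (pred1 l) h; rewrite cl /= !addn0.
  by case/or4P: hl => /eqP->; rewrite eqxx; case: eqP; rewrite ?addn1.
- move=> a b; rewrite map_cat /= => h; case: (eqVneq a b) => // nab; apply: IH.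
  rewrite map_cat /=; apply: subseq_dedup h.
  by rewrite /= nab eq_sym nab.
Qed.

Lemma lev_dfacs p (M : seq (seq D)) : size M = size p ->
  (forall i z, i < size p -> dfac (nth z p i).2 (nth [::] M i)) ->
  gp (map inj (flatten M)) = lev p.
Proof.
elim: p M => [|z p IHp] [|m M] //= [sM] hM.
rewrite map_cat gp_cat (dfac_inj (hM 0%N z isT)); congr (_ * _).
by apply: IHp => // i z' hi; apply: (hM i.+1 z').
Qed.

(** Distinct labels leave no room for a split, so the diagram consists of insertions only, and block
    moves sort their factorizations into the order of the letters. *)
Lemma reads_uniq w s : Reads w s -> uniq (map fst w) ->
  exists N : seq (seq D), [/\ size N = size w,
    forall i z, i < size w -> dfac (nth z w i).2 (nth [::] N i) &
    heq s (map inj (flatten N))].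
Proof.
elim=> {w s} [_|p q l x nu s fr nx r IH|p q l x y s sxy _ _|w s t h _ IH u].
- exists [::]; split=> //; exact: heq_refl.
- move=> u; have {}u : uniq (map fst (p ++ q)).
    move: u; rewrite !map_cat /= !cat_uniq /= has_sym /= => /and3P[-> + /andP[_ ->]].
    by rewrite negb_or has_sym => /andP[_ ->].
  have [N [sN hN eN]] := IH u.
  exists (take (size p) N ++ nu :: drop (size p) N).
  have sp : size (take (size p) N) = size p by rewrite size_takel // sN size_cat leq_addr.
  split.
  + by rewrite !size_cat /= addnS -size_cat cat_take_drop sN size_cat addnS.
  + move=> i z hi; rewrite !nth_cat sp; case: ltnP => ip.
      have := hN i z; rewrite nth_cat ip nth_take //; apply.
      by rewrite size_cat; apply: ltn_addr.
    case E: (i - size p)%N => [|k] //=.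
    have := hN (size p + k)%N z; rewrite nth_cat nth_drop.
    have -> : (size p + k < size p)%N = false by lia.
    have -> : (size p + k - size p)%N = k by lia.
    apply.
    by move: hi; rewrite !size_cat /=; lia.
  + apply: heq_trans (heq_catl _ eN) _.
    rewrite -{1}(cat_take_drop (size p) N) !flatten_cat /= !map_cat.
    rewrite catA [X in heq _ X]catA; apply: heq_catr.
    have -> : lev p = gp (map inj (flatten (take (size p) N))).
      have {}hN i z : i < size p -> dfac (nth z p i).2 (nth [::] (take (size p) N) i).
        move=> ip; have := hN i z; rewrite nth_cat ip nth_take //; apply.
        by rewrite size_cat; apply: ltn_addr.
      by rewrite (lev_dfacs sp hN).
    apply: heq_sym; exact: heq_block.
- by rewrite map_cat cat_uniq /= inE eqxx /= !andbF.
- have [N [? ? h2]] := IH u; exists N; split=> //; exact: heq_trans (heq_sym h) h2.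
Qed.

End Reads.

Lemma map_cj (G : groupType) (g h : G) s : map (cj g) (map (cj h) s) = map (cj (g * h)) s.
Proof. by rewrite -map_comp; apply: eq_map => x; exact: cjJ. Qed.

(** * Changing the boundary word of a diagram: multiplying, merging and deleting letters *)

Section Moves.
Variables A B : rsys.
Local Notation D := (A + B)%type.
Local Notation F := (fp A B).
Local Notation lword := (seq (nat * D)).
Implicit Types (p q w : lword) (s : seq F) (l : nat) (x y : D).

Lemma reads_ins_eq w t p q l x nu s : w = p ++ (l, x) :: q -> t = map (cj (lev p)) (map inj nu) ++ s ->
  l \notin map fst (p ++ q) -> dfac x nu -> Reads (p ++ q) s -> Reads w t.
Proof. move=> -> ->; exact: reads_ins. Qed.

Lemma reads_spl_eq w p q l x y s : w = p ++ (l, x) :: (l, y) :: q -> same x y ->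
  Reads (p ++ (l, dmul x y) :: q) s -> Reads w s.
Proof. move=> ->; exact: reads_spl. Qed.

Lemma dfac_cat x y (s t : seq D) : same x y -> dfac x s -> dfac y t -> dfac (dmul x y) (s ++ t).
Proof.
move=> sxy [Hs Es] [Ht Et]; split.
  move=> z; rewrite mem_cat => /orP[/Hs|/Ht] [hz sz]; split=> //; rewrite /same isl_dmul //.
  by rewrite (eqP sxy).
have -> : done (dmul x y) = done y :> D by case: x y sxy {Hs Es Ht Et} => [a|a] [b|b].
rewrite foldr_cat Et -[in RHS]Es.
elim: s Hs {Es} => [|z s IH] Hs /=; first by rewrite dmul1 // /same.
rewrite IH => [|r hr]; last by apply: Hs; rewrite inE hr orbT.
have [_ sz] := Hs z (mem_head _ _).
rewrite dmulA // /same same_foldr.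
  by case: s Hs {IH} => [|r s] Hs /=; rewrite -(eqP sz) //; have [|_] := Hs r; rewrite ?inE ?eqxx ?orbT.
by case: s Hs {IH} => [|r s] Hs /=; rewrite ?(eqP sxy) //; have [|_ h] := Hs r; rewrite ?inE ?eqxx ?orbT // -(eqP h) (eqP sxy).
Qed.

Lemma same_trans x y z : same x y -> same x z = same y z.
Proof. by rewrite /same => /eqP->. Qed.

Definition cjl x y : D := dmul (dmul x y) (dinv x).

Lemma isl_cjl x y : isl (cjl x y) = isl x.
Proof. by rewrite /cjl !isl_dmul. Qed.

Lemma inj_cjl x y : same x y -> inj (cjl x y) = cj (inj x) (inj y).
Proof. by move=> s; rewrite /cjl !inj_mul ?inj_inv // /same ?isl_dmul isl_dinv. Qed.

Lemma dfac_cjl x y (s : seq D) : same x y -> dfac y s -> dfac (cjl x y) (map (cjl x) s).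
Proof.
move=> sxy [Hs E]; split.
  move=> z /mapP[r /Hs[hr sr] ->]; split; last by rewrite /same !isl_cjl.
  move: hr; case: (x) (y) (r) sxy sr => [a|a] [b|b] [c|c] //= _ _; exact: reflJ.
rewrite -{2}E; have sd : same x (done y) by rewrite /same isl_done.
have -> : done (cjl x y) = cjl x (done y).
  by case: (x) (y) sxy => [a|a] [b|b] //= _; rewrite /cjl /= mulg1 mulgV.
have {Hs} : forall z, z \in s -> same x z by move=> z /Hs[_]; rewrite (same_trans _ sxy).
elim: s {E} => //= z s IH Hs; rewrite IH => [|r hr]; last by apply: Hs; rewrite inE hr orbT.
have : same x (foldr (@dmul A B) (done y) s).
  case: s Hs {IH} => [|r s] Hs //=; rewrite /same isl_dmul; apply: Hs; by rewrite !inE eqxx orbT.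
have : same x z by apply: Hs; exact: mem_head.
by case: (x) (z) (foldr _ _ _) => [a|a] [b|b] [c|c] //= _ _; rewrite /cjl /= !mulgA mulgVK.
Qed.

(** The factors [nu] are pushed back through the construction of the diagram to the insertion of the
    class of the letter, where they join its factorization. Insertions elsewhere are passed by block
    moves. *)
Lemma reads_mul w t p q l u v nu s : w = p ++ (l, dmul u v) :: q ->
  t = map (cj (lev p)) (map inj nu) ++ s -> same u v -> dfac u nu ->
  Reads (p ++ (l, v) :: q) s -> Reads w t.
Proof.
move=> -> -> suv hu; move: {-1}(p ++ _ :: _) (erefl (p ++ (l, v) :: q)) => w0 E H.
elim: H p q l u v nu suv hu E => {w t w0 s} [|p0 q0 l0 x nu0 s fr nx r IH|p0 q0 l0 x y s sxy r IH|w s t h r IH]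
   p q l u v nu suv hu E.
- by case: (p) E.
- case: (cat_cons_eq (esym E)) => [[e [ep eq]]|[ep [e1 e2] eq]|[e [ep eq]]].
  + subst p q0.
    have {}IH := IH (p0 ++ e) q l u v nu suv hu.
    rewrite -!catA /= in IH *; have {}IH := IH erefl.
    apply: (@reads_heq _ _ _ (map (cj (lev p0)) (map inj nu0) ++ (map (cj (lev (p0 ++ e))) (map inj nu) ++ s))).
      rewrite !catA; apply: heq_catr; apply: heq_trans (heq_block _ _) _.
      rewrite gp_cj (dfac_inj nx) map_cj.
      have -> : cj (lev p0) (inj x) * lev (p0 ++ e) = lev (p0 ++ (l0, x) :: e).
        by rewrite !lev_cat lev_cons /cj !mulgA mulgVK.
      exact: heq_refl.
    apply: reads_ins => //; first by move: fr; rewrite !map_cat.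
  + subst p0 l0 x q0.
    rewrite catA -!map_cat; apply: reads_ins => //; exact: dfac_cat.
  + subst p0 q.
    have {}IH := IH p (e ++ q0) l u v nu suv hu.
    rewrite -!catA /= in IH *; have {}IH := IH erefl.
    apply: (@reads_heq _ _ _ (map (cj (lev (p ++ (l, dmul u v) :: e))) (map inj nu0) ++ (map (cj (lev p)) (map inj nu) ++ s))).
      apply: heq_sym; rewrite !catA; apply: heq_catr; apply: heq_trans (heq_block _ _) _.
      rewrite gp_cj (dfac_inj hu) map_cj.
      have -> : cj (lev p) (inj u) * lev (p ++ (l, v) :: e) = lev (p ++ (l, dmul u v) :: e).
        by rewrite !lev_cat !lev_cons inj_mul // /cj !mulgA mulgVK.
      exact: heq_refl.
    apply: (@reads_ins_eq _ _ (p ++ (l, dmul u v) :: e) q0 l0 x nu0 _ _ erefl) => //.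
    * by rewrite -catA.
    * by move: fr; rewrite !map_cat.
    * by rewrite -catA.
- case: (cat_cons_eq (esym E)) => [[[|c e] [ep eq]]|[ep [e1 e2] eq]|[e [ep eq]]].
  + case: eq => e1 e2 e3; subst p l0 y q0.
    (* The letter [v] is the right half of a split letter; [u] gets past the left half [x] by
       [x (u v) = (x u x^-1) (x v)]. *)
    have suv' : same (cjl x u) (dmul x v) by rewrite /same isl_cjl isl_dmul.
    have sxu : same x u by rewrite /same (eqP sxy) (eqP suv).
    have := IH p0 q l _ _ _ suv' (dfac_cjl sxu hu) erefl.
    have -> : dmul (cjl x u) (dmul x v) = dmul x (dmul u v).
      by case: (x) (u) (v) sxu suv => [a|a] [b|b] [c|c] //= _ _; rewrite /cjl /= -!mulgA mulKg.
    have -> : map (cj (lev (p0 ++ [:: (l, x)]))) (map inj nu) = map (cj (lev p0)) (map inj (map (cjl x) nu)).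
      rewrite -!map_comp; apply/eq_in_map => z hz /=.
      rewrite inj_cjl ?cjJ ?lev_cat ?lev_cons ?mulg1 //.
      by rewrite (same_trans _ sxu) //; case: (hu.1 z hz).
    move=> R; apply: (@reads_spl_eq _ p0 q l x (dmul u v)) => //; first by rewrite -catA.
    by rewrite /same isl_dmul (eqP sxu).
  + case: eq => e1 e2; subst p c q0.
    have := IH (p0 ++ (l0, dmul x y) :: e) q l u v nu suv hu; rewrite -!catA => /(_ erefl) R.
    apply: (@reads_spl_eq _ p0 (e ++ (l, dmul u v) :: q) l0 x y) => //.
    by move: R; rewrite !lev_cat /= !lev_cons inj_mul // -!mulgA.
  + subst p0 l0 x q.
    have suv' : same u (dmul v y) by rewrite /same isl_dmul.
    have := IH p q0 l _ _ _ suv' hu erefl; rewrite dmulA // => R.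
    by apply: (@reads_spl_eq _ p q0 l (dmul u v) y) => //; rewrite /same isl_dmul (eqP suv).
  + subst p0 q.
    have := IH p (e ++ (l0, dmul x y) :: q0) l u v nu suv hu; rewrite -!catA => /(_ erefl) R.
    apply: (@reads_spl_eq _ (p ++ (l, dmul u v) :: e) q0 l0 x y) => //; by rewrite -catA.
- apply: (@reads_heq _ _ _ (map (cj (lev p)) (map inj nu) ++ s)); first exact: heq_catl.
  exact: IH.
Qed.

Definition relab (a b k : nat) := if k == b then a else k.

Lemma relab_l a b : relab a b a = a.
Proof. by rewrite /relab; case: eqP. Qed.
Lemma relab_r a b : relab a b b = a.
Proof. by rewrite /relab eqxx. Qed.
Lemma relab_out a b k : k != b -> relab a b k = k.
Proof. by rewrite /relab => /negbTE->. Qed.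
Lemma relab_id a k : relab a a k = k.
Proof. by rewrite /relab; case: eqP. Qed.

Lemma mapl_cat g p q : mapl g (p ++ q) = mapl g p ++ mapl g q.
Proof. exact: map_cat. Qed.
Lemma mapl_cons g l x q : mapl g ((l, x) :: q) = (g l, x) :: mapl g q.
Proof. by []. Qed.

Lemma relab_fresh k a b (ls : seq nat) : k \notin ls -> k != a -> k != b -> k \notin map (relab a b) ls.
Proof.
move=> kl ka kb; apply/mapP => -[j jl]; rewrite /relab; case: eqP => _ e.
  by rewrite e eqxx in ka.
by rewrite e jl in kl.
Qed.

(** Merging commutes with every step of the construction except the insertion of one of the two
    letters. In that case the new letter hands its factors to the other one by [reads_mul]. *)
Lemma reads_merge p q l l' u v s : same u v -> Reads (p ++ (l, u) :: (l', v) :: q) s ->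
  Reads (mapl (relab l l') (p ++ (l, dmul u v) :: q)) s.
Proof.
move=> suv; move: {-1}(p ++ _ :: _) (esym (erefl (p ++ (l, u) :: (l', v) :: q))) => w E H.
elim: H p q l l' u v suv E => {w s} [|p0 q0 l0 x nu s fr nx r IH|p0 q0 l0 x y s sxy r IH|w s t h r IH]
   p q l l' u v suv E.
- by case: (p) E.
- case: (cat_cons_eq (esym E)) => [[e [ep eq]]|[ep [e1 e2] eq]|[[|c e] [ep eq]]].
  + subst p q0; have := IH (p0 ++ e) q l l' u v suv; rewrite -!catA => /(_ erefl).
    move: fr; rewrite map_cat mem_cat /= map_cat mem_cat /= !inE !negb_or => /and5P[f1 f2 f3 f4 f5].
    move=> R; apply: (@reads_ins_eq _ _ (mapl (relab l l') p0) (mapl (relab l l') (e ++ (l, dmul u v) :: q)) l0 x nu s) => //.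
    * by rewrite -?catA mapl_cat mapl_cons relab_out.
    * by rewrite lev_mapl.
    2: by rewrite -mapl_cat.
    rewrite -mapl_cat labels_mapl; apply: relab_fresh => //.
    by rewrite !map_cat /= !mem_cat inE !negb_or f1 f2 f3 f5.
  + subst p0 l0 x q0.
    (* The left letter came last: its factors join the class [l'], which is then renamed to [l]. *)
    have R := reads_mul erefl erefl suv nx r.
    suff <- : mapl (relab l l') (p ++ (l', dmul u v) :: q) = mapl (relab l l') (p ++ (l, dmul u v) :: q).
      apply: reads_relabel R => a b; move: fr; rewrite !map_cat !mem_cat /= !inE !negb_or => /and3P[f1 f2 f3].
      have H k : [|| k \in map fst p, k == l' | k \in map fst q] -> k != l.
        by case/or3P=> [h|/eqP->|h]; [apply: contraNneq f1 => <-|rewrite eq_sym|apply: contraNneq f3 => <-].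
      move=> /H ha /H hb; rewrite /relab; case: (a =P l') => [->|_]; case: (b =P l') => [->|_] // e.
        by rewrite -e eqxx in hb.
      by rewrite e eqxx in ha.
    by rewrite !mapl_cat !mapl_cons relab_l relab_r.
  + case: eq => e1 e2 e3; subst p0 l0 x q0.
    (* The right letter came last: to be multiplied from the left its factors have to pass [u],
       hence [u v = (u v u^-1) u]. *)
    have suv' : same (cjl u v) u by rewrite /same isl_cjl.
    have eN : map (cj (lev (p ++ [:: (l, u)]))) (map inj nu) = map (cj (lev p)) (map inj (map (cjl u) nu)).
      rewrite -!map_comp; apply/eq_in_map => z hz /=.
      rewrite inj_cjl ?cjJ ?lev_cat ?lev_cons ?mulg1 //.
      by rewrite (same_trans _ suv) //; case: (nx.1 z hz).
    have eM : dmul u v = dmul (cjl u v) u.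
      by case: (u) (v) suv => [a|a] [b|b] //= _; rewrite /cjl /= mulgVK.
    rewrite -catA /= in r.
    have R : Reads (p ++ (l, dmul u v) :: q) (map (cj (lev (p ++ [:: (l, u)]))) (map inj nu) ++ s).
      by apply: (reads_mul _ _ suv' (dfac_cjl suv nx) r); rewrite ?eM ?eN.
    apply: reads_relabel R => a b; move: fr; rewrite -catA /= !map_cat !mem_cat /= !inE => f1.
    have H k : [|| k \in map fst p, k == l | k \in map fst q] -> k != l' by apply: contraTneq => ->.
    by move=> /H ha /H hb; rewrite !relab_out.
  + case: eq => e1 e2; subst p0 c q.
    have := IH p (e ++ q0) l l' u v suv; rewrite -!catA => /(_ erefl).
    move: fr; rewrite -catA map_cat mem_cat /= map_cat !inE mem_cat !negb_or => /and5P[f1 f2 f3 f4 f5].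
    rewrite !mapl_cat !mapl_cons !mapl_cat mapl_cons [relab l l' l0]relab_out // => R.
    have eL : lev (p ++ [:: (l, u), (l', v) & e]) = lev (mapl (relab l l') (p ++ (l, dmul u v) :: e)).
      by rewrite lev_mapl !lev_cat !lev_cons inj_mul // -!mulgA.
    apply: (@reads_ins_eq _ _ (mapl (relab l l') (p ++ (l, dmul u v) :: e)) (mapl (relab l l') q0) l0 x nu s) => //.
    * by rewrite mapl_cat mapl_cons -catA.
    * by rewrite eL.
    * rewrite -mapl_cat labels_mapl; apply: relab_fresh => //.
      by rewrite -catA map_cat mem_cat /= map_cat inE mem_cat !negb_or f1 f2 f4 f5.
    * by rewrite mapl_cat mapl_cons -catA.
- case: (cat_cons_eq (esym E)) => [[[|c e] [ep eq]]|[ep [e1 e2] eq]|[[|c e] [ep eq]]].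
  + case: eq => e1 e2 e3; subst p l0 y q0.
    have := IH p0 q l l' (dmul x u) v; rewrite {1}/same isl_dmul (eqP sxy) => /(_ suv erefl).
    rewrite -dmulA // !mapl_cat !mapl_cons relab_l -catA; apply: reads_spl.
    by rewrite /same isl_dmul.
  + case: eq => e1 e2; subst p c q0.
    have := IH (p0 ++ (l0, dmul x y) :: e) q l l' u v suv; rewrite -!catA => /(_ erefl).
    rewrite !mapl_cat !mapl_cons; exact: reads_spl.
  + case: eq => e3 e4 e5; subst p0 l' l0 x y q0.
    by apply: reads_relabel r => a b _ _; rewrite !relab_id.
  + case: eq => e1 e2 e3; subst p0 l0 x q.
    rewrite -catA in IH; have := IH p q0 l l' u (dmul v y); rewrite {1}/same isl_dmul => /(_ suv erefl).
    rewrite dmulA // !mapl_cat !mapl_cons relab_l relab_r; apply: reads_spl.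
    by rewrite /same isl_dmul (eqP suv).
  + case: eq => e1 e2; subst p0 c q.
    rewrite -catA in IH; have := IH p (e ++ (l0, dmul x y) :: q0) l l' u v suv erefl => R.
    apply: (@reads_spl_eq _ (mapl (relab l l') (p ++ (l, dmul u v) :: e)) (mapl (relab l l') q0) (relab l l' l0) x y) => //.
      by rewrite !mapl_cat !mapl_cons !mapl_cat !mapl_cons -catA.
    by move: R; rewrite !mapl_cat !mapl_cons !mapl_cat !mapl_cons -catA.
- exact: reads_heq h (IH _ _ _ _ _ _ suv E).
Qed.

Lemma reads_del p q l x s : triv x -> Red (lev (p ++ q)) s -> Reads (p ++ (l, x) :: q) s ->
  Reads (p ++ q) s.
Proof.
move=> tx; move: {-1}(p ++ _ :: _) (esym (erefl (p ++ (l, x) :: q))) => w E Rs H.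
elim: H p q l x tx E Rs => {w s} [|p0 q0 l0 y nu s fr nx r IH|p0 q0 l0 y z s syz r IH|w s t h r IH]
   p q l x tx E Rs.
- by case: (p) E.
- case: (cat_cons_eq (esym E)) => [[e [ep eq]]|[ep [e1 e2] eq]|[e [ep eq]]].
  + subst p q0; have := IH (p0 ++ e) q l x tx; rewrite -!catA => /(_ erefl).
    have eL : lev (p0 ++ e ++ q) = gp s.
      by rewrite (reads_gp r) !lev_cat lev_cons inj_triv // mul1g.
    have [_ Rs2 _] := Red_split Rs; rewrite eL => /(_ Rs2); apply: reads_ins => //.
    move: fr; rewrite !map_cat !mem_cat /= !inE !negb_or => /and4P[-> -> _ ->] //.
  + subst p0 l0 y q0.
    have [Rs1 _ _] := Red_split Rs; case: Rs1 => _; rewrite gp_cj (dfac_inj nx) inj_triv // cjg1 len1.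
    by rewrite !size_map => /size0nil ->.
  + subst p0 q; have := IH p (e ++ q0) l x tx; rewrite -!catA => /(_ erefl).
    have eL : lev (p ++ e ++ q0) = gp s.
      by rewrite (reads_gp r) !lev_cat lev_cons inj_triv // mul1g mulgA.
    have [_ Rs2 _] := Red_split Rs; rewrite eL => /(_ Rs2) R.
    apply: (@reads_ins_eq _ _ (p ++ e) q0 l0 y nu s) => //; rewrite -?catA //.
      by rewrite !lev_cat lev_cons inj_triv // mul1g.
    by move: fr; rewrite !map_cat !mem_cat /= !inE !negb_or -?andbA => /and4P[-> _ -> ->].
- case: (cat_cons_eq (esym E)) => [[[|c e] [ep eq]]|[ep [e1 e2] eq]|[e [ep eq]]].
  + case: eq => e1 e2 e3; subst p l0 z q0; move: r; rewrite dmul_triv' // -catA //.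
  + case: eq => e1 e2; subst p c q0.
    have := IH (p0 ++ (l0, dmul y z) :: e) q l x tx; rewrite -!catA => /(_ erefl).
    move: Rs; rewrite -!catA !lev_cat !lev_cons inj_mul // -!mulgA => Rs /(_ Rs).
    exact: reads_spl.
  + by subst p0 l0 y q; move: r; rewrite dmul_triv.
  + subst p0 q.
    have := IH p (e ++ (l0, dmul y z) :: q0) l x tx; rewrite -!catA => /(_ erefl).
    move: Rs; rewrite !lev_cat !lev_cons inj_mul // -!mulgA => Rs /(_ Rs) R.
    by apply: (@reads_spl_eq _ (p ++ e) q0 l0 y z) => //; rewrite -catA.
- apply: (reads_heq h); apply: IH E _ => //; exact: Red_heq (heq_sym h) Rs.
Qed.

End Moves.

Lemma fresh_label (ls : seq nat) : exists l, l \notin ls.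
Proof.
exists (sumn ls).+1; elim: ls => //= a ls; rewrite !inE negb_or => IH.
apply/andP; split; first by apply/eqP; lia.
have : forall b, b \in ls -> b <= sumn ls.
  elim: ls {IH} => //= b ls IHl c; rewrite inE => /orP[/eqP->|/IHl]; lia.
by move=> H; apply/negP => /H; lia.
Qed.

(** * Every reduced factorization of a word is read off a diagram with that boundary *)

Section Existence.
Variables A B : rsys.
Local Notation D := (A + B)%type.
Local Notation F := (fp A B).
Local Notation lword := (seq (nat * D)).
Implicit Types (p q w : lword) (s : seq F) (l : nat) (x y : D).

Lemma reads_cat w1 s1 w2 s2 : {in map fst w1, forall l, l \notin map fst w2} ->
  Reads w1 s1 -> Reads w2 s2 -> Reads (w1 ++ w2) (s1 ++ s2).
Proof.
move=> dj R1 R2; elim: R2 dj => {w2 s2} [|p q l x nu s fr nx r IH|p q l x y s sxy r IH|w s t h r IH] dj.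
- by rewrite !cats0.
- have {}IH : Reads (w1 ++ p ++ q) (s1 ++ s).
    apply: IH => k /dj; rewrite !map_cat !mem_cat /= inE !negb_or => /and3P[-> _ ->] //.
  have fr' : l \notin map fst ((w1 ++ p) ++ q).
    rewrite -catA map_cat mem_cat negb_or fr andbT; apply/negP => /dj.
    by rewrite map_cat mem_cat /= inE eqxx orbT.
  apply: (@reads_heq _ _ _ (map (cj (lev (w1 ++ p))) (map inj nu) ++ s1 ++ s)).
    apply: heq_sym; rewrite !catA; apply: heq_catr; apply: heq_trans (heq_block _ _) _.
    by rewrite map_cj (reads_gp R1) -lev_cat; exact: heq_refl.
  apply: (@reads_ins_eq _ _ _ _ (w1 ++ p) q l x nu) => //; by rewrite -catA.
- rewrite catA; apply: reads_spl => //; rewrite -catA; apply: IH => k /dj.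
  by rewrite !map_cat !mem_cat /= !inE !negb_or => /and4P[-> -> _ ->].
- apply: reads_heq (heq_catl _ h) _; exact: IH.
Qed.

(** A trivial letter inserted with the empty factorization splits into [x] and its inverse; nesting
    such pairs puts [g g^-1] into the word at no cost in [s]. *)
Lemma reads_pairs p q s (g : seq D) : Reads (p ++ q) s ->
  exists L1 L2, [/\ map snd L1 = g, map snd L2 = winv g & Reads (p ++ L1 ++ L2 ++ q) s].
Proof.
elim: g p q => [|x g IH] p q R; first by exists [::], [::].
have [l fr] := fresh_label (map fst (p ++ q)).
have R1 : Reads (p ++ (l, dmul x (dinv x)) :: q) s.
  apply: (@reads_ins_eq _ _ _ _ p q l (dmul x (dinv x)) [::] s) => //; split=> //=.
  by case: (x) => a /=; rewrite mulgV.
have {R1}R2 : Reads ((p ++ [:: (l, x)]) ++ (l, dinv x) :: q) s.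
  by rewrite -catA; apply: reads_spl R1; rewrite /same isl_dinv.
have [L1 [L2 [e1 e2 R3]]] := IH _ _ R2.
exists ((l, x) :: L1), (L2 ++ [:: (l, dinv x)]); split; first by rewrite /= e1.
  by rewrite map_cat e2 /winv /= rev_cons -cats1.
by move: R3; rewrite -!catA /=.
Qed.

Lemma reads_conj s : (forall t, t \in s -> refl t) -> exists w, Reads w s.
Proof.
elim: s => [|t s IH] Hs; first by exists [::]; exact: reads_nil.
have [|w R] := IH; first by move=> r hr; apply: Hs; rewrite inE hr orbT.
have [g [x [hx ->]]] := Hs t (mem_head _ _).
have [L1 [L2 [e1 e2 R1]]] := @reads_pairs [::] w s (nf g) R.
have [l fr] := fresh_label (map fst (L1 ++ L2 ++ w)).
exists (L1 ++ (l, x) :: L2 ++ w).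
have -> : cj g (inj x) :: s = map (cj (lev L1)) (map inj [:: x]) ++ s.
  by rewrite /lev e1 ev_nf.
apply: reads_ins => //; split; first by move=> y; rewrite inE => /eqP->; split; rewrite ?same_refl.
by rewrite /= dmulr1 ?same_refl.
Qed.

Lemma nonreducedP (w : seq D) : ~~ reduced w ->
  (exists (p : seq D) x (q : seq D), w = p ++ x :: q /\ triv x) \/
  (exists (p : seq D) x y (q : seq D), w = p ++ x :: y :: q /\ same x y).
Proof.
elim: w => // x w IH nr; case tx: (triv x); first by left; exists [::], x, w.
case: w IH nr => [|y w] IH nr; first by rewrite /reduced /= tx in nr.
case sxy: (same x y); first by right; exists [::], x, y, w.
case: IH; first by move: nr; rewrite /reduced /= tx sxy.
  by move=> [p [z [q [-> tz]]]]; left; exists (x :: p), z, q.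
by move=> [p [z [z' [q [-> tz]]]]]; right; exists (x :: p), z, z', q.
Qed.

(** A nonempty word of value 1 is not reduced: it has a trivial letter to delete or two neighbours
    to merge, and both shorten [S]. Merging may rename labels in [w], so only its letters are
    kept. *)
Lemma reads_trunc S w s : lev S = 1 -> Red (lev w) s -> Reads (w ++ S) s ->
  exists2 w', map snd w' = map snd w & Reads w' s.
Proof.
have [n] := ubnP (size S); elim: n S w => // n IH [|z S] w hn eS Rs R.
  by exists w => //; rewrite cats0 in R.
have : ~~ reduced (map snd (z :: S)) by apply/negP => /(ev_eq1 eS).
case/nonreducedP=> [[p [x [q [e tx]]]]|[p [x [y [q [e sxy]]]]]].
- have [P [[|[l x'] Q] [eS' ep eq]]] := map_eq_cat e; rewrite //= in eq.
  case: eq => ex eq; subst x'; rewrite eS' in hn R eS.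
  have eS2 : lev (P ++ Q) = 1 by rewrite -eS !lev_cat lev_cons inj_triv // mul1g.
  rewrite catA in R; have R' : Reads ((w ++ P) ++ Q) s.
    by apply: reads_del R => //; rewrite -catA lev_cat eS2 mulg1.
  apply: (IH (P ++ Q)) => //; last by rewrite catA.
  by move: hn; rewrite !size_cat /= addnS.
- have [P [[|[l x'] [|[l' y'] Q]] [eS' ep eq]]] := map_eq_cat e; rewrite //= in eq.
  case: eq => ex ey eq; subst x' y'; rewrite eS' in hn R eS.
  rewrite catA in R; have := reads_merge sxy R.
  rewrite -catA mapl_cat => R'.
  have [||||w' e' Rw'] := IH (mapl (relab l l') (P ++ (l, dmul x y) :: Q)) (mapl (relab l l') w).
  + by move: hn; rewrite size_map !size_cat /= !addnS.
  + by rewrite lev_mapl -eS !lev_cat !lev_cons inj_mul // !mulgA.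
  + by rewrite lev_mapl.
  + exact: R'.
  + exists w' => //; by rewrite e' /mapl -map_comp.
Qed.

(** Start from any diagram of [s], write [v v^-1] in front of its word, and cancel everything after
    [v], which has value 1. *)
Lemma reads_ex (v : seq D) s : Red (ev v : F) s -> exists2 w, map snd w = v & Reads w s.
Proof.
move=> Rs; have [w R] := reads_conj Rs.1.1.
have [L1 [L2 [e1 e2 R1]]] := @reads_pairs [::] w s v R.
have [|||w' e R'] := @reads_trunc (L2 ++ w) L1 s; try exact: R1.
- by rewrite lev_cat /lev e2 ev_winv -/(lev w) -(reads_gp R) (Red_gp Rs) mulVg.
- by rewrite /lev e1.
- by exists w' => //; rewrite e e1.
Qed.

End Existence.

(** * Direct products, and length bounds obtained from diagrams *)

Section Product.
Variables G H : rsys.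
Definition prefl (z : G * H) := (refl z.1 /\ z.2 = 1) \/ (z.1 = 1 /\ refl z.2).

Lemma preflJ (g t : (G * H)%type) : prefl t -> prefl (cj g t).
Proof.
by case: g t => g1 g2 [t1 t2] [[h e]|[e h]]; [left|right]; split;
  [exact: (reflJ g1 h)|rewrite [t2]e; exact: cjg1|rewrite [t1]e; exact: cjg1|exact: (reflJ g2 h)].
Qed.
Lemma preflV (t : (G * H)%type) : prefl t -> prefl t^-1.
Proof.
by case: t => t1 t2 [[h e]|[e h]]; [left|right]; split;
  [exact: (reflV h)|rewrite [t2]e; exact: invg1|rewrite [t1]e; exact: invg1|exact: (reflV h)].
Qed.

Lemma gp_fst (u : seq (G * H)) : (gp u).1 = gp (map fst u).
Proof. exact: (@morph_gp _ _ (@fst G H)). Qed.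
Lemma gp_snd (u : seq (G * H)) : (gp u).2 = gp (map snd u).
Proof. exact: (@morph_gp _ _ (@snd G H)). Qed.

Lemma gp_pairl (s : seq G) : gp [seq (x, 1 : H) | x <- s] = (gp s, 1).
Proof. by elim: s => //= x s ->; congr pair; rewrite mulg1. Qed.
Lemma gp_pairr (s : seq H) : gp [seq (1 : G, x) | x <- s] = (1, gp s).
Proof. by elim: s => //= x s ->; congr pair; rewrite mulg1. Qed.

Lemma prefl_gen (z : (G * H)%type) : exists s, (forall t, t \in s -> prefl t) /\ gp s = z.
Proof.
case: z => x y; have [s [[Hs <-] _]] := len_red x; have [t [[Ht <-] _]] := len_red y.
exists ([seq (x, 1 : H) | x <- s] ++ [seq (1 : G, x) | x <- t]); split.
  by move=> r; rewrite mem_cat => /orP[] /mapP[r' hr ->]; [left|right]; split=> //=; auto.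
by rewrite gp_cat gp_pairl gp_pairr; congr pair; rewrite ?mulg1 ?mul1g.
Qed.

Definition prs := Rsys preflJ preflV prefl_gen.

(** Each reflection of the product lives in one coordinate. This additivity is what makes separating
    the classes of a diagram informative. *)
Lemma len_prs (z : prs) : len z = (len z.1 + len z.2)%N.
Proof.
apply/eqP; rewrite eqn_leq; apply/andP; split.
  case: z => x y; have [s [[Hs <-] <-]] := len_red x; have [t [[Ht <-] <-]] := len_red y.
  rewrite -(size_map (fun x => (x, 1 : H)) s) -(size_map (fun y => (1 : G, y)) t) -size_cat.
  apply: len_min; split.
    by move=> r; rewrite mem_cat => /orP[] /mapP[r' hr ->]; [left|right]; split=> //=; auto.
  by rewrite gp_cat gp_pairl gp_pairr; congr pair; rewrite ?mulg1 ?mul1g.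
have [s [[Hs <-] <-]] := len_red z; rewrite gp_fst gp_snd.
elim: s Hs {z} => [|t s IH] Hs; first by rewrite !len1.
have {}IH := IH (fun r hr => Hs r (@mem_behead _ (t :: s) r hr)).
rewrite !map_cons !gp_cons [size _]/=.
have h1 (K : rsys) (r : K) : refl r -> len r <= 1.
  by move=> hr; apply: (@len_min _ _ [:: r]); split; [move=> ?; rewrite inE => /eqP->|exact: gp1].
have [[/h1 l1 ->]|[-> /h1 l1]] := Hs t (mem_head _ _).
  by rewrite mul1g; apply: leq_trans (leq_add (lenM _ _) (leqnn _)) _; rewrite -addnA; exact: leq_add l1 IH.
by rewrite mul1g; apply: leq_trans (leq_add (leqnn _) (lenM _ _)) _; rewrite addnCA; exact: leq_add l1 IH.
Qed.
End Product.

Lemma nc_nth s i j k n : noncrossing s -> i < j -> j < k -> k < n -> n < size s ->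
  nth 0 s i = nth 0 s k -> nth 0 s j = nth 0 s n -> nth 0 s i = nth 0 s j.
Proof.
move=> nc ij jk kn ns e1 e2; apply: nc.
have H a t (u : seq nat) : a < size u -> subseq t (drop a.+1 u) -> subseq (nth 0 u a :: t) u.
  move=> au st; rewrite -{2}(cat_take_drop a u) (drop_nth 0 au).
  by apply: (subseq_trans _ (suffix_subseq _ _)); rewrite /= eqxx.
have E a b : a < b -> nth 0 s b = nth 0 (drop a.+1 s) (b - a.+1).
  by move=> ab; rewrite nth_drop; congr nth; lia.
have D a b : a < b -> drop b.+1 s = drop (b - a.+1).+1 (drop a.+1 s).
  by move=> ab; rewrite drop_drop; congr drop; lia.
suff : subseq [:: nth 0 s i; nth 0 s j; nth 0 s k; nth 0 s n] s by rewrite -e1 -e2.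
apply: (H); first lia.
rewrite (E i j) //; apply: (H); first by rewrite size_drop; lia.
rewrite -D // (E j k) //; apply: (H); first by rewrite size_drop; lia.
rewrite -D // (E k n) //; apply: (H); first by rewrite size_drop; lia.
exact: sub0seq.
Qed.

Definition flab (T : Type) (Z : pred nat) (w : seq (nat * T)) := [seq z <- w | Z z.1].

(** Labels between the first two letters of the first class cannot recur later, so the enclosed part
    is a shorter word of the same kind and has product 1. The two letters then become neighbours and
    are multiplied into one. *)
Lemma nc_gp1 (G : groupType) (w : seq (nat * G)) : noncrossing (map fst w) ->
  (forall l, l \in map fst w -> gp (map snd (flab (pred1 l) w)) = 1) -> gp (map snd w) = 1.
Proof.
have [n] := ubnP (size w); elim: n w => // n IH [|[l x] v] //= hn nc B1.
have := B1 l (mem_head _ _); rewrite /= eqxx /= -/(flab _ _) => Bl.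
have sub b (u r : seq (nat * G)) : b \notin map fst r -> flab (pred1 b) (u ++ r) = flab (pred1 b) u.
  move=> br; rewrite /flab filter_cat; suff -> : [seq z <- r | pred1 b z.1] = [::] by rewrite cats0.
  apply/eqP; rewrite -(negbK (_ == _)) -has_filter; apply: contra br => /hasP[z zr /eqP <-].
  exact: map_f.
case lv: (l \in map fst v); last first.
  have e : flab (pred1 l) v = [::] by rewrite -[v]cat0s sub ?lv.
  move: Bl; rewrite e /= mulg1 => ->; rewrite mul1g; apply: IH; first by lia.
    by apply: noncrossing_sub nc; exact: subseq_cons.
  move=> b bv; have := B1 b; rewrite /= inE bv orbT => /(_ isT).
  by case: eqP => // e'; rewrite -e' lv in bv.
have [u [y [r [ev lu]]]] : exists u y r, v = u ++ (l, y) :: r /\ l \notin map fst u.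
  elim: (v) lv => //= -[a b] v' IHv; rewrite inE; case: eqP => [->|] /=.
    by move=> _; exists [::], b, v'.
  move=> al /IHv [u [y [r [-> lu]]]]; exists ((a, b) :: u), y, r; split=> //=.
  by rewrite inE negb_or lu andbT; apply/eqP.
subst v; have ur b : b \in map fst u -> b \notin map fst r.
  move=> bu; apply/negP => br; suff e : l = b by rewrite e bu in lu.
  apply: nc; rewrite map_cat /= eqxx -[[:: b; l; b]]/([:: b] ++ [:: l; b]).
  by apply: cat_subseq; rewrite ?sub1seq //= eqxx sub1seq.
have gu : gp (map snd u) = 1.
  apply: IH; first by move: hn; rewrite size_cat /=; lia.
    apply: noncrossing_sub nc; rewrite map_cat; apply: (subseq_trans _ (subseq_cons _ _)).
    exact: prefix_subseq.
  move=> b bu; have := B1 b; rewrite /= map_cat inE mem_cat bu orbT => /(_ isT).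
  have /negbTE lb : l != b by apply: contraNneq lu => ->.
  by rewrite lb sub //= inE eq_sym lb ur.
rewrite map_cat gp_cat gu mul1g /= mulgA.
have := IH ((l, x * y) :: r); apply.
- by move: hn; rewrite size_cat /=; lia.
- apply: noncrossing_sub nc; rewrite map_cat /= eqxx.
  by apply: (subseq_trans _ (suffix_subseq _ _)); exact: subseq_cons.
- move=> b /=; rewrite inE => /orP[/eqP->|br].
    rewrite eqxx /=; move: Bl; rewrite /flab filter_cat /= eqxx /=.
    suff -> : [seq z <- u | z.1 == l] = [::] by rewrite /= mulgA.
    apply/eqP; rewrite -(negbK (_ == _)) -has_filter; apply: contra lu => /hasP[z zr /eqP <-].
    exact: map_f.
  have := B1 b; rewrite /= map_cat inE mem_cat /= inE br !orbT => /(_ isT).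
  case: (l =P b) => [e|/eqP/negbTE ne] /=; rewrite /flab filter_cat /= ?ne.
    rewrite e eqxx /= map_cat gp_cat /=; suff -> : [seq z <- u | z.1 == b] = [::] by rewrite /= mul1g mulgA.
    apply/eqP; rewrite -(negbK (_ == _)) -has_filter; apply: contra lu => /hasP[z zr /eqP].
    by rewrite e => <-; exact: map_f.
  suff -> : [seq z <- u | z.1 == b] = [::] by [].
  apply/eqP; rewrite -(negbK (_ == _)) -has_filter; apply: contraL br => /hasP[z zr /eqP <-].
  by apply: ur; exact: map_f.
Qed.

Section ReadsLen.
Variables A B : rsys.
Local Notation D := (A + B)%type.
Local Notation F := (fp A B).
Local Notation lword := (seq (nat * D)).
Implicit Types (p q w : lword) (s : seq F) (l : nat) (x y : D).

Lemma reads_len (C : rsys) (f : nat -> D -> C) w s :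
  (forall l x y, same x y -> f l (dmul x y) = f l x * f l y) ->
  (forall l x, drefl x -> refl (f l x) \/ f l x = 1) -> Reads w s ->
  len (gp [seq f z.1 z.2 | z <- w]) <= size s.
Proof.
move=> fM fT R; pose T (c : C) := refl c \/ c = 1.
have TJ g t : T t -> T (cj g t) by case=> [h|->]; [left; exact: reflJ|right; exact: cjg1].
have [u [<- uT <- _]] := reads_lift TJ fM fT R.
rewrite size_map -(size_map fst); apply: len_min1 => t /mapP[z /uT ? ->] //.
Qed.

(** Send the class [l] to a second coordinate and the rest of [Z] to 1. The first coordinate still
    evaluates to [lev w], which uses up all of [size s], so the second has length 0. *)
Lemma reads_kill w s (Z : pred nat) l : Reads w s -> size s = len (lev w : F) ->
  lev (flab (predC Z) w) = lev w -> Z l -> lev (flab (pred1 l) w) = 1.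
Proof.
move=> R sz eZ Zl; pose f k x : prs F F :=
  if k == l then (1, inj x) else if Z k then (1, 1) else (inj x, 1).
have fM k x y : same x y -> f k (dmul x y) = f k x * f k y.
  by move=> sxy; rewrite /f; case: eqP => _; last case: ifP => _; congr pair; rewrite /= ?mulg1 ?inj_mul.
have fT k x : drefl x -> refl (f k x) \/ f k x = 1.
  move=> hx; rewrite /f; case: eqP => _; first by left; right; split=> //=; exact: fprefl_inj.
  by case: ifP => _; [right|left; left; split=> //=; exact: fprefl_inj].
have e1 := reads_len fM fT R.
have E : gp [seq f z.1 z.2 | z <- w] = (lev (flab (predC Z) w), lev (flab (pred1 l) w)).
  elim: w {R sz eZ e1} => //= -[k x] w ->; rewrite /f /=; case: eqP => [->|_] /=.
    by rewrite Zl /=; congr pair; rewrite ?mul1g.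
  by case: ifP => _ /=; congr pair; rewrite /= ?mul1g.
by move: e1; rewrite E len_prs /= eZ sz => e1; apply: (@len_eq0 F); lia.
Qed.

End ReadsLen.

(** * Connectivity of the glued diagram *)

Section Stage.
Variables A B : rsys.
Local Notation D := (A + B)%type.
Local Notation F := (fp A B).
Local Notation lword := (seq (nat * D)).
Implicit Types (V : lword) (s : seq F) (l : nat) (x y : D) (Z : pred nat).

Lemma flab_cat Z V V' : flab Z (V ++ V') = flab Z V ++ flab Z V'.
Proof. exact: filter_cat. Qed.

Lemma mem_flab Z V l : l \in map fst (flab Z V) -> Z l /\ l \in map fst V.
Proof.
by case/mapP=> -[k x]; rewrite mem_filter => /andP[/= Zk h] ->; split=> //; exact: (map_f fst h).
Qed.

Lemma flab_notin l V : l \notin map fst V -> flab (pred1 l) V = [::].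
Proof.
move=> h; apply/eqP; rewrite -(negbK (_ == _)) -has_filter; apply: contra h => /hasP[z zr /eqP <-].
exact: map_f.
Qed.

(** By noncrossing, a class of [Z] met between two letters of class [l] lies entirely between them,
    so [nc_gp1] makes the [Z]-part between them trivial. *)
Lemma flab_const Z V V1 V1' V2 V2' l x y : noncrossing (map fst V) ->
  (forall k, Z k -> lev (flab (pred1 k) V) = 1) -> ~~ Z l ->
  V = V1 ++ (l, x) :: V1' -> V = V2 ++ (l, y) :: V2' -> lev (flab Z V1) = lev (flab Z V2).
Proof.
suff H V0 U1 U2 r k a b : noncrossing (map fst V0) ->
    (forall k, Z k -> lev (flab (pred1 k) V0) = 1) -> ~~ Z k ->
    V0 = U1 ++ (k, a) :: r ++ (k, b) :: U2 -> lev (flab Z r) = 1.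
  move=> nc Z1 Zl e1 e2; case: (cat_cons_eq (etrans (esym e1) e2)) => [[r [e3 e4]]|[-> _ _]|[r [e3 e4]]] //.
    rewrite e4 in e1; rewrite e3 flab_cat lev_cat /= (negbTE Zl) (H _ _ _ _ _ _ _ nc Z1 Zl e1).
    by rewrite mulg1.
  rewrite e4 in e2; rewrite e3 flab_cat lev_cat /= (negbTE Zl) (H _ _ _ _ _ _ _ nc Z1 Zl e2).
  by rewrite mulg1.
move=> nc Z1 Zk e.
have -> : lev (flab Z r) = gp (map snd [seq (z.1, inj z.2) | z <- flab Z r]).
  by rewrite -map_comp /lev /ev -map_comp.
apply: nc_gp1.
  have -> : map fst [seq (z.1, inj z.2) | z <- flab Z r] = map fst (flab Z r) by rewrite -map_comp.
  apply: noncrossing_sub nc; rewrite e map_cat /= map_cat.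
  apply: (subseq_trans _ (suffix_subseq _ _)); apply: (subseq_trans _ (subseq_cons _ _)).
  apply: (subseq_trans _ (prefix_subseq _ _)); apply: map_subseq; exact: filter_subseq.
move=> c; rewrite -map_comp => /mem_flab [Zc cr].
have kc : k != c by apply: contraNneq Zk => ->.
rewrite -(Z1 c Zc) e flab_cat lev_cat /= (negbTE kc) -/(flab _ _) flab_cat lev_cat /= (negbTE kc) -/(flab _ _).
have nc' : noncrossing (map fst U1 ++ k :: map fst r ++ k :: map fst U2).
  by move: nc; rewrite e map_cat /= map_cat.
rewrite (@flab_notin _ U1) ?mul1g; last first.
  apply/negP => h; case/eqP: kc; apply/esym; apply: nc'.
  rewrite -[[:: c; k; c; k]]/([:: c] ++ [:: k; c; k]); apply: cat_subseq; rewrite ?sub1seq //= eqxx.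
  by rewrite -[[:: c; k]]/([:: c] ++ [:: k]); apply: cat_subseq; rewrite ?sub1seq ?mem_head.
rewrite (@flab_notin _ U2) ?mulg1; last first.
  apply/negP => h; case/eqP: kc; apply: nc'.
  apply: (subseq_trans _ (suffix_subseq _ _)); rewrite /= eqxx.
  rewrite -[[:: c; k; c]]/([:: c] ++ [:: k; c]); apply: cat_subseq; rewrite ?sub1seq //= eqxx.
  by rewrite sub1seq.
rewrite /lev /ev -map_comp; congr gp.
elim: (r) => //= z r' IH; case Zz: (Z z.1) => /=; rewrite /flab /= in IH *.
  by case: eqP => /= _; rewrite IH.
by rewrite IH; case: eqP => // ez; rewrite ez Zc in Zz.
Qed.

Variables (p q : nat -> nat) (w : nat -> D) (la lb : nat) (x1 x2 : D).

Definition pl i : nat * D := (p i, w i).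
Definition ql i : nat * D := (q i, dinv (w i)).
(** The first [k] letters of [a], their inverses in reverse order, and the two letters of [h]: what
    is left of [a (a^-1 h)] after cancelling the inner pairs. The labels are the vertices of a graph
    with an edge from [p i] to [q i]. *)
Definition stagew k : lword :=
  map pl (iota 0 k) ++ map ql (rev (iota 0 k)) ++ [:: (la, x1); (lb, x2)].

Definition eta Z (js : seq nat) : F := gp [seq inj (w j) | j <- js & Z (p j)].

Lemma eta_cat Z js js' : eta Z (js ++ js') = eta Z js * eta Z js'.
Proof. by rewrite /eta filter_cat map_cat gp_cat. Qed.

Lemma eta_pl Z js : lev (flab Z (map pl js)) = eta Z js.
Proof.
by elim: js => //= j js IH; rewrite /eta /=; case: ifP => _; rewrite ?lev_cons IH.
Qed.

Lemma eta_ql Z js : (forall j, j \in js -> Z (p j) = Z (q j)) ->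
  lev (flab Z (map ql (rev js))) = (eta Z js)^-1.
Proof.
elim: js => [|j js IH] H; first by rewrite invg1.
rewrite rev_cons map_rcons -cats1 flab_cat lev_cat IH => [|k hk]; last by apply: H; rewrite inE hk orbT.
rewrite /eta /= (H j (mem_head _ _)); case: (Z (q j)) => /=.
  by rewrite lev_cons mulg1 inj_inv invgM.
by rewrite mulg1.
Qed.

Section Fixed.
Variables (k : nat) (s : seq F).
Local Notation V := (stagew k).
Hypothesis HR : Reads V s.
Hypothesis Hsz : size s = len (inj x1 * inj x2 : F).

Lemma mem_pl i : i < k -> pl i \in V.
Proof. by move=> ik; rewrite mem_cat map_f // mem_iota. Qed.
Lemma mem_ql i : i < k -> ql i \in V.
Proof. by move=> ik; rewrite !mem_cat map_f ?orbT // mem_rev mem_iota. Qed.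
Lemma mem_la : (la, x1) \in V.
Proof. by rewrite !mem_cat inE eqxx ?orbT. Qed.
Lemma mem_lb : (lb, x2) \in V.
Proof. by rewrite !mem_cat !inE eqxx ?orbT. Qed.

Lemma stage_side_pb i : i < k -> p i = lb -> same (w i) x2.
Proof. by move=> /mem_pl + e; rewrite /pl e => h1; exact: (reads_mono HR h1 mem_lb). Qed.
Lemma stage_side_qb i : i < k -> q i = lb -> same (w i) x2.
Proof.
move=> /mem_ql + e; rewrite /ql e => h1.
by have := reads_mono HR h1 mem_lb; rewrite /same !isl_dinv.
Qed.

(** Some letter of class [l] has [Z]-part [g] in front of it. By [occ_const] this value depends only
    on the class, which makes it a height function on the classes outside [Z]. *)
Definition occ Z l g := exists V1 x V', V = V1 ++ (l, x) :: V' /\ lev (flab Z V1) = g.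
Definition zclosed Z := forall i, i < k -> Z (p i) = Z (q i).

Lemma occ_p Z i : i < k -> occ Z (p i) (eta Z (iota 0 i)).
Proof.
move=> ik; exists (map pl (iota 0 i)), (w i), (map pl (iota i.+1 (k - i.+1)) ++ map ql (rev (iota 0 k)) ++ [:: (la, x1); (lb, x2)]).
split; last exact: eta_pl.
rewrite /stagew; have -> : k = (i + (k - i.+1).+1)%N by lia.
rewrite iotaD map_cat -catA /= add0n; congr (_ ++ (_ :: _ ++ _)).
by congr (map _ (iota _ _)); lia.
Qed.

Lemma occ_q Z i : zclosed Z -> i < k -> occ Z (q i) (eta Z (iota 0 i.+1)).
Proof.
move=> Zc ik; exists (map pl (iota 0 k) ++ map ql (rev (iota i.+1 (k - i.+1)))), (dinv (w i)),
  (map ql (rev (iota 0 i)) ++ [:: (la, x1); (lb, x2)]).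
have ek : iota 0 k = iota 0 i.+1 ++ iota i.+1 (k - i.+1).
  by rewrite -{1}(subnKC ik) iotaD.
split.
  rewrite /stagew -catA; congr (_ ++ _); rewrite ek rev_cat map_cat -catA; congr (_ ++ _).
  by rewrite -[in iota 0 i.+1]addn1 iotaD rev_cat map_cat -catA.
rewrite flab_cat lev_cat eta_pl eta_ql => [|j]; last by rewrite mem_iota => /andP[_ h]; apply: Zc; lia.
by rewrite ek eta_cat mulgK.
Qed.

Lemma eta_all Z js : zclosed Z -> (forall j, j \in js -> j < k) ->
  lev (flab Z (map pl js ++ map ql (rev js))) = 1.
Proof.
move=> Zc hj; rewrite flab_cat lev_cat eta_pl eta_ql ?mulgV // => j /hj; exact: Zc.
Qed.

Lemma occ_la Z : zclosed Z -> occ Z la 1.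
Proof.
move=> Zc; exists (map pl (iota 0 k) ++ map ql (rev (iota 0 k))), x1, [:: (lb, x2)].
by rewrite -catA; split=> //; apply: eta_all => // j; rewrite mem_iota.
Qed.

Lemma occ_lb Z : zclosed Z -> ~~ Z la -> occ Z lb 1.
Proof.
move=> Zc Zla; exists (map pl (iota 0 k) ++ map ql (rev (iota 0 k)) ++ [:: (la, x1)]), x2, [::].
rewrite -!catA; split=> //; rewrite catA flab_cat /= (negbTE Zla) cats0.
by apply: eta_all => // j; rewrite mem_iota.
Qed.

Lemma stage_lev : lev V = inj x1 * inj x2.
Proof.
have e : lev (map pl (iota 0 k) ++ map ql (rev (iota 0 k))) = 1.
  rewrite -[X in lev X]filter_predT; apply: (@eta_all predT) => // j; by rewrite mem_iota.
by rewrite /stagew catA lev_cat e mul1g !lev_cons mulg1.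
Qed.

Lemma stage_kill Z : zclosed Z -> ~~ Z la -> ~~ Z lb -> forall l, Z l -> lev (flab (pred1 l) V) = 1.
Proof.
move=> Zc Za Zb l; apply: (reads_kill HR); first by rewrite stage_lev.
rewrite stage_lev /stagew catA flab_cat lev_cat eta_all.
- by rewrite /= Za Zb mul1g !lev_cons mulg1.
- by move=> i hi; rewrite /= Zc.
- by move=> j; rewrite mem_iota.
Qed.

Lemma occ_const Z l g g' : zclosed Z -> ~~ Z la -> ~~ Z lb -> ~~ Z l -> occ Z l g -> occ Z l g' -> g = g'.
Proof.
move=> Zc Za Zb Zl [V1 [x [V' [e <-]]]] [V2 [y [V2' [e2 <-]]]].
exact: (flab_const (reads_nc HR) (stage_kill Zc Za Zb) Zl e e2).
Qed.

Hypothesis Hnt : forall i, i < k -> ~~ triv (w i).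
Hypothesis Halt : forall i, i.+1 < k -> ~~ same (w i) (w i.+1).
Hypothesis Hne : forall i, i.+1 = k -> p i <> q i.

Lemma inj_eq1 x : inj x = 1 :> F -> triv x.
Proof.
by move=> /(congr1 (@nf A B)); rewrite /= /act; case: ifP.
Qed.

(** Every component of the graph contains [la] or [lb]. If a union of components misses both and
    first meets the word at letter [i0], then the classes lying at height [w i0] over it form
    another such union, which first meets the word at [i0.+1]. The march ends at the last letter,
    which would be alone on its class and hence trivial. *)
Lemma stage_conn Z : zclosed Z -> ~~ Z la -> ~~ Z lb -> forall i, i < k -> ~~ Z (p i).
Proof.
suff H i0 Z' : i0 < k -> zclosed Z' -> ~~ Z' la -> ~~ Z' lb -> (forall i, i < i0 -> ~~ Z' (p i)) -> ~~ Z' (p i0).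
  move=> Zc Za Zb i; elim/ltn_ind: i => i IH ik; apply: H => // j ji; apply: IH => //; lia.
move: {2}(k - i0)%N (leqnn (k - i0)) => n; elim: n i0 Z' => [|n IH] i0 Z' hn hk; first lia.
move=> Zc0 Za0 Zb0 Zmin0; apply/negP => Z0'.
pose b := isl (w i0).
(* Only the classes on the side of [w i0] are kept, so that the next letter, which is on the other
   side, lies outside [Z1]. *)
pose Z1 l := Z' l && has (fun z => (z.1 == l) && (isl z.2 == b)) V.
have Z1E l x : (l, x) \in V -> Z1 l = Z' l && (isl x == b).
  move=> h; rewrite /Z1; congr (_ && _); apply/hasP/idP.
    by case=> -[l' y] h' /= /andP[/eqP e /eqP <-]; rewrite e in h'; exact: (reads_mono HR h h').
  by move=> e; exists (l, x); rewrite //= eqxx.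
have Zc : zclosed Z1.
  by move=> i ik; rewrite (Z1E _ _ (mem_pl ik)) (Z1E _ _ (mem_ql ik)) isl_dinv Zc0.
have Za : ~~ Z1 la by rewrite /Z1 negb_and Za0.
have Zb : ~~ Z1 lb by rewrite /Z1 negb_and Zb0.
have Zmin i : i < i0 -> ~~ Z1 (p i) by move=> /Zmin0 h; rewrite /Z1 negb_and h.
have Z0 : Z1 (p i0) by rewrite (Z1E _ _ (mem_pl hk)) Z0' eqxx.
have eta0 i : i <= i0 -> eta Z1 (iota 0 i) = 1.
  move=> ii; rewrite /eta; suff -> : [seq j <- iota 0 i | Z1 (p j)] = [::] by [].
  apply/eqP; rewrite -(negbK (_ == _)) -has_filter; apply/hasPn => j; rewrite mem_iota => h.
  by apply: Zmin; lia.
have eta1 : eta Z1 (iota 0 i0.+1) = inj (w i0).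
  by rewrite -addn1 iotaD eta_cat eta0 // mul1g /eta /= Z0 /= mulg1.
have ne1 : inj (w i0) <> 1 :> F by move=> /inj_eq1; apply/negP; exact: Hnt.
(* At the innermost letter, [Hne] and the minimality of [i0] leave no other letter on its class, yet
   the class has product 1. *)
have [ek|nk] := eqVneq i0.+1 k.
  case: ne1; rewrite -(stage_kill Zc Za Zb Z0).
  rewrite /stagew -ek -[in iota 0 i0.+1]addn1 iotaD rev_cat !map_cat !flab_cat !lev_cat /= eqxx.
  have F1 (f : nat -> nat * D) js : (forall j, j \in js -> (f j).1 <> p i0) ->
      lev (flab (pred1 (p i0)) (map f js)) = 1.
    by elim: js => //= j js IHj hj; rewrite (introF eqP (hj j (mem_head _ _))) IHj // => j' h; apply: hj; rewrite inE h orbT.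
  rewrite !F1.
  - have /eqP/negbTE -> : q i0 <> p i0 by move/esym; apply: Hne.
    have /eqP/negbTE -> : la <> p i0 by move=> e; rewrite e Z0 in Za.
    have /eqP/negbTE -> : lb <> p i0 by move=> e; rewrite e Z0 in Zb.
    by rewrite lev_cons !mulg1 mul1g.
  - move=> j; rewrite mem_rev mem_iota => h /= e.
    have := Zmin j; rewrite Zc; last by lia.
    by rewrite e Z0 => /(_ h).
  - move=> j; rewrite mem_iota => h /= e.
    by have := Zmin j h; rewrite e Z0.
have hk1 : i0.+1 < k by lia.
(* The classes outside [Z1] at height [w i0]. Since [la] and [lb] have height 1, both are avoided,
   and so are all letters up to [i0]. *)
pose Z2 l := ~~ Z1 l && has (fun i => (eta Z1 (iota 0 i) == inj (w i0)) && ((p i == l) || (q i == l))) (iota 0 k).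
have OC l g g' : ~~ Z1 l -> occ Z1 l g -> occ Z1 l g' -> g = g' by exact: occ_const.
have OP l i : ~~ Z1 l -> i < k -> (p i == l) || (q i == l) -> occ Z1 l (eta Z1 (iota 0 i)).
  move=> Zl ik /orP[/eqP<-|/eqP e]; first exact: occ_p.
  have := occ_q Zc ik; rewrite e -addn1 iotaD eta_cat [eta Z1 (iota _ 1)]/eta /= add0n.
  by rewrite (Zc i ik) e (negbTE Zl) mulg1.
have Z2E l i : i < k -> (p i == l) || (q i == l) -> Z2 l = ~~ Z1 l && (eta Z1 (iota 0 i) == inj (w i0)).
  move=> ik il; rewrite /Z2; case Zl: (Z1 l) => //=; apply/hasP/idP => [[j]|e].
    rewrite mem_iota => jk /andP[/eqP e jl]; apply/eqP; rewrite -e.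
    by apply: (OC l); rewrite ?Zl //; apply: OP; rewrite ?Zl.
  by exists i; rewrite ?mem_iota // e il.
have Z2c : zclosed Z2.
  by move=> i ik; rewrite (@Z2E _ i) ?eqxx // (@Z2E _ i) ?eqxx ?orbT // Zc.
have Z2n l : occ Z1 l 1 -> ~~ Z2 l.
  move=> o; apply/negP => /andP[Zl /hasP[j]]; rewrite mem_iota => jk /andP[/eqP e jl].
  by apply: ne1; rewrite -e; apply: OC o => //; exact: OP.
have hn1 : k - i0.+1 <= n by lia.
have Zm i : i < i0.+1 -> ~~ Z2 (p i).
  move=> ii; rewrite (@Z2E _ i) ?eqxx //; last lia.
  by rewrite eta0 // negb_and orbC; apply/orP; left; apply/eqP => e; apply: ne1.
have := IH i0.+1 Z2 hn1 hk1 Z2c (Z2n _ (occ_la Zc)) (Z2n _ (occ_lb Zc Za)) Zm.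
apply/negP; rewrite negbK (@Z2E _ i0.+1) ?eqxx // eta1 eqxx andbT (Z1E _ _ (mem_pl hk1)) negb_and.
by apply/orP; right; move: (Halt hk1); rewrite /same eq_sym.
Qed.
End Fixed.
End Stage.

(** * Components and forests of a graph given by a list of edges *)

Section Components.
Variables p q : nat -> nat.

(** Union-find: adding an edge renames the component of its [q]-end to that of its [p]-end. *)
Fixpoint comp (js : seq nat) : nat -> nat :=
  if js is j :: js' then relab (comp js' (p j)) (comp js' (q j)) \o comp js' else id.

Lemma relab_eq a b x y : relab a b x = relab a b y -> x <> y -> (x = a /\ y = b) \/ (x = b /\ y = a).
Proof.
by rewrite /relab; case: (x =P b) => [->|_]; case: (y =P b) => [->|_] //; [right|left].
Qed.

Lemma comp_edge js j : j \in js -> comp js (p j) = comp js (q j).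
Proof.
elim: js => //= k js IH; rewrite inE => /orP[/eqP->|/IH ->] //.
by rewrite relab_l relab_r.
Qed.

Lemma comp_univ (T : Type) (g : nat -> T) js x y : (forall j, j \in js -> g (p j) = g (q j)) ->
  comp js x = comp js y -> g x = g y.
Proof.
elim: js x y => [|k js IH] x y Hg /=; first by move=> ->.
have Hg' j : j \in js -> g (p j) = g (q j) by move=> h; apply: Hg; rewrite inE h orbT.
move=> e; have [/IH -> //|/eqP ne] := eqVneq (comp js x) (comp js y).
have gk := Hg k (mem_head _ _).
have [[e1 e2]|[e1 e2]] := relab_eq e ne.
  by rewrite (IH _ _ Hg' e1) gk (IH _ _ Hg' e2).
by rewrite (IH _ _ Hg' e1) -gk (IH _ _ Hg' e2).
Qed.

Fixpoint forest (js : seq nat) := if js is j :: js' then comp js' (p j) <> comp js' (q j) /\ forest js' else True.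

(** Suppose that adding an earlier edge [k] is what joins the ends of [e]. Then the ends of [k] are
    joined through [e] and the remaining edges, contrary to the forest condition at [k]. *)
Lemma forest_cut js e js' : forest (js ++ e :: js') -> comp (js ++ js') (p e) <> comp (js ++ js') (q e).
Proof.
elim: js => [[]//|k js IH] /= [ne /IH {}IH] h.
have sub j : j \in js ++ js' -> comp (js ++ e :: js') (p j) = comp (js ++ e :: js') (q j).
  by move=> hj; apply: comp_edge; move: hj; rewrite !mem_cat inE => /orP[->|->]; rewrite ?orbT.
have ee : comp (js ++ e :: js') (p e) = comp (js ++ e :: js') (q e).
  by apply: comp_edge; rewrite mem_cat inE eqxx orbT.
have [[e1 e2]|[e1 e2]] := relab_eq h IH; apply: ne.
  by rewrite -(comp_univ sub e1) ee (comp_univ sub e2).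
by rewrite -(comp_univ sub e2) -ee (comp_univ sub e1).
Qed.

End Components.

(** * Cancelling the glued word from the inside; the gluing graph is a forest *)

Section Tower.
Variables A B : rsys.
Local Notation D := (A + B)%type.
Local Notation F := (fp A B).
Variables (al : A) (be : B) (w : nat -> D) (m : nat) (p q : nat -> nat) (la lb : nat) (s : seq F).
Hypothesis HR : Reads (stagew p q w la lb (inl al) (inr be) m) s.
Hypothesis Hsz : size s = len (inj (inl al) * inj (inr be) : F).
Hypothesis Hnt : forall i, i < m -> ~~ triv (w i).
Hypothesis Hside : forall i, i < m -> isl (w i) = ~~ odd i.
Hypothesis Hpq : forall i j, i < m -> j < m -> p i <> q j.

(** The classes after the pairs with index at least [k] have been merged and cancelled. *)
Definition cc k := comp p q (iota k (m - k)).
Local Notation W k := (stagew (cc k \o p) (cc k \o q) w (cc k la) (cc k lb) (inl al) (inr be) k).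

Lemma stagewS (p' q' : nat -> nat) la' lb' x1 x2 k : stagew p' q' w la' lb' x1 x2 k.+1 =
  map (pl p' w) (iota 0 k) ++ (p' k, w k) :: (q' k, dinv (w k)) ::
    (map (ql q' w) (rev (iota 0 k)) ++ [:: (la', x1); (lb', x2)]).
Proof. by rewrite /stagew -addn1 iotaD rev_cat !map_cat -catA. Qed.

Lemma ccS k : k < m -> cc k = relab (cc k.+1 (p k)) (cc k.+1 (q k)) \o cc k.+1.
Proof. by move=> km; rewrite /cc -(subnSK km). Qed.

(** The innermost letter and its inverse merge to a trivial letter, which can be deleted because [s]
    is a reduced factorization of [h]. *)
Lemma tower_reads k : k <= m -> Reads (W k) s.
Proof.
move=> km; rewrite -(subKn km); elim: (m - k)%N (leq_subr k m) => [|d IH] dm.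
  by rewrite subn0 /cc subnn.
have {IH} := IH (ltnW dm); have -> : (m - d = (m - d.+1).+1)%N by lia.
set j := (m - d.+1)%N => R; have jm : j < m by rewrite /j; lia.
rewrite stagewS in R.
have sw : same (w j) (dinv (w j)) by rewrite /same isl_dinv.
have R' := reads_merge sw R.
rewrite mapl_cat mapl_cons mapl_cat /= in R'.
have E : W j = mapl (relab ((cc j.+1 \o p) j) ((cc j.+1 \o q) j)) (map (pl (cc j.+1 \o p) w) (iota 0 j)) ++
     (mapl (relab ((cc j.+1 \o p) j) ((cc j.+1 \o q) j)) (map (ql (cc j.+1 \o q) w) (rev (iota 0 j)))
     ++ [:: (relab ((cc j.+1 \o p) j) ((cc j.+1 \o q) j) (cc j.+1 la), inl al);
            (relab ((cc j.+1 \o p) j) ((cc j.+1 \o q) j) (cc j.+1 lb), inr be)]).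
  by rewrite /stagew (ccS jm) /mapl -!map_comp.
rewrite E; apply: reads_del R'; first by case: (w j) => a /=; rewrite mulgV.
rewrite -E; split; last by rewrite stage_lev Hsz.
rewrite stage_lev; split; first exact: reads_refl HR.
by rewrite (reads_gp HR) stage_lev.
Qed.

Lemma conn k : k <= m -> (forall i, i.+1 = k -> cc k (p i) <> cc k (q i)) ->
  forall Z : pred nat, (forall i, i < k -> Z (cc k (p i)) = Z (cc k (q i))) -> ~~ Z (cc k la) -> ~~ Z (cc k lb) ->
  forall i, i < k -> ~~ Z (cc k (p i)).
Proof.
move=> km ne Z Zc Za Zb; apply: (stage_conn (tower_reads km)) => //.
- by move=> i ik; apply: Hnt; lia.
- by move=> i ik; rewrite /same !Hside /=; try lia; case: (odd i).
Qed.

Definition slab k := map (cc k \o p) (iota 0 k) ++ map (cc k \o q) (rev (iota 0 k)) ++ [:: cc k la; cc k lb].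

Lemma slab_nc k : k <= m -> noncrossing (slab k).
Proof.
move=> km; have := reads_nc (tower_reads km); rewrite /stagew !map_cat -!map_comp; exact.
Qed.
Lemma size_slab k : size (slab k) = k.*2.+2.
Proof. rewrite !size_cat !size_map size_rev size_iota /=; lia. Qed.
Lemma slab_p k i : i < k -> nth 0 (slab k) i = cc k (p i).
Proof. by move=> ik; rewrite nth_cat size_map size_iota ik (nth_map 0) ?size_iota // nth_iota. Qed.
Lemma slab_q k i : i < k -> nth 0 (slab k) (k.*2 - i.+1) = cc k (q i).
Proof.
move=> ik; rewrite nth_cat size_map size_iota.
have -> : (k.*2 - i.+1 < k)%N = false by lia.
rewrite nth_cat size_map size_rev size_iota.
have -> : (k.*2 - i.+1 - k < k)%N by lia.
rewrite (nth_map 0) ?size_rev ?size_iota; last lia.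
rewrite nth_rev ?size_iota; last lia.
rewrite nth_iota; last lia.
by rewrite /=; congr (cc k (q _)); lia.
Qed.
Lemma slab_a k : nth 0 (slab k) k.*2 = cc k la.
Proof.
rewrite nth_cat size_map size_iota; have -> : (k.*2 < k)%N = false by lia.
rewrite nth_cat size_map size_rev size_iota; have -> : (k.*2 - k < k)%N = false by lia.
by have -> : (k.*2 - k - k = 0)%N by lia.
Qed.
Lemma slab_b k : nth 0 (slab k) k.*2.+1 = cc k lb.
Proof.
rewrite nth_cat size_map size_iota; have -> : (k.*2.+1 < k)%N = false by lia.
rewrite nth_cat size_map size_rev size_iota; have -> : (k.*2.+1 - k < k)%N = false by lia.
by have -> : (k.*2.+1 - k - k = 1)%N by lia.
Qed.

(** The side of position [y] of [slab k], with [true] for the second factor: letters alternate, [la]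
    at [k.*2] is on the first side and [lb] after it on the second. *)
Definition pside k y := if y < k then odd y else if y < k.*2 then odd (k.*2 - y.+1) else y == k.*2.+1.

Lemma slab_letter k y : k <= m -> y < k.*2.+2 -> exists2 x, (nth 0 (slab k) y, x) \in W k & isl x = ~~ pside k y.
Proof.
move=> km hy; rewrite /pside; case: ltnP => yk.
  by exists (w y); [rewrite slab_p //; exact: mem_pl|apply: Hside; lia].
case: ltnP => y2.
  exists (dinv (w (k.*2 - y.+1))); last by rewrite isl_dinv Hside //; lia.
  have -> : y = (k.*2 - (k.*2 - y.+1).+1)%N by lia.
  rewrite slab_q; last lia.
  have -> : (k.*2 - (k.*2 - (k.*2 - y.+1).+1).+1 = k.*2 - y.+1)%N by lia.
  by apply: (@mem_ql _ _ (cc k \o p) (cc k \o q)); lia.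
have [->|ny] := eqVneq y k.*2; first by exists (inl al); [rewrite slab_a; exact: mem_la|rewrite /=; case: eqP => //; lia].
have -> : y = k.*2.+1 by lia.
by exists (inr be); [rewrite slab_b; exact: mem_lb|rewrite eqxx].
Qed.

Lemma slab_side k y y' : k <= m -> y < k.*2.+2 -> y' < k.*2.+2 ->
  nth 0 (slab k) y = nth 0 (slab k) y' -> pside k y = pside k y'.
Proof.
move=> km /(slab_letter km) [x h1 e1] /(slab_letter km) [x' h2 e2] e; rewrite e in h1.
have := reads_mono (tower_reads km) h1 h2; rewrite /same e1 e2.
by case: (pside k y) (pside k y') => -[].
Qed.

Lemma slab_cross k a b c d : k <= m -> a < b -> b < c -> c < d -> d < k.*2.+2 ->
  nth 0 (slab k) a = nth 0 (slab k) c -> nth 0 (slab k) b = nth 0 (slab k) d -> pside k a = pside k b.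
Proof.
move=> km ab bc cd dk e1 e2; apply: slab_side => //; try lia.
by apply: (nc_nth (slab_nc km) ab bc cd _ e1 e2); rewrite size_slab.
Qed.

(** Suppose merging the ends of edge [j] first joins the ends of edge [l]. If [p l] meets [q j] and
    [q l] meets [p j], the classes cross. If [p l] meets [p j] and [q l] meets [q j], they fence off
    the classes of the other side between them, and these cannot reach [la] or [lb], contrary to
    [conn]. *)
Lemma good k l : k <= m -> l < k -> cc k (p l) <> cc k (q l).
Proof.
move=> km; rewrite -(subKn km); elim: (m - k)%N (leq_subr k m) l => [|d IH] dm l.
  by rewrite subn0 /cc subnn /= => lm; apply: Hpq.
have {IH} := IH (ltnW dm); have -> : (m - d = (m - d.+1).+1)%N by lia.
set j := (m - d.+1)%N => IH lj; have jm : j < m by rewrite /j; lia.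
rewrite (ccS jm) /= => e.
have nl := IH l (ltnW (leq_ltn_trans lj (ltnSn _))).
pose N := nth 0 (slab j.+1).
have P1 i : i < j.+1 -> N i = cc j.+1 (p i) by exact: slab_p.
have Q1 i : i < j.+1 -> N (j.+1.*2 - i.+1)%N = cc j.+1 (q i) by exact: slab_q.
have sP i : i < j.+1 -> pside j.+1 i = odd i by rewrite /pside => ->.
have sQ i : i < j.+1 -> pside j.+1 (j.+1.*2 - i.+1) = odd i.
  move=> ij; rewrite /pside; have -> : (j.+1.*2 - i.+1 < j.+1)%N = false by lia.
  have -> : (j.+1.*2 - i.+1 < j.+1.*2)%N by lia.
  by congr odd; lia.
have cross a b c d' := @slab_cross j.+1 a b c d' jm.
have side y y' := @slab_side j.+1 y y' jm.
have eN1 : (j.+1.*2 - j.+1 = j.+1)%N by lia.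
have lj1 : l < j.+1 by lia.
have jj1 : j < j.+1 by lia.
have bN : j.+1.*2 - l.+1 < j.+1.*2.+2 by lia.
have [[e1 e2]|[e1 e2]] := relab_eq e nl; last first.
  have E1 : N l = N j.+1 by rewrite P1 // e1 -Q1 // eN1.
  have E2 : N j = N (j.+1.*2 - l.+1)%N by rewrite P1 // -e2 -Q1.
  have h : N l = N j.
    by apply: (nc_nth (slab_nc jm) _ _ _ _ E1 E2); rewrite ?size_slab //; lia.
  by apply: nl; rewrite e2 -!P1.
rewrite -!P1 // in e1; rewrite -!Q1 // eN1 in e2.
have sl : pside j.+1 l = odd l by exact: sP.
have sj : pside j.+1 j = odd l by rewrite -sl; apply: side => //; lia.
have sj1 : pside j.+1 j.+1 = odd l by rewrite -{2}eN1 sQ // -sP.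
have sl1 : pside j.+1 (j.+1.*2 - l.+1) = odd l by exact: sQ.
(* Positions inside one of the two arcs, from [l] to [j] or mirrored, on the other side of the free
   product. Noncrossing keeps their classes inside the arcs. *)
pose pz y := [&& l < y, y < j.+1.*2 - l.+1, y != j, y != j.+1 & pside j.+1 y != odd l].
pose Z x := has (fun y => pz y && (N y == x)) (iota 0 j.+1.*2.+2).
have NZ y : pz y -> Z (N y).
  move=> py; apply/hasP; exists y; last by rewrite py eqxx.
  by rewrite mem_iota; move: py => /and5P[]; lia.
have ZN y0 : y0 < j.+1.*2.+2 -> Z (N y0) -> pz y0.
  move=> by0 /hasP[y]; rewrite mem_iota => yb /andP[/and5P[y1 y2 y3 y4 y5] /eqP eN].
  have s0 : pside j.+1 y0 = pside j.+1 y by apply: side.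
  have n1 : y0 != l by apply: contraNneq y5 => e0; rewrite -s0 e0 sl.
  have n2 : y0 != j by apply: contraNneq y5 => e0; rewrite -s0 e0 sj.
  have n3 : y0 != j.+1 by apply: contraNneq y5 => e0; rewrite -s0 e0 sj1.
  have n4 : y0 != (j.+1.*2 - l.+1)%N by apply: contraNneq y5 => e0; rewrite -s0 e0 sl1.
  have y5' : pside j.+1 y <> odd l by apply/eqP.
  apply/and5P; split=> //; last by rewrite s0.
    rewrite ltnNge; apply/negP => y0l; case: y5'.
    have [yj|jy] := ltnP y j.
      have c1 : y0 < l by lia.
      by rewrite -s0 -sl; apply: (cross y0 l y j) => //; lia.
    by rewrite -s0 -sj1; apply: (cross y0 j.+1 y (j.+1.*2 - l.+1)%N) => //; lia.
  rewrite ltnNge; apply/negP => y0l; case: y5'.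
  have [yj|jy] := ltnP y j.
    by rewrite -sl; apply/esym; apply: (cross l y j y0) => //; lia.
  by rewrite -sj1; apply/esym; apply: (cross j.+1 y (j.+1.*2 - l.+1)%N y0) => //; lia.
have Zc i : i < j.+1 -> Z (cc j.+1 (p i)) = Z (cc j.+1 (q i)).
  move=> ij; rewrite -P1 // -Q1 //; apply/idP/idP.
    have ib : i < j.+1.*2.+2 by lia.
    move=> /(ZN _ ib) /and5P; rewrite sP // => -[h1 h2 h3 h4 h5].
    by apply: NZ; apply/and5P; rewrite sQ //; split=> //; lia.
  have ib : j.+1.*2 - i.+1 < j.+1.*2.+2 by lia.
  move=> /(ZN _ ib) /and5P; rewrite sQ // => -[h1 h2 h3 h4 h5].
  by apply: NZ; apply/and5P; rewrite sP //; split=> //; lia.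
have Za : ~~ Z (cc j.+1 la).
  have ib : j.+1.*2 < j.+1.*2.+2 by lia.
  by apply/negP; rewrite -slab_a => /(ZN _ ib) /and5P[_ h _ _ _]; lia.
have Zb : ~~ Z (cc j.+1 lb).
  by apply/negP; rewrite -slab_b => /(ZN _ (ltnSn _)) /and5P[_ h _ _ _]; lia.
have nl1 : l.+1 != j.
  by apply/eqP => e0; have := sj; rewrite sP // -e0 /=; case: (odd l).
have ne i : i.+1 = j.+1 -> cc j.+1 (p i) <> cc j.+1 (q i) by move=> ei; apply: IH; lia.
have l1 : l.+1 < j.+1 by lia.
have := conn jm ne Zc Za Zb l1; apply/negP; rewrite negbK -P1 //.
apply: NZ; apply/and5P; rewrite sP; last lia.
by split=> //=; try lia; case: (odd l).
Qed.

Lemma cc_forest k : k <= m -> forest p q (iota k (m - k)).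
Proof.
move=> km; rewrite -(subKn km); elim: (m - k)%N (leq_subr k m) => [|d IH] dm; first by rewrite subn0 subnn.
have -> : (m - (m - d.+1) = d.+1)%N by lia.
rewrite /=; have e : (m - d.+1).+1 = (m - d)%N by lia.
split; last by have := IH (ltnW dm); rewrite e subKn // ltnW.
have := @good (m - d)%N (m - d.+1)%N (leq_subr _ _) _; rewrite /cc subKn ?e; last lia.
by apply; lia.
Qed.

Hypothesis Hm : 1 < m.

(** At stage 1 only [w 0] and its inverse are left beside [h]. Their classes cannot reach [lb],
    which is on the other side, so one of them is the class of [la]. If it were that of [p 0], it
    would separate letter 1 and its inverse from [lb] at stage 2. *)
Lemma first_la : cc 1 la = cc 1 (q 0).
Proof.
have m1 : 1 <= m by lia.
have g1 : cc 1 (p 0) <> cc 1 (q 0) by apply: good.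
have n1 i : i.+1 = 1%N -> cc 1 (p i) <> cc 1 (q i) by case: i.
pose Z x := (x == cc 1 (p 0)) || (x == cc 1 (q 0)).
have Zc i : i < 1 -> Z (cc 1 (p i)) = Z (cc 1 (q i)) by case: i => // _; rewrite /Z !eqxx ?orbT.
have Zb : ~~ Z (cc 1 lb).
  apply/negP => /orP[]/eqP/esym.
    by move=> /(stage_side_pb (tower_reads m1) (ltnSn 0)); rewrite /same Hside.
  by move=> /(stage_side_qb (tower_reads m1) (ltnSn 0)); rewrite /same Hside.
have : Z (cc 1 la).
  apply/negP => /negP Za; have := conn m1 n1 Zc Za Zb (ltnSn 0).
  by rewrite /Z eqxx.
case/orP=> /eqP // e1; exfalso.
have m2 : 2 <= m by [].
have g2 i : i.+1 = 2%N -> cc 2 (p i) <> cc 2 (q i) by move=> ei; apply: good; lia.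
have [i0 i1] : 0 < 2 /\ 1 < 2 by [].
pose N := nth 0 (slab 2).
have E0 : cc 2 (p 0) = N 0 by rewrite /N slab_p.
have E1 : cc 2 (p 1%N) = N 1%N by rewrite /N slab_p.
have E2 : cc 2 (q 1%N) = N 2 by rewrite -(@slab_q 2 1).
have E3 : cc 2 (q 0) = N 3 by rewrite -(@slab_q 2 0).
have E4 : cc 2 la = N 4 by rewrite -(slab_a 2).
have E5 : cc 2 lb = N 5 by rewrite -(slab_b 2).
have nN y y' : y < 6 -> y' < 6 -> pside 2 y != pside 2 y' -> N y != N y'.
  by move=> h h'; apply: contraNneq => /(slab_side m2 h h') ->.
have rN y y' : y < 6 -> y' < 6 -> ~~ pside 2 y -> ~~ pside 2 y' ->
    relab (N 1%N) (N 2) (N y) = relab (N 1%N) (N 2) (N y') -> N y = N y'.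
  move=> hy hy' sy sy'.
  by rewrite !relab_out //; apply: nN; rewrite // ?(negbTE sy) ?(negbTE sy').
(* The merge of stage 2 into stage 1 concerns classes of the second factor only, so the equality
   holds before it. *)
have e04 : N 4 = N 0.
  by apply: rN => //; move: e1; rewrite (ccS Hm) /= E0 E1 E2 E4.
pose Z2 x := (x == N 1%N) || (x == N 2).
have nZ y : y < 6 -> ~~ pside 2 y -> Z2 (N y) = false.
  by move=> hy sy; rewrite /Z2 !(negbTE (nN y _ hy _ _)) // (negbTE sy).
have Z2c i : i < 2 -> Z2 (cc 2 (p i)) = Z2 (cc 2 (q i)).
  case: i => [|[|//]] _; first by rewrite E0 E3 !nZ.
  by rewrite E1 E2 /Z2 !eqxx orbT.
have : Z2 (cc 2 lb).
  apply/negP => /negP Zlb; have Zla : ~~ Z2 (cc 2 la) by rewrite E4 nZ.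
  by have := conn m2 g2 Z2c Zla Zlb i1; rewrite E1 /Z2 eqxx.
rewrite E5 => /orP[] /eqP h.
  by have := slab_cross (a := 0) (b := 1%N) (c := 4) (d := 5) m2 isT isT isT isT (esym e04) (esym h).
by have := slab_cross (a := 0) (b := 2%N) (c := 4) (d := 5) m2 isT isT isT isT (esym e04) (esym h).
Qed.

Lemma first_ne : cc 1 (p 0) <> cc 1 (q 0).
Proof. by apply: good; lia. Qed.

Lemma class_edge i : 0 < i < m -> cc 1 (p i) = cc 1 (q i).
Proof. by move=> hi; apply: comp_edge; rewrite mem_iota; lia. Qed.

Definition cut e := comp p q (iota 1 e.-1 ++ iota e.+1 (m - e.+1)).

Lemma iota_cut e : 0 < e < m -> iota 1 (m - 1) = iota 1 e.-1 ++ e :: iota e.+1 (m - e.+1).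
Proof.
move=> he; have -> : (m - 1 = e.-1 + (m - e.+1).+1)%N by lia.
rewrite iotaD /=; have -> : (1 + e.-1 = e)%N by lia. by [].
Qed.

Lemma cut_edge e i : 0 < i < m -> i != e -> cut e (p i) = cut e (q i).
Proof. by move=> hi ie; apply: comp_edge; rewrite mem_cat !mem_iota; lia. Qed.

Lemma cut_ne e : 0 < e < m -> cut e (p e) <> cut e (q e).
Proof.
move=> he; apply: forest_cut; rewrite -iota_cut //.
by apply: cc_forest; lia.
Qed.

(** Putting the edge [e] back by a relabelling gives a function constant on all edges, hence on the
    component of [p e]. *)
Lemma cut_near e x : 0 < e < m -> cc 1 x = cc 1 (p e) -> cut e x = cut e (p e) \/ cut e x = cut e (q e).
Proof.
move=> he h; pose g y := relab (cut e (p e)) (cut e (q e)) (cut e y).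
have : g x = g (p e).
  apply: (@comp_univ p q _ g (iota 1 (m - 1))) => // j; rewrite mem_iota => hj; rewrite /g.
  have [->|je] := eqVneq j e; first by rewrite relab_l relab_r.
  by rewrite (@cut_edge e j) //; lia.
rewrite /g relab_l /relab; case: eqP => [-> _|_ ->]; by [right|left].
Qed.

End Tower.

(** * Projection to the direct product, and lengths of short words *)

Section Projection.
Variables A B : rsys.
Local Notation D := (A + B)%type.
Local Notation F := (fp A B).

Definition dpr (x : D) : prs A B := match x with inl a => (a, 1) | inr b => (1, b) end.
Lemma dprM (x y : D) : same x y -> dpr (dmul x y) = dpr x * dpr y.
Proof. by case: x y => [a|a] [b|b] //= _; congr pair; rewrite /= mulg1. Qed.
Definition pr : F -> prs A B := hom dpr.
Lemma prM : {morph pr : u v / u * v}.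
Proof. exact: homM dprM. Qed.
Lemma pr_inj x : pr (inj x) = dpr x.
Proof. exact: hom_inj dprM x. Qed.
Lemma dpr_refl (x : D) : drefl x -> refl (dpr x).
Proof. by case: x => a h; [left|right]. Qed.

Lemma hom_refl (C : rsys) (f : D -> C) : (forall x y, same x y -> f (dmul x y) = f x * f y) ->
  (forall x, drefl x -> refl (f x)) -> forall t : F, refl t -> refl (hom f t).
Proof.
by move=> fM fT t [g [x [hx ->]]]; rewrite (morphcj (homM fM)) hom_inj //; apply: reflJ; apply: fT.
Qed.

Lemma len_pr (u : F) : len (pr u).1 + len (pr u).2 <= len u.
Proof.
rewrite -len_prs; apply: (len_hom prM) => t ht; left.
by apply: hom_refl ht; [exact: dprM|exact: dpr_refl].
Qed.

Lemma len_inj x : len (inj x : F) = dlen x.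
Proof.
apply/eqP; rewrite eqn_leq; apply/andP; split.
  have [r Hr <-] := dfac_ex x; rewrite -(size_map inj); apply: len_min; split; last exact: dfac_inj.
  by move=> t /mapP[y hy ->]; apply: fprefl_inj; case: (Hr.1 y hy).
by have := len_pr (inj x); rewrite pr_inj; case: (x) => a /=; rewrite len1; lia.
Qed.

Lemma len_inj2 a b : len (inj (inl a) * inj (inr b) : F) = (len a + len b)%N.
Proof.
apply/eqP; rewrite eqn_leq; apply/andP; split.
  by apply: leq_trans (lenM _ _) _; rewrite !len_inj.
by have := len_pr (inj (inl a) * inj (inr b)); rewrite prM !pr_inj /= mulg1 mul1g.
Qed.
End Projection.

Lemma tele (G : groupType) (u v : nat -> G) js : (forall j, j \in js -> v j = (u j)^-1) ->
  gp (map u js) * gp (map v (rev js)) = 1.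
Proof.
elim: js => [|j js IH] H; first exact: mulg1.
rewrite rev_cons map_rcons -cats1 gp_cat mulgA /= -(mulgA (u j)) IH => [|k hk].
  by rewrite mulg1 H ?mem_head // mulg1 mulgV.
by apply: H; rewrite inE hk orbT.
Qed.

(** All pairs cancel except those of index 0 and [e]; the letters between them only conjugate the
    contribution of [e]. *)
Lemma tele_cut (G : groupType) (u v : nat -> G) m e : 0 < e < m ->
  (forall j, 0 < j < m -> j != e -> v j = (u j)^-1) ->
  gp (map u (iota 0 m)) * gp (map v (rev (iota 0 m))) =
  u 0 * cj (gp (map u (iota 1 e.-1))) (u e * v e) * v 0.
Proof.
move=> he H; set g := gp (map u (iota 1 e.-1)).
have -> : iota 0 m = 0 :: iota 1 e.-1 ++ e :: iota e.+1 (m - e.+1).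
  have -> : m = (e.-1 + (m - e.+1).+1).+1 by lia.
  rewrite /= iotaD /=; have -> : (1 + e.-1 = e)%N by lia.
  by congr (_ :: _ ++ _ :: iota _ _); lia.
rewrite rev_cons rev_cat rev_cons -!cats1 [map u _]/= !map_cat ?gp_cons ?gp_cat !gp1 -/g.
have T1 : gp (map u (iota e.+1 (m - e.+1))) * gp (map v (rev (iota e.+1 (m - e.+1)))) = 1.
  by apply: tele => j; rewrite mem_iota => hj; apply: H; lia.
have T2 : g * gp (map v (rev (iota 1 e.-1))) = 1.
  by apply: tele => j; rewrite mem_iota => hj; apply: H; lia.
rewrite /cj (mulg1_eq T2) ?map_cons ?gp_cons -!mulgA.
by rewrite (mulgA (gp (map u (iota e.+1 _)))) T1 mul1g.
Qed.

Lemma sandwich (zy y lz lv lb : nat) : zy + y + (lv + lb) <= lz + lv + lb -> lz <= zy + y -> (y + zy)%N = lz.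
Proof. lia. Qed.

(** * Lifting an element below [h] by splitting off the class of its first letter *)

Section FirstLift.
Variables A B : rsys.
Local Notation D := (A + B)%type.
Local Notation F := (fp A B).
Local Notation FF := (fp (fp A B) A).

(* Letters of the first factor are split into two classes; class [true] goes to a new copy of [A]. *)
Definition lift (c : bool) (x : D) : FF := match x with
  | inl a => if c then inj (inr a) else inj (inl (inj (inl a)))
  | inr b => inj (inl (inj (inr b))) end.
Definition fold_letter (y : F + A) : F := match y with inl u => u | inr a => inj (inl a) end.
Definition fold : FF -> F := hom fold_letter.
Definition lval (x : D) : A := if x is inl a then a else 1.

Lemma liftM c x y : same x y -> lift c (dmul x y) = lift c x * lift c y.
Proof.
case: x y => [a|a] [b|b] //= _; last by rewrite -inj_mul //= -inj_mul.
by case: c; rewrite -inj_mul //= -inj_mul.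
Qed.
Lemma fold_letterM x y : same x y -> fold_letter (dmul x y) = fold_letter x * fold_letter y.
Proof. by case: x y => [a|a] [b|b] //= _; rewrite -inj_mul. Qed.
Lemma foldM : {morph fold : u v / u * v}.
Proof. exact: homM fold_letterM. Qed.
Lemma fold_lift c x : fold (lift c x) = inj x.
Proof. by case: x => a /=; [case: c|]; rewrite /fold hom_inj //; exact: fold_letterM. Qed.
Lemma lift_refl c (x : D) : drefl x -> refl (lift c x).
Proof.
by case: x => a h /=; [case: c|]; apply: fprefl_inj => //=; apply: fprefl_inj.
Qed.
Lemma lift_inv c x : lift c (dinv x) = (lift c x)^-1.
Proof. exact: f_inv (liftM c) x. Qed.

Variables (al : A) (be : B).
Local Notation h := (inj (inl al) * inj (inr be) : F).

(** What one factorization [s] provides: [cl] marks the letters grouped with the first letter [z].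
    The last clause puts each marked letter below [z] up to inversion and conjugation by earlier
    marked letters, the form in which [indep] can use it. *)
Definition lifting (w : seq D) (s : seq F) x0 z (cl : nat -> bool) := [/\ cl 0, (len z + len (z^-1 * al))%N = len al,
    exists2 r : seq FF, Red (gp [seq lift (cl i) (nth x0 w i) | i <- iota 0 (size w)] : FF) r & map fold r = s,
    le (gp [seq lift (cl i) (nth x0 w i) | i <- iota 0 (size w)] : FF)
       (inj (inr z) * inj (inl (inj (inl (z^-1 * al)) * inj (inr be))))
  & forall e x, 0 < e < size w -> nth x0 w e = inl x -> cl e ->
    exists2 sel : pred nat, forall i, sel i -> [/\ cl i, isl (nth x0 w i) & 0 < i < e] &
    le (cj (gp [seq lval (nth x0 w i) | i <- iota 1 e.-1 & sel i]) x) z \/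
    le (cj (gp [seq lval (nth x0 w i) | i <- iota 1 e.-1 & sel i]) x^-1) z].

(** Glue the diagrams of [s] and of a reduced factorization [r] of [a^-1 h]. Marked letters cancel
    in pairs except for [z] itself, because the inverse of the first letter is on an unmarked class.
    So any homomorphism that treats marked and unmarked letters separately takes the glued word to
    the image of [z] times that of [z^-1 h]. *)
Lemma first_lift (w : seq D) (s : seq F) x0 z : reduced w -> 1 < size w -> nth x0 w 0 = inl z ->
  le (ev w : F) h -> Red (ev w : F) s -> exists cl, lifting w s x0 z cl.
Proof.
move=> rw sw w0 lah Rs; rewrite /lifting; set m := size w in sw *; pose wf i := nth x0 w i.
have mw : map wf (iota 0 m) = w by rewrite -[RHS](mkseq_nth x0).
have [r Rr] := len_red ((ev w)^-1 * h : F).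
have [LP eP RP] := reads_ex Rs.
have evQ : ev (winv w ++ [:: inl al; inr be]) = (ev w)^-1 * h.
  by rewrite ev_cat ev_winv ev_cons ev1.
have Rr' : Red (ev (winv w ++ [:: inl al; inr be]) : F) r by rewrite evQ.
have [LQ eQ RQ] := reads_ex Rr'.
(* Even labels for the diagram of [s] and odd ones for that of [r] keep the two disjoint. *)
pose p i := (nth (0, x0) LP i).1.*2.
pose q i := (nth (0, x0) LQ (m - i.+1)).1.*2.+1.
pose la := (nth (0, x0) LQ m).1.*2.+1; pose lb := (nth (0, x0) LQ m.+1).1.*2.+1.
have sP : size LP = m by rewrite -(size_map snd) eP.
have sQ : size LQ = m.+2 by rewrite -(size_map snd) eQ size_cat /winv size_rev size_map addn2.
have {}RP : Reads (map (pl p wf) (iota 0 m)) s.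
  have := reads_relabel (g := double) _ RP; have -> : mapl double LP = map (pl p wf) (iota 0 m).
    apply: (@eq_from_nth _ (0, x0)); first by rewrite !size_map size_iota.
    move=> i; rewrite size_map sP => im; rewrite !(nth_map (0,x0)) ?sP // !(nth_map 0) ?size_iota // nth_iota //.
    by rewrite /pl /p /wf add0n -eP (nth_map (0, x0)) // sP.
  by apply=> ? ? _ _; exact: double_inj.
have {}RQ : Reads (map (ql q wf) (rev (iota 0 m)) ++ [:: (la, inl al); (lb, inr be)]) r.
  have := reads_relabel (g := fun k => k.*2.+1) _ RQ.
  have -> : mapl (fun k => k.*2.+1) LQ = map (ql q wf) (rev (iota 0 m)) ++ [:: (la, inl al); (lb, inr be)].
    have nQ i : (nth (0, x0) LQ i).2 = nth x0 (winv w ++ [:: inl al; inr be]) i.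
      have [hi|hi] := ltnP i (size LQ); first by rewrite -eQ (nth_map (0, x0)).
      by rewrite !nth_default // -eQ size_map.
    have sW : size (winv w) = m by rewrite /winv size_rev size_map.
    apply: (@eq_from_nth _ (0, x0)); first by rewrite size_cat !size_map size_rev size_iota sQ addn2.
    move=> i; rewrite size_map sQ => im; rewrite (nth_map (0,x0)) ?sQ // nQ.
    rewrite !nth_cat size_map size_rev size_iota sW; case: ltnP => im'.
      rewrite (nth_map 0) ?size_rev ?size_iota // nth_rev ?size_iota // nth_iota; last lia.
      rewrite /ql /q /winv nth_rev ?size_map // (nth_map x0); last by rewrite -/m; lia.
      by rewrite add0n (_ : (m - (m - i.+1).+1 = i)%N) //; lia.
    have [->|ne] := eqVneq i m; first by rewrite subnn.
    have -> : i = m.+1 by lia.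
    rewrite subSnn; reflexivity.
  by apply=> a b _ _ e; lia.
have Hpq i j : i < m -> j < m -> p i <> q j by rewrite /p /q; lia.
have HR : Reads (stagew p q wf la lb (inl al) (inr be) m) (s ++ r).
  apply: reads_cat RP RQ => l; rewrite -map_comp => /mapP[i _ ->].
  rewrite map_cat mem_cat -map_comp negb_or; apply/andP; split.
    by apply/mapP => -[j _]; rewrite /= /p /q; lia.
  by rewrite !inE /la /lb /= /p; apply/norP; split; apply/eqP; lia.
have Hsz : size (s ++ r) = len h by rewrite size_cat Rs.2 Rr.2.
have Hnt i : i < m -> ~~ triv (wf i).
  by move=> im; move: rw => /andP[/allP h1 _]; apply: h1; exact: mem_nth.
have Hside i : i < m -> isl (wf i) = ~~ odd i.
  elim: i => [|i IH] im; first by rewrite /wf w0.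
  have := IH (ltnW im); move: rw => /andP[_ /(sortedP x0) /(_ i im)].
  rewrite /same -!/(wf _) => ns e; rewrite [odd _]/= -e.
  by case: (isl (wf i)) (isl (wf i.+1)) ns => -[].
have F1 := first_la HR Hsz Hnt Hside Hpq sw; have F0 := first_ne HR Hsz Hnt Hside Hpq sw.
set c1 := cc m p q 1 in F1 F0.
have CE i : 0 < i < m -> c1 (p i) = c1 (q i) by exact: (class_edge p q Hsz sw).
(* Marked means connected to the class of the first letter when the edge of that letter is left
   out. *)
pose isz l := c1 l == c1 (p 0).
have z0 : isz (p 0) by exact: eqxx.
have zq0 : isz (q 0) = false by apply/eqP => e; apply: F0.
have zla : isz la = false by rewrite /isz F1; exact: zq0.
have zE i : 0 < i < m -> isz (q i) = isz (p i) by move=> hi; rewrite /isz (CE i hi).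
have m0 : 0 < m by lia.
have wf0 : wf 0 = inl z by [].
have nrm : len h = (len al + len be)%N by exact: len_inj2.
have gpW (G : groupType) (f : nat -> D -> G) :
    gp [seq f y.1 y.2 | y <- stagew p q wf la lb (inl al) (inr be) m] =
    gp (map (fun i => f (p i) (wf i)) (iota 0 m)) * gp (map (fun i => f (q i) (dinv (wf i))) (rev (iota 0 m)))
      * (f la (inl al) * f lb (inr be)).
  by rewrite /stagew !map_cat -!map_comp !gp_cat /= mulg1 mulgA.
have tele0 (G : groupType) (u v : nat -> G) : (forall j, 0 < j < m -> v j = (u j)^-1) ->
    gp (map u (iota 0 m)) * gp (map v (rev (iota 0 m))) = u 0 * v 0.
  move=> H; have -> : iota 0 m = 0 :: iota 1 m.-1 by rewrite -{1}(prednK m0).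
  rewrite rev_cons map_rcons -cats1 gp_cat gp1 /= mulgA -(mulgA (u 0)) tele ?mulg1 // => j.
  by rewrite mem_iota => hj; apply: H; lia.
have lz : (len z + len (z^-1 * al))%N = len al.
  (* Marked letters go to the first coordinate; the image is [z] there and [z^-1 al be] in the
     second, which bounds the sum of their lengths. *)
  pose f l (x : D) : prs A F := match x with
    | inl a => if isz l then (a, 1) else (1, inj (inl a)) | inr b => (1, inj (inr b)) end.
  have fM l x y : same x y -> f l (dmul x y) = f l x * f l y.
    by case: x y => [a|a] [b|b] //= _; [case: ifP => _|]; congr pair; rewrite /= ?mulg1 // -inj_mul.
  have fT l x : drefl x -> refl (f l x) \/ f l x = 1.
    by case: x => a hx /=; left; [case: ifP => _; [left|right]|right]; split=> //=; exact: fprefl_inj.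
  have := reads_len fM fT HR; rewrite gpW tele0; last first.
    by move=> j hj; rewrite -(f_inv (fM _)) /f zE.
  rewrite wf0 /= z0 zq0 zla Hsz nrm len_prs /= !mulg1 !mul1g.
  rewrite [inj _ * (_ * _)]mulgA -inj_mul //= len_inj2.
  have := lenM z (z^-1 * al); rewrite mulVKg => h1 h2.
  by apply/eqP; rewrite eqn_leq h1 andbT -(leq_add2r (len be)) -addnA; exact: h2.
pose f l := lift (isz l).
have fT l x : drefl x -> refl (f l x) by exact: lift_refl.
have fM l x y : same x y -> f l (dmul x y) = f l x * f l y by exact: liftM.
have [u1 [u1s u1T u1g u1f]] := reads_lift (@reflJ FF) fM fT RP.
have [u2 [u2s u2T u2g u2f]] := reads_lift (@reflJ FF) fM fT RQ.
move: u1g; set aa := (X in _ = X) => u1g; move: u2g; set bb := (X in _ = X) => u2g.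
have lenaa : len (aa : FF) <= size s.
  rewrite -u1s size_map -(size_map fst); apply: len_min; split=> //.
  by move=> t /mapP[y /u1T hy ->].
have lenbb : len (bb : FF) <= size r.
  rewrite -u2s size_map -(size_map fst); apply: len_min; split=> //.
  by move=> t /mapP[y /u2T hy ->].
set hh : FF := inj (inr z) * _.
(* The product has length [size s + size r] while the two parts have at most these lengths, so both
   lifted tuples are reduced. *)
have ehh : aa * bb = hh.
  rewrite /aa /bb !map_cat gp_cat mulgA -!map_comp tele0; last first.
    by move=> j hj; rewrite /= -lift_inv /f zE.
  rewrite /= wf0 /f z0 zq0 zla /= mulg1 -!mulgA; congr (_ * _).
  have e1 (u v : F) : inj (inl (u * v)) = inj (inl u) * inj (inl v) :> FF by rewrite -inj_mul.
  have e2 (u v : A) : inj (inl (u * v)) = inj (inl u) * inj (inl v) :> F by rewrite -inj_mul.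
  by rewrite e1 e2 e1 -!mulgA.
have lenhh : len hh = (size s + size r)%N.
  by rewrite /hh lenC len_inj2 len_inj2 -size_cat Hsz nrm -lz; lia.
have lenab := lenM (aa : FF) bb.
have eaa : gp [seq lift (isz (p i)) (nth x0 w i) | i <- iota 0 m] = aa by rewrite /aa -map_comp.
exists (fun i => isz (p i)); rewrite /lifting eaa; split=> //.
- exists (map fst u1); first split=> //.
  + by split=> // t /mapP[y /u1T hy ->].
  + by rewrite size_map -(size_map snd) u1s; move: lenab; rewrite ehh lenhh; lia.
  + rewrite -map_comp -u1s; apply/eq_in_map => y hy /=.
    by apply: u1f hy; [exact: foldM|move=> l x; exact: fold_lift].
- by rewrite /le -ehh mulKg ehh lenhh; move: lenab; rewrite ehh lenhh; lia.
move=> e x he ex ce.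
set cut := cut m p q e.
have nr : cut (p 0) = cut (p e) \/ cut (p 0) = cut (q e).
  by apply: (cut_near Hsz sw) => //; apply/esym/eqP.
have cn : cut (p e) <> cut (q e) by apply: (cut_ne HR Hsz).
(* The edge [e] is removed as well, and the marked classes fall into those still joined to [p 0] and
   the others, with exactly one end of [e] among the former. The map [k] gives each part its own
   copy of [A]. *)
pose near l := cut l == cut (p 0).
pose k l (y : D) : prs (prs A A) F := match y with
  | inl a => if isz l then (if near l then ((a, 1), 1) else ((1, a), 1)) else ((1, 1), inj (inl a))
  | inr b => ((1, 1), inj (inr b)) end.
have kM l y y' : same y y' -> k l (dmul y y') = k l y * k l y'.
  by case: y y' => [a|a] [b|b] //= _; [case: ifP => _; [case: ifP => _|]|];
     congr pair; rewrite /= -?inj_mul ?mulg1 //; congr pair; rewrite /= mulg1.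
have kT l y : drefl y -> refl (k l y) \/ k l y = 1.
  by case: y => a hy /=; left; [case: ifP => _; [case: ifP => _|]|];
    [left; split=> //; left|left; split=> //; right|right; split=> //; exact: fprefl_inj|right; split=> //; exact: fprefl_inj].
have TC := @tele_cut _ (fun i => k (p i) (wf i)) (fun i => k (q i) (dinv (wf i))) m e he.
have kE j : 0 < j < m -> j != e -> k (q j) (dinv (wf j)) = (k (p j) (wf j))^-1.
  by move=> hj je; rewrite -(f_inv (kM _)) /k zE // /near /cut (cut_edge p q Hsz sw hj je).
have {}TC := TC kE.
have := reads_len kM kT HR; rewrite gpW TC Hsz nrm wf0 [k (p 0) _]/= z0 /near eqxx -/near.
rewrite [k (q 0) _]/= zq0 [k la _]/= zla [k lb _]/=.
have ewx : wf e = inl x by [].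
rewrite ewx [k (p e) _]/= ce [k (q e) _]/= zE // ce => L.
pose sel i := [&& isz (p i), isl (wf i), near (p i) & 0 < i < e].
exists sel; first by move=> i /and4P[h1 h2 _ h3].
set g := gp (map _ (iota 1 e.-1)) in L.
have g1 : g.1.1 = gp [seq lval (nth x0 w i) | i <- iota 1 e.-1 & sel i].
  rewrite /g (@morph_gp _ _ (fun c : prs (prs A A) F => c.1.1)) // -map_comp.
  have : forall i, i \in iota 1 e.-1 -> 0 < i < e by move=> i; rewrite mem_iota; lia.
  elim: (iota _ _) => //= i js IHj hj; rewrite IHj => [|j hj']; last by apply: hj; rewrite inE hj' orbT.
  rewrite /sel (hj i (mem_head _ _)) andbT -/(wf i); case ewi: (wf i) => [a|a] /=; last by rewrite andbF mul1g.
  case: ifP => _ /=; last by rewrite mul1g.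
  by case: ifP => _ /=; rewrite ?mul1g // -/(wf i) ewi.
rewrite -g1.
(* Here [y] is what the near end of [e] contributes beside [z], and [len x] comes from the far end;
   the bound leaves [len (z * y) + len y = len z]. *)
have key y : len (z * y) + len x + (len (z^-1 * al) + len be) <= len al + len be -> len y = len x -> le y^-1 z.
  rewrite /le invgK lenV -lz => h1 ey; rewrite lenC ey.
  have := lenM (z * y) y^-1; rewrite mulgK lenV ey; exact: sandwich h1.
have comp3 (c : F) : len (c / c * inj (inl z^-1) * (inj (inl al) * inj (inr be)) : F) = (len (z^-1 * al) + len be)%N.
  by rewrite mulgV mul1g mulgA -inj_mul //= len_inj2.
have nre : near (p e) = (cut (p e) == cut (p 0)) by [].
have nrq : near (q e) = (cut (q e) == cut (p 0)) by [].
rewrite !len_prs nre nrq in L; clear nre nrq; case: nr L => ->.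
  rewrite eqxx [cut (q e) == _]eq_sym (introF eqP cn); case: (g) => -[g1' g2'] g3' /=.
  rewrite !mulg1 !mul1g => L; right.
  rewrite cjV; apply: key; last by rewrite lenJ.
  by move: L; rewrite comp3 -/(cj g1' x) -/(cj g2' x^-1) lenJ lenV.
rewrite eqxx (introF eqP cn); case: (g) => -[g1' g2'] g3' /=.
rewrite !mulg1 !mul1g => L; left.
rewrite -[cj _ x]invgK -cjV; apply: key; last by rewrite lenJ lenV.
by move: L; rewrite comp3 -/(cj g1' x^-1) -/(cj g2' x) lenJ.
Qed.
End FirstLift.

(** * Isomorphisms of reflection systems, and exchanging the two factors *)

Section Iso.
Variables (G H : rsys) (f : G -> H) (g : H -> G).
Hypotheses (fM : {morph f : x y / x * y}) (gM : {morph g : x y / x * y}).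
Hypotheses (fK : cancel f g) (gK : cancel g f).
Hypotheses (fT : forall t, refl t -> refl (f t)) (gT : forall t, refl t -> refl (g t)).

Lemma iso_len x : len (f x) = len x.
Proof.
apply/eqP; rewrite eqn_leq; apply/andP; split; first by apply: len_hom => // t /fT; left.
by rewrite -{1}(fK x); apply: len_hom => // t /gT; left.
Qed.

Lemma iso_le a c : le (f a) (f c) <-> le a c.
Proof. by rewrite /le -(morphV fM) -fM !iso_len. Qed.

Lemma iso_Red a s : Red a s -> Red (f a) (map f s).
Proof.
case=> -[Hs <-] e; split; last by rewrite size_map iso_len.
by split; [move=> t /mapP[r /Hs/fT ? ->]|rewrite (morph_gp fM)].
Qed.

Lemma iso_single a : single (f a) -> single a.
Proof.
move=> S s t /iso_Red hs /iso_Red ht; have := heq_map gM (S _ _ hs ht).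
by rewrite -!map_comp !(eq_map fK) !map_id.
Qed.
End Iso.

Section Swap.
Variables A B : rsys.
Definition dswap (x : A + B) : B + A := match x with inl a => inr a | inr b => inl b end.
Definition swp : fp A B -> fp B A := hom (fun x => inj (dswap x)).
Lemma swp_letterM (x y : A + B) : same x y -> inj (dswap (dmul x y)) = inj (dswap x) * inj (dswap y).
Proof. by case: x y => [a|a] [b|b] //= _; rewrite -inj_mul. Qed.
Lemma swpM : {morph swp : u v / u * v}.
Proof. exact: homM swp_letterM. Qed.
Lemma swp_inj x : swp (inj x) = inj (dswap x).
Proof. exact: hom_inj swp_letterM x. Qed.
Lemma swp_ev w : swp (ev w) = ev (map dswap w).
Proof. by rewrite /swp (hom_ev swp_letterM) /ev -map_comp. Qed.
Lemma swp_refl t : refl t -> refl (swp t).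
Proof.
apply: hom_refl; first exact: swp_letterM.
by move=> x hx; apply: fprefl_inj; case: x hx.
Qed.
Lemma reduced_dswap w : reduced (map dswap w) = reduced w.
Proof.
rewrite /reduced /alt sorted_map all_map; congr (_ && _); first by apply: eq_all; case.
by apply: eq_sorted; do 2 case=> ?.
Qed.
End Swap.

Lemma swpK (A B : rsys) : cancel (@swp A B) (@swp B A).
Proof.
move=> u; rewrite -[u]ev_nf !swp_ev -map_comp; congr ev.
by rewrite -[RHS]map_id; apply: eq_map; case.
Qed.

Lemma swp_single (A B : rsys) (a : fp A B) : single (swp a) -> single a.
Proof. by apply: (@iso_single _ _ (@swp A B) (@swp B A)); first [exact: swpM | exact: swpK | exact: swp_refl]. Qed.

Lemma swp_le (A B : rsys) (a c : fp A B) : le (swp a) (swp c) <-> le a c.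
Proof. by apply: (@iso_le _ _ (@swp A B) (@swp B A)); first [exact: swpM | exact: swpK | exact: swp_refl]. Qed.

Lemma squeeze (a1 a2 a c1 c2 c b1 b2 b : nat) : a1 + a2 <= a -> c1 + c2 <= c -> b1 <= a1 + c1 -> b2 <= a2 + c2 ->
  (a + c)%N = b -> (b1 + b2)%N = b -> [/\ (a1 + c1)%N = b1, (a2 + c2)%N = b2 & (a1 + a2)%N = a].
Proof. by move=> *; split; lia. Qed.

Lemma squeeze2 (a b z1 v1 z2 v2 : nat) : a <= z1 + v1 -> b <= z2 + v2 ->
  (z1 + z2 + (v1 + v2))%N = (a + b)%N -> (z1 + v1)%N = a /\ (z2 + v2)%N = b.
Proof. by move=> *; split; lia. Qed.

Lemma squeeze3 (a b n m : nat) : a <= n -> b <= m -> (a + b)%N = (n + m)%N -> n = a /\ m = b.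
Proof. by move=> *; split; lia. Qed.

(** * Contents of elements below [h], and factorizations of words with at most two letters *)

Section Contents.
Variables A B : rsys.
Local Notation D := (A + B)%type.
Local Notation F := (fp A B).
Variables (al : A) (be : B).
Local Notation h := (inj (inl al) * inj (inr be) : F).

Lemma pr_h : pr h = (al, be).
Proof. by rewrite prM !pr_inj /=; congr pair; rewrite /= ?mulg1 ?mul1g. Qed.

(** The contents of [a] and [a^-1 b] are no longer than these elements, while those of [b] have full
    length; all inequalities in between are equalities. *)
Lemma pr_le1 (a b : F) : le a b -> (len (pr b).1 + len (pr b).2)%N = len b ->
  [/\ le (pr a).1 (pr b).1, le (pr a).2 (pr b).2 & (len (pr a).1 + len (pr a).2)%N = len a].
Proof.
rewrite /le => e1 e2; have h1 := len_pr a; have h2 := len_pr (a^-1 * b).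
have h3 := lenM (pr a).1 ((pr a).1^-1 * (pr b).1); have h4 := lenM (pr a).2 ((pr a).2^-1 * (pr b).2).
rewrite prM (morphV (@prM A B)) /= in h2; rewrite !mulVKg in h3 h4.
exact: squeeze h1 h2 h3 h4 e1 e2.
Qed.

Lemma pr_full (a : F) : le a h -> (len (pr a).1 + len (pr a).2)%N = len a.
Proof. by move=> ha; case: (pr_le1 ha) => //; rewrite pr_h len_inj2. Qed.

(** Everything involved lies below [h], so both contents satisfy the hypotheses of [indep] in their
    factors and the contents of [cj g x] are trivial. Below [h] the contents determine the length,
    which is therefore 0. *)
Lemma indep_fp : indep al -> indep be -> indep h.
Proof.
move=> ia ib z v e l g x hg hx hl.
have lz : le z h by rewrite e; apply: le_factorl; rewrite -e l.
have lv : le v h by rewrite e; apply: le_factorr; rewrite -e l.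
have lx := le_trans hl lz.
have fz := pr_full lz; have fv := pr_full lv.
have [l1 l2 fy] := pr_le1 hl fz.
have [ez1 ez2] : al = (pr z).1 * (pr v).1 /\ be = (pr z).2 * (pr v).2.
  by have := pr_h; rewrite e prM => -[<- <-].
have [s1 s2] : (len (pr z).1 + len (pr v).1)%N = len al /\ (len (pr z).2 + len (pr v).2)%N = len be.
  have h1 := lenM (pr z).1 (pr v).1; have h2 := lenM (pr z).2 (pr v).2.
  rewrite -ez1 in h1; rewrite -ez2 in h2; move: l; rewrite len_inj2 -fz -fv => l.
  exact: squeeze2 h1 h2 l.
have P (k y : F) : le k h -> inH k y -> inH (pr k).1 (pr y).1 /\ inH (pr k).2 (pr y).2.
  move=> lk [s [Hs <-]].
  have E1 : (pr (gp s)).1 = gp (map (fun r => (pr r).1) s).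
    by rewrite (morph_gp (@prM A B)) gp_fst -map_comp.
  have E2 : (pr (gp s)).2 = gp (map (fun r => (pr r).2) s).
    by rewrite (morph_gp (@prM A B)) gp_snd -map_comp.
  rewrite E1 E2.
  have fk := pr_full lk.
  suff H r : r \in s -> inH (pr k).1 (pr r).1 /\ inH (pr k).2 (pr r).2.
    split; apply: inH_gp => y' /mapP[r hr ->]; have [h1 h2] := H r hr.
      exact: h1.
    exact: h2.
  move=> /Hs[hr hlr].
  have [hl1 hl2] : (le (pr r).1 (pr k).1 \/ le (pr r).1^-1 (pr k).1) /\ (le (pr r).2 (pr k).2 \/ le (pr r).2^-1 (pr k).2).
    case: hlr => hlr; have [h1 h2 _] := pr_le1 hlr fk; first by split; left.
    by rewrite (morphV (@prM A B)) /= in h1 h2; split; right.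
  have : refl (pr r) by apply: hom_refl hr; [exact: dprM|exact: dpr_refl].
  case=> -[h1 h2]; split.
  - by exists [:: (pr r).1]; split; [move=> y'; rewrite inE => /eqP->|exact: gp1].
  - by rewrite h2; exact: inH1.
  - by rewrite h1; exact: inH1.
  - by exists [:: (pr r).2]; split; [move=> y'; rewrite inE => /eqP->|exact: gp1].
have [g1 g2] := P _ _ lz hg; have [x1 x2] := P _ _ lv hx.
rewrite (morphcj (@prM A B)) in l1 l2.
have e1 := ia _ _ ez1 s1 _ _ g1 x1 l1; have e2 := ib _ _ ez2 s2 _ _ g2 x2 l2.
have : cj g x = 1.
  apply: (@len_eq0 F); rewrite -fy (morphcj (@prM A B)) /= e1 e2.
  by rewrite !mulg1 !mulgV !len1.
by move/(congr1 (cj g^-1)); rewrite cjK cjg1.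
Qed.

(** Hurwitz moves bring [t] to the front of the factorization. *)
Lemma Red_mem_le (G : rsys) (x t : G) s : Red x s -> t \in s -> le t x.
Proof.
move=> Hs /splitPr st; case: st Hs => p q Hs.
have : Red x ([:: t] ++ (map (cj t^-1) p ++ q)).
  apply: Red_heq Hs; rewrite -cat1s !catA; apply: heq_catr.
  by have := heq_block' p [:: t]; rewrite gp1.
move=> Ht; have [_ _ e] := Red_split Ht; have := Red_gp Ht.
by rewrite gp_cat gp1 => ex; rewrite -ex; apply: le_factorl; rewrite ex -e gp1.
Qed.

Lemma lvalM (x y : D) : same x y -> lval (dmul x y) = lval x * lval y.
Proof. by case: x y => [a|a] [b|b] //= _; rewrite mulg1. Qed.

Lemma dfac_len (x : D) N : dfac x N -> dlen x <= size N.
Proof.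
move=> HN; rewrite -len_inj -(size_map inj); apply: len_min; split; last exact: dfac_inj.
by move=> t /mapP[y hy ->]; apply: fprefl_inj; case: (HN.1 y hy).
Qed.

Lemma dfac_inl (a : A) N : dfac (inl a : D) N -> size N = len a -> exists2 r, Red a r & N = map inl r.
Proof.
move=> HN sN; have eN : N = map inl (map (@lval A B) N).
  rewrite -map_comp -[LHS]map_id; apply/eq_in_map => -[y|y] hy //=.
  by have [_] := HN.1 _ hy.
exists (map (@lval A B) N) => //; split; last by rewrite size_map.
split; last exact: (dfac_fold lvalM HN).
by move=> t /mapP[[y|y] hy ->]; have [] := HN.1 _ hy.
Qed.

Lemma dfac_inr (b : B) N : dfac (inr b : D) N -> size N = len b -> exists2 r, Red b r & N = map inr r.
Proof.
pose rv (x : D) : B := if x is inr b then b else 1.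
have rM (x y : D) : same x y -> rv (dmul x y) = rv x * rv y.
  by case: x y => [a|a] [b'|b'] //= _; rewrite mulg1.
move=> HN sN; have eN : N = map inr (map rv N).
  rewrite -map_comp -[LHS]map_id; apply/eq_in_map => -[y|y] hy //=.
  by have [_] := HN.1 _ hy.
exists (map rv N) => //; split; last by rewrite size_map.
split; last exact: (dfac_fold rM HN).
by move=> t /mapP[[y|y] hy ->]; have [] := HN.1 _ hy.
Qed.

Lemma one_form (x : D) s : Red (inj x : F) s ->
  exists N, [/\ dfac x N, size N = dlen x & heq s (map inj N)].
Proof.
move=> Hs; have Hs' : Red (ev [:: x] : F) s by rewrite ev1.
have [w ew R] := reads_ex Hs'; case: w ew R => [|[l y] [|]] //= [->] R.
have [N [sN hN eN]] := reads_uniq R isT; case: N sN hN eN => [|N [|]] //= _ hN.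
rewrite cats0 => eN; exists N; split=> //; first exact: (hN 0%N (0%N, x)).
by rewrite -(size_map inj) -(heq_size eN) Hs.2 len_inj.
Qed.

(** Letters on different sides carry different labels, so [reads_uniq] applies to any diagram with
    this boundary. *)
Lemma two_form (x y : D) s : ~~ same x y -> len (inj x * inj y : F) = (dlen x + dlen y)%N ->
  Red (inj x * inj y : F) s ->
  exists N M, [/\ dfac x N, dfac y M, size N = dlen x, size M = dlen y & heq s (map inj (N ++ M))].
Proof.
move=> nxy exy Hs; have Hs' : Red (ev [:: x; y] : F) s by rewrite ev_cons ev1.
have [w ew R] := reads_ex Hs'; case: w ew R => [|[l x'] [|[l' y'] [|]]] //= [-> ->] R.
have ll : uniq (map fst [:: (l, x); (l', y)]).
  rewrite /= inE andbT; apply/eqP => e; rewrite e in R.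
  have h1 : (l', x) \in [:: (l', x); (l', y)] by rewrite !inE eqxx.
  have h2 : (l', y) \in [:: (l', x); (l', y)] by rewrite !inE eqxx orbT.
  by move: nxy; rewrite (reads_mono R h1 h2).
have [N [sN hN eN]] := reads_uniq R ll; case: N sN hN eN => [|N [|M [|]]] //= _ hN.
rewrite cats0 => eN; exists N, M.
have fN := hN 0%N (0%N, x) isT; have fM := hN 1%N (0%N, x) isT.
have lN := dfac_len fN; have lM := dfac_len fM.
have e := heq_size eN; rewrite Hs.2 exy size_map size_cat in e.
by have [] := squeeze3 lN lM e.
Qed.

Lemma single_inl a : single a -> single (inj (inl a) : F).
Proof.
move=> S s t /one_form [N [hN sN eN]] /one_form [M [hM sM eM]].
have [r hr er] := dfac_inl hN sN; have [r' hr' er'] := dfac_inl hM sM.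
apply: heq_trans eN _; apply: heq_sym; apply: heq_trans eM _; rewrite er er' -!map_comp.
apply: heq_map; last exact: S.
by move=> u v /=; rewrite -inj_mul.
Qed.

Lemma single_inr b : single b -> single (inj (inr b) : F).
Proof.
move=> S s t /one_form [N [hN sN eN]] /one_form [M [hM sM eM]].
have [r hr er] := dfac_inr hN sN; have [r' hr' er'] := dfac_inr hM sM.
apply: heq_trans eN _; apply: heq_sym; apply: heq_trans eM _; rewrite er er' -!map_comp.
apply: heq_map; last exact: S.
by move=> u v /=; rewrite -inj_mul.
Qed.

Lemma single_h : single al -> single be -> single h.
Proof.
move=> Sa Sb s t Hs Ht.
have [N [M [fN fM sN sM e]]] := two_form (x := inl al) (y := inr be) isT (len_inj2 al be) Hs.
have [N' [M' [fN' fM' sN' sM' e']]] := two_form (x := inl al) (y := inr be) isT (len_inj2 al be) Ht.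
apply: heq_trans e _; apply: heq_sym; apply: heq_trans e' _; rewrite !map_cat; apply: heq_cat2.
  have [r hr ->] := dfac_inl fN sN; have [r' hr' ->] := dfac_inl fN' sN'.
  rewrite -!map_comp; apply: heq_map; last exact: Sa.
  by move=> u v /=; rewrite -inj_mul.
have [r hr ->] := dfac_inr fM sM; have [r' hr' ->] := dfac_inr fM' sM'.
rewrite -!map_comp; apply: heq_map; last exact: Sb.
by move=> u v /=; rewrite -inj_mul.
Qed.

Lemma single_letter x : pant al -> pant be -> le (inj x : F) h -> single (inj x : F).
Proof.
move=> Pa Pb lx; have := pr_le1 lx; rewrite pr_h len_inj2 pr_inj => /(_ erefl) [l1 l2 _].
by case: x lx l1 l2 => a _ l1 l2; [apply: single_inl; exact: Pa|apply: single_inr; exact: Pb].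
Qed.

End Contents.

(** * Which letters occur in the normal form of the lifted element *)

Section LetterPredicate.
Variables A B : rsys.
Local Notation D := (A + B)%type.
Local Notation F := (fp A B).
Variable P : D -> Prop.
Hypotheses (PM : forall x y, same x y -> P x -> P y -> P (dmul x y)) (PV : forall x, P x -> P (dinv x)).
Definition nfP (u : F) := forall x, x \in nf u -> P x.

Lemma nfP_act x w : P x -> (forall y, y \in w -> P y) -> forall y, y \in act x w -> P y.
Proof.
rewrite /act => Px Pw y; case: ifP => _; first exact: Pw.
case: w Pw => [|z w] Pw; first by rewrite inE => /eqP->.
have Pz : P z by apply: Pw; exact: mem_head.
have Pw' u : u \in w -> P u by move=> hu; apply: Pw; rewrite inE hu orbT.
case: ifP => [s|_]; last by rewrite inE => /orP[/eqP->|/Pw].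
case: ifP => _; first exact: Pw'.
by rewrite inE => /orP[/eqP->|/Pw']; auto.
Qed.

Lemma nfPM u v : nfP u -> nfP v -> nfP (u * v).
Proof.
rewrite /nfP /= => Pu Pv; elim: (nf u) Pu => //= x w IH Pu.
apply: nfP_act; first by apply: Pu; exact: mem_head.
by apply: IH => y hy; apply: Pu; rewrite inE hy orbT.
Qed.
Lemma nfPV u : nfP u -> nfP u^-1.
Proof. by rewrite /nfP /= /winv => Pu x; rewrite mem_rev => /mapP[y /Pu hy ->]; exact: PV. Qed.
Lemma nfP_inj x : P x -> nfP (inj x).
Proof. by move=> Px; apply: nfP_act. Qed.
Lemma nfPcj u v : nfP u -> nfP v -> nfP (cj u v).
Proof. by move=> hu hv; apply: nfPM; [exact: nfPM|exact: nfPV]. Qed.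
Lemma nfP_gp s : (forall x, x \in s -> nfP x) -> nfP (gp s).
Proof.
elim: s => [|x s IH] H; first by [].
apply: nfPM; first by apply: H; exact: mem_head.
by apply: IH => y hy; apply: H; rewrite inE hy orbT.
Qed.

Lemma nfP_heq s t : heq s t -> (forall x, x \in t -> nfP x) -> forall x, x \in s -> nfP x.
Proof.
move=> h Ht; have P1 (a b : F) : nfP a -> nfP b -> nfP (cj a b) by exact: nfPcj.
have P2 (a b : F) : nfP a -> nfP b -> nfP (cj a^-1 b) by move=> /nfPV; exact: nfPcj.
by apply/(heq_sub P1 P2 h).
Qed.
End LetterPredicate.

Section Classes.
Variables A B : rsys.
Local Notation D := (A + B)%type.
Local Notation F := (fp A B).
Local Notation FF := (fp (fp A B) A).
Variables (be : B) (z v : A).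

Definition okD (x : D) := match x with inl a => inH v a | inr _ => True end.
Lemma okDM x y : same x y -> okD x -> okD y -> okD (dmul x y).
Proof. by case: x y => [a|a] [b|b] //= _; exact: inHM. Qed.
Lemma okDV x : okD x -> okD (dinv x).
Proof. by case: x => [a|a] //=; exact: inHV. Qed.
Definition okL (y : F + A) := match y with inl u => nfP okD u | inr a => inH z a end.
Lemma okLM x y : same x y -> okL x -> okL y -> okL (dmul x y).
Proof. by case: x y => [a|a] [b|b] //= _; [exact: (nfPM okDM)|exact: inHM]. Qed.
Lemma okLV x : okL x -> okL (dinv x).
Proof. by case: x => [a|a] //=; [exact: (nfPV okDV)|exact: inHV]. Qed.

Lemma inH_Red (G : rsys) (c : G) s t : Red c s -> t \in s -> inH c t.
Proof. by move=> Hs ts; apply: inH_refl; [exact: Hs.1.1|exact: Red_mem_le Hs ts]. Qed.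

Local Notation hh := (inj (inr z) * inj (inl (inj (inl v) * inj (inr be) : F)) : FF).

Lemma len_hh : len hh = (len z + (len v + len be))%N.
Proof. by rewrite lenC len_inj2 len_inj2 addnC. Qed.

(** A reduced factorization of [U] extends to one of [hh]. Applying [two_form] at both levels brings
    the latter to reflections below [z], [v] or [be]; the elements whose letters have the required
    form are a subgroup, so moves and products stay inside. *)
Lemma le_hh_ok (U : FF) : le U hh -> nfP okL U.
Proof.
move=> lU; have [s hs] := len_red U; have [t ht] := len_red (U^-1 * hh).
have hst := le_Red lU hs ht.
have e2 : len hh = (dlen (inr z : F + A)%type + dlen (inl (inj (inl v) * inj (inr be))%g : F + A))%N.
  by rewrite len_hh /= len_inj2.
have [N [M [fN fM sN sM e]]] := two_form (x := inr z : F + A) (y := inl _) isT e2 hst.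
rewrite -(Red_gp hs); apply: (nfP_gp okLM) => x xs.
have xst : x \in s ++ t by rewrite mem_cat xs.
apply: (nfP_heq okLM okLV e) xst => y /mapP[y' hy ->]; apply: (nfP_inj okLM).
move: hy; rewrite mem_cat => /orP[].
  have [r hr ->] := dfac_inr fN sN; by case/mapP=> a har ->; exact: inH_Red hr har.
have [r hr ->] := dfac_inl fM sM => /mapP[u ur ->] /=.
have [N1 [M1 [fN1 fM1 sN1 sM1 e1]]] := two_form (x := inl v : D) (y := inr be) isT (len_inj2 v be) hr.
apply: (nfP_heq okDM okDV e1) ur => y'' /mapP[d hd ->]; apply: (nfP_inj okDM).
move: hd; rewrite mem_cat => /orP[].
  have [r1 hr1 ->] := dfac_inl fN1 sN1; by case/mapP=> a har ->; exact: inH_Red hr1 har.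
by have [r1 hr1 ->] := dfac_inr fM1 sM1; case/mapP=> a har ->.
Qed.

Definition zcl (c : bool) (x : D) := c && isl x.
Definition prodl (w : seq (bool * D)) : FF := gp [seq lift y.1 y.2 | y <- w].
(** For a lifted word the first factor is [A * B], and this counts the maximal runs of letters
    outside the new copy of [A]: the number that the inner induction lowers. *)
Definition cnt (G H : rsys) (u : fp G H) := count isl (nf u).

Lemma zclP c x : zcl c x -> c = true /\ exists a, x = inl a.
Proof. by rewrite /zcl; case: c x => [] [a|b] //= _; split=> //; exists a. Qed.

Lemma count_zcl c x w : count (fun y => zcl y.1 y.2) ((c, x) :: w) = (zcl c x + count (fun y => zcl y.1 y.2) w)%N.
Proof. by []. Qed.

(* The normal form of the lifted word: letters of the first copy of [A] stay letters, and the maximal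
   runs of the other letters are multiplied together. *)
Lemma shape x w : reduced (map snd (x :: w)) ->
  [/\ zcl x.1 x.2 -> exists L, nf (prodl (x :: w)) = inr (lval x.2) :: L,
      ~~ zcl x.1 x.2 -> exists u u' L, nf (prodl (x :: w)) = inl u :: L /\ nf u = x.2 :: u',
      nfP okL (prodl (x :: w)) -> forall y, y \in x :: w -> if zcl y.1 y.2 then inH z (lval y.2) else okD y.2 &
      cnt (prodl (x :: w)) + zcl (last x w).1 (last x w).2 <=
        count (fun y => zcl y.1 y.2) (x :: w) + ~~ zcl x.1 x.2].
Proof.
elim: w x => [|y w IH] [c x] rw.
  have tx : ~~ triv x by move: rw => /andP[/andP[h _] _].
  have ep : prodl [:: (c, x)] = lift c x by exact: gp1.
  rewrite ep {ep} -![(c, x).1]/c -![(c, x).2]/x; case zx: (zcl c x).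
    have [ec [a ea]] := zclP zx; subst c x.
    have e : nf (lift true (inl a : A + B)) = [:: inr a] by rewrite /= /act /= (negbTE (tx : a != 1)).
    split; first by move=> _; exists [::]; exact: e.
    - by [].
    - by move=> ok [c' y]; rewrite inE => /eqP[-> ->]; apply: (ok (inr a)); rewrite e mem_head.
    - by rewrite /cnt e.
  have el : lift c x = inj (inl (inj x)) by case: x zx {tx rw} => [a|b] //=; rewrite /zcl andbT => ->.
  have ex : nf (inj x : F) = [:: x] by rewrite /= /act (negbTE tx).
  have ne : inj x != 1 :> F by apply/eqP => /(congr1 (@nf A B)); rewrite ex.
  have e : nf (lift c x) = [:: inl (inj x)] by rewrite el /= /act /= (negbTE ne).
  split=> // [_|ok|]; first by exists (inj x), [::], [::].
    move=> [c' y]; rewrite inE => /eqP[-> ->]; rewrite zx.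
    have := ok (inl (inj x)); rewrite e mem_head => /(_ isT x).
    by rewrite ex mem_head; apply.
  by rewrite /cnt e /= zx.
have rw' : reduced (map snd (y :: w)) by exact: reduced_tail rw.
have [h1 h2 h3 h4] := IH y rw'.
have tx : ~~ triv x by move: rw => /andP[/andP[h _] _].
have sxy : ~~ same x y.2 by move: rw => /andP[_ /= /andP[]].
have ep : prodl [:: (c, x), y & w] = lift c x * prodl (y :: w) by [].
case zx: (zcl c x).
  have [ec [a ea]] := zclP zx; subst c x.
  have zy : ~~ zcl y.1 y.2 by move: sxy; rewrite /zcl /same /=; case: (isl y.2) => //; rewrite andbF.
  have [u [u' [L [e eu]]]] := h2 zy.
  have e' : nf (prodl [:: (true, inl a), y & w]) = inr a :: nf (prodl (y :: w)).
    by rewrite ep nf_injM e /act /= (negbTE (tx : a != 1)).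
  split=> //; first by exists (nf (prodl (y :: w))).
  - move=> ok y'; rewrite inE => /orP[/eqP->/=|hy].
      by apply: (ok (inr a)); rewrite e' mem_head.
    by apply: h3 hy => b hb; apply: ok; rewrite e' inE hb orbT.
  - have -> : cnt (prodl [:: (true, inl a), y & w]) = cnt (prodl (y :: w)) by rewrite /cnt e'.
    apply: leq_trans h4 _; rewrite [in X in _ <= X]count_zcl zy.
    have -> : zcl true (inl a : D) = true by [].
    by rewrite addn0 addnC.
have el : lift c x = inj (inl (inj x)) by case: x zx {tx rw sxy ep} => [a|b] //=; rewrite /zcl andbT => ->.
have ex : nf (inj x : F) = [:: x] by rewrite /= /act (negbTE tx).
have ne : inj x != 1 :> F by apply/eqP => /(congr1 (@nf A B)); rewrite ex.
case zy: (zcl y.1 y.2).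
  have [L e] := h1 zy.
  have e' : nf (prodl [:: (c, x), y & w]) = inl (inj x) :: nf (prodl (y :: w)).
    by rewrite ep el nf_injM e /act /= (negbTE ne).
  split=> // [_|ok|]; first by exists (inj x), [::], (nf (prodl (y :: w))).
    move=> y'; rewrite inE => /orP[/eqP->|hy].
      rewrite zx; have := ok (inl (inj x)); rewrite e' mem_head => /(_ isT x).
      by rewrite ex mem_head; apply.
    by apply: h3 hy => b hb; apply: ok; rewrite e' inE hb orbT.
  have -> : cnt (prodl [:: (c, x), y & w]) = (cnt (prodl (y :: w))).+1 by rewrite /cnt e'.
  rewrite addSn -addn1; apply: leq_trans (leq_add h4 (leqnn _)) _.
  by rewrite [in X in _ <= X]count_zcl zy zx addn0.
have [u [u' [L [e eu]]]] := h2 (negbT zy).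
have eu2 : nf (inj x * u) = x :: nf u by rewrite nf_injM eu /act (negbTE tx) (negbTE sxy).
have ne2 : inj x * u != 1 :> F by apply/eqP => /(congr1 (@nf A B)); rewrite eu2.
have e' : nf (prodl [:: (c, x), y & w]) = inl (inj x * u) :: L.
  by rewrite ep el nf_injM e /act /= (negbTE ne) (negbTE ne2).
split=> // [_|ok|]; first by exists (inj x * u), (nf u), L.
  have okx : nfP okD (inj x * u) by apply: (ok (inl (inj x * u))); rewrite e' mem_head.
  move=> y'; rewrite inE => /orP[/eqP->|hy].
    by rewrite zx; apply: okx; rewrite eu2 mem_head.
  apply: h3 hy => b; rewrite e inE => /orP[/eqP->|hb].
    by move=> b' hb'; apply: okx; rewrite eu2 inE hb' orbT.
  by apply: ok; rewrite e' inE hb orbT.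
have -> : cnt (prodl [:: (c, x), y & w]) = cnt (prodl (y :: w)) by rewrite /cnt e' e.
by apply: leq_trans h4 _; rewrite [in X in _ <= X]count_zcl zy zx.
Qed.

End Classes.

(** * Labels occurring once in a noncrossing word, and powers of [h] *)

Lemma split_first (T : eqType) (a : T) t : a \in t -> exists u r, t = u ++ a :: r /\ a \notin u.
Proof.
elim: t => //= b t IH; rewrite inE; case: (a =P b) => [<- _|ne /= /IH [u [r [-> au]]]].
  by exists [::], t.
by exists (b :: u), r; split=> //; rewrite inE negb_or au andbT; apply/eqP.
Qed.

Lemma split_last (T : eqType) (a : T) t : a \in t -> exists u r, t = u ++ a :: r /\ a \notin r.
Proof.
rewrite -mem_rev => /split_first [u [r [e au]]]; exists (rev r), (rev u).
by rewrite mem_rev; split=> //; rewrite -[t]revK e rev_cat rev_cons cat_rcons.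
Qed.

Definition nadj (s : seq nat) := sorted (fun a b => a != b) s.

Lemma nc_gap a (u r : seq nat) l : noncrossing (a :: u ++ a :: r) -> l \in u -> a != l -> l \notin r.
Proof.
move=> nc lu al; apply/negP => lr; case/eqP: al; apply: nc; rewrite /= eqxx.
rewrite -[[:: l; a; l]]/([:: l] ++ [:: a; l]); apply: cat_subseq; first by rewrite sub1seq.
by rewrite /= eqxx sub1seq.
Qed.

Lemma nadj_cat u r : nadj (u ++ r) -> nadj u /\ nadj r.
Proof.
rewrite /nadj; elim: u => //= a u IH h; have [h1 h2] := IH (path_sorted h); split=> //.
by move: h; rewrite cat_path => /andP[].
Qed.

(** If the first label recurs, the part before its next occurrence is shorter and nonempty; a label
    alone there cannot reappear outside. *)
Lemma nc_single s : s != [::] -> noncrossing s -> nadj s -> exists2 l, l \in s & count_mem l s = 1%N.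
Proof.
have [n] := ubnP (size s); elim: n s => // n IH [|a t] //= hn _ nc na.
have [at_|/negP at_] := boolP (a \in t); last first.
  by exists a; rewrite ?mem_head // eqxx (count_memPn _) //; exact/negP.
have [u [r [et au]]] := split_first at_; subst t.
have un : u != [::] by apply/eqP => e; move: na; rewrite e /nadj /= eqxx.
have [l lu lc] : exists2 l, l \in u & count_mem l u = 1%N.
  apply: IH => //.
  - by move: hn; rewrite size_cat /=; lia.
  - by apply: noncrossing_sub nc; apply: (subseq_trans _ (subseq_cons _ _)); exact: prefix_subseq.
  - by have [] := nadj_cat (path_sorted na).
have al : a != l by apply: contraNneq au => ->.
have lr := nc_gap nc lu al.
by exists l; rewrite ?inE ?mem_cat ?lu ?orbT // (negbTE al) count_cat /= (negbTE al) lc (count_memPn lr).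
Qed.

(** Either [a] itself is alone and the tail provides another label, or one label is found before the
    second occurrence of [a] and another after its last one. *)
Lemma nc_single2 a t : last a t != a -> noncrossing (a :: t) -> nadj (a :: t) ->
  exists l1 l2, [/\ l1 != l2, count_mem l1 (a :: t) = 1%N & count_mem l2 (a :: t) = 1%N].
Proof.
move=> la nc na; have nt := path_sorted na.
have tn : t != [::] by apply: contraNneq la => ->.
have nct : noncrossing t by apply: noncrossing_sub nc; exact: subseq_cons.
have [at_|nat_] := boolP (a \in t); last first.
  have [l lt lc] := nc_single tn nct nt.
  have al : a != l by apply: contraNneq nat_ => ->.
  by exists a, l; rewrite /= eqxx (negbTE al) (count_memPn nat_) lc.
have [u [r [et ar]]] := split_last at_; have [u1 [r1 [et1 au1]]] := split_first at_.
have rn : r != [::] by apply: contraNneq la => e; rewrite et e last_cat.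
have u1n : u1 != [::] by apply/eqP => e; move: na; rewrite et1 e /nadj /= eqxx.
have nt1 : nadj (u1 ++ a :: r1) by rewrite -et1.
have [nu1 _] := nadj_cat nt1.
have nr : nadj r by have := nt; rewrite et => /nadj_cat [_ /path_sorted].
have [l1 l1u c1] : exists2 l, l \in u1 & count_mem l u1 = 1%N.
  apply: nc_single => //; apply: noncrossing_sub nct; rewrite et1; exact: prefix_subseq.
have [l2 l2r c2] : exists2 l, l \in r & count_mem l r = 1%N.
  apply: nc_single => //; apply: noncrossing_sub nct; rewrite et.
  by apply: (subseq_trans (subseq_cons _ _) (suffix_subseq _ _)).
have al1 : a != l1 by apply: contraNneq au1 => ->.
have al2 : a != l2 by apply: contraNneq ar => ->.
rewrite et1 in nc; have l1r := nc_gap nc l1u al1.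
have l2u : l2 \notin u.
  by apply/negP => h; rewrite -et1 et in nc; have := nc_gap nc h al2; rewrite l2r.
have rr : l2 \in r1.
  have e := et1; rewrite et in e; case: (cat_cons_eq e) => [[x [e1 _]]|[_ _ <-]|[x [_ e2]]] //.
    by move: au1; rewrite e1 mem_cat inE eqxx orbT.
  by rewrite e2 mem_cat inE l2r !orbT.
exists l1, l2; split; first by apply: contraNneq l1r => ->.
  by rewrite et1 /= (negbTE al1) count_cat /= (negbTE al1) c1 (count_memPn l1r).
by rewrite et /= (negbTE al2) count_cat /= (negbTE al2) c2 (count_memPn l2u).
Qed.

Lemma gp_only (G : groupType) (T : eqType) (g : nat * T -> G) (L : seq (nat * T)) l x :
  (l, x) \in L -> count_mem l (map fst L) = 1%N -> (forall z, z \in L -> z.1 != l -> g z = 1) ->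
  gp (map g L) = g (l, x).
Proof.
elim: L => //= -[k y] L IH; rewrite inE /= => h c H.
have H' z : z \in L -> z.1 != l -> g z = 1 by move=> hz; apply: H; rewrite inE hz orbT.
have [e|ne] := eqVneq k l; last first.
  rewrite (negbTE ne) in c; move: h; rewrite xpair_eqE eq_sym (negbTE ne) /= => h.
  by rewrite (H (k, y)) ?mem_head // mul1g; apply: IH.
have c0 : l \notin map fst L by apply/count_memPn; move: c; rewrite e eqxx add1n => -[].
have -> : gp (map g L) = 1.
  elim: L c0 H' {IH h c H} => //= z L IHL; rewrite inE negb_or => /andP[lz lL] H'.
  rewrite IHL // ?mulg1; first by apply: H'; rewrite ?mem_head // eq_sym.
  by move=> z' hz'; apply: H'; rewrite inE hz' orbT.
move: h => /orP[/eqP->|h]; first by rewrite mulg1.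
by rewrite (map_f fst h) in c0.
Qed.

Lemma pow_arith (a b bq bk hk hq : nat) : b <= bq + bk -> a + a + bq <= hq -> bk <= hk -> 0 < a ->
  (hk + hq)%N = (a + b)%N -> False.
Proof. lia. Qed.

Lemma pow_arith2 (a b hk hq : nat) : a + b <= hq -> (hk + hq)%N = (a + b)%N -> hk = 0.
Proof. lia. Qed.

Section Powers.
Variables A B : rsys.
Local Notation D := (A + B)%type.
Local Notation F := (fp A B).
Variables (al : A) (be : B).
Local Notation h := (inj (inl al) * inj (inr be) : F).
Hypotheses (al1 : al != 1) (be1 : be != 1).

Definition pword q : seq D := flatten (nseq q [:: inl al; inr be]).

Lemma ev_pword q : ev (pword q) = h ^+ q.
Proof. by elim: q => // q IH; rewrite expgS -IH /pword /= !ev_cons mulgA. Qed.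

Lemma reduced_pword q : reduced (pword q).
Proof.
case: q => // q; rewrite /reduced; apply/andP; split.
  by elim: q.+1 => //= k ->; rewrite al1 be1.
by elim: q => //= q ->; rewrite andbT.
Qed.

(* The reading of [h ^+ k.+1] has two letters that are alone on their regions, hence it is too long. *)
Lemma no_power k : 0 < k -> (len (h ^+ k) + len (h ^+ k.+1))%N = len h -> False.
Proof.
move=> k0; rewrite len_inj2 => el.
have [s hs] := len_red (h ^+ k.+1 : F).
have hs' : Red (ev (pword k.+1) : F) s by rewrite ev_pword.
have [L eL R] := reads_ex hs'.
have nc := reads_nc R.
have aL : alt (map snd L) by rewrite eL; case/andP: (reduced_pword k.+1).
have na : nadj (map fst L).
  have mono := reads_mono R; clear -aL mono; rewrite /nadj.
  elim: L aL mono => //= -[l x] [|[l' y] L] IH //= /andP[s aL] mono.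
  have mono' : monotype ((l', y) :: L) by move=> i a b ha hb; apply: (mono i); rewrite inE ?ha ?hb orbT.
  have /= -> := IH aL mono'; rewrite andbT.
  apply: contraNneq s => e; apply: (mono l); rewrite ?mem_head //.
  by rewrite e !inE eqxx orbT.
case: L eL R nc aL na => // -[l0 x0] L eL R nc aL na.
have ex0 : x0 = inl al by case: eL.
have lastne : last l0 (map fst L) != l0.
  have hl : last (l0, x0) L \in (l0, x0) :: L by exact: mem_last.
  have e2 : (last (l0, x0) L).2 = inr be.
    have -> : (last (l0, x0) L).2 = last x0 (map snd L) by rewrite -(last_map snd).
    have -> : last x0 (map snd L) = last x0 (map snd ((l0, x0) :: L)) by [].
    by rewrite eL; elim: (k) (x0) => // q IH x; exact: IH.
  have -> : last l0 (map fst L) = (last (l0, x0) L).1 by rewrite -(last_map fst).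
  apply/eqP => e1.
  move: hl e1 e2; case: (last (l0, x0) L) => l' y hl /= e1 e2; rewrite e1 e2 in hl.
  have h0 : (l0, x0) \in (l0, x0) :: L by exact: mem_head.
  by have := reads_mono R h0 hl; rewrite ex0.
have [l1 [l2 [l12 c1 c2]]] := nc_single2 lastne nc na.
set L0 := (l0, x0) :: L in eL R c1 c2.
have ex l : count_mem l (map fst L0) = 1%N -> exists2 x, (l, x) \in L0 & x = inl al \/ x = inr be.
  move=> c; have : l \in map fst L0 by rewrite -has_pred1 has_count c.
  case/mapP=> -[l' x] hx ->; exists x => //.
  have : x \in pword k.+1 by rewrite -eL; exact: (map_f snd hx).
  clear; elim: k.+1 => // q IH; rewrite /pword /= !inE => /or3P[/eqP->|/eqP->|/IH //]; by [left|right].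
have [x1 h1 e1] := ex l1 c1; have [x2 h2 e2] := ex l2 c2.
have sz : size s = len (h ^+ k.+1) by exact: hs.2.
(* Each of the two lone letters gets a coordinate of its own; the third coordinate keeps the letters
   selected by [X], which will avoid the sides of the lone ones. *)
pose f (X : pred D) l x : prs (prs F F) F :=
  if l == l1 then ((inj x, 1), 1) else if l == l2 then ((1, inj x), 1) else
  if X x then ((1, 1), inj x) else ((1, 1), 1).
have key (X : pred D) : (forall x y, same x y -> X x = X y) -> X x1 = false -> X x2 = false ->
    len (inj x1 : F) + len (inj x2 : F) + len (gp [seq (if X x then inj x else 1) | x <- pword k.+1] : F) <= len (h ^+ k.+1).
  move=> XE X1 X2.
  have fM l x y : same x y -> f X l (dmul x y) = f X l x * f X l y.
    move=> sxy; have sx : X (dmul x y) = X x by apply: XE; rewrite /same isl_dmul.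
    rewrite /f sx -(XE _ _ sxy); case: eqP => _; last case: eqP => _; last case: ifP => _;
    by rewrite ?inj_mul //; congr pair; rewrite /= ?mulg1 //; congr pair; rewrite /= ?mulg1.
  have fT l x : drefl x -> refl (f X l x) \/ f X l x = 1.
    move=> hx; have hx' := fprefl_inj hx; rewrite /f; case: eqP => _; last case: eqP => _; last case: ifP => _.
    - by left; left; split=> //; left.
    - by left; left; split=> //; right.
    - by left; right.
    - by right.
  have H := reads_len fM fT R; rewrite sz in H; apply: leq_trans _ H.
  set u := gp [seq f X z.1 z.2 | z <- L0]; have -> : len u = (len u.1.1 + len u.1.2 + len u.2)%N by rewrite len_prs len_prs.
  have u1 : u.1.1 = inj x1.
    rewrite /u (@morph_gp _ _ (fun c : prs (prs F F) F => c.1.1)) // -map_comp (gp_only h1 c1) /=; first by rewrite /f eqxx.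
    by move=> z _ nz; rewrite /f (negbTE nz); case: eqP => //= _; case: ifP.
  have u2 : u.1.2 = inj x2.
    rewrite /u (@morph_gp _ _ (fun c : prs (prs F F) F => c.1.2)) // -map_comp (gp_only h2 c2) /=.
      by rewrite /f eq_sym (negbTE l12) eqxx.
    by move=> z _ nz; rewrite /f (negbTE nz); case: eqP => //= _; case: ifP.
  have u3 : u.2 = gp [seq (if X x then inj x else 1) | x <- pword k.+1].
    rewrite /u gp_snd -eL -!map_comp; congr gp; apply/eq_in_map => -[l x] hx /=.
    have un l' x' : count_mem l' (map fst L0) = 1%N -> (l', x') \in L0 -> l = l' -> x = x'.
      move=> c h' el'; move: hx h' c; rewrite el'; clear; elim: L0 => //= -[a b] L' IH.
      rewrite !inE => /orP[/eqP[-> ->]|hx] /orP[/eqP[e e']|h']; rewrite ?e ?e' ?eqxx //=.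
      - by rewrite ?eqxx add1n => -[] /count_memPn; rewrite (map_f fst h').
      - by rewrite ?eqxx add1n => -[] /count_memPn; rewrite -e (map_f fst hx).
      - move=> c; apply: IH => //; case: (a =P l') c => //= _.
        by rewrite add1n => -[] /count_memPn; rewrite (map_f fst h').
    rewrite /f; case: eqP => [e|_]; first by rewrite (un _ _ c1 h1 e) X1.
    case: eqP => [e|_]; first by rewrite (un _ _ c2 h2 e) X2.
    by case: ifP.
  by rewrite u1 u2 u3.
have powX (X : pred D) q : gp [seq (if X x then inj x else 1) | x <- pword q] =
    ((if X (inl al) then inj (inl al) else 1) * (if X (inr be) then inj (inr be) else 1)) ^+ q :> F.
  by elim: q => // q IH; rewrite expgS -IH /pword /= !mulgA.
have hk : h ^+ k != 1 :> F.
  apply/eqP; rewrite -ev_pword => /ev_eq1 /(_ (reduced_pword k)).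
  by case: (k) k0.
have lenk : 0 < len (h ^+ k : F) by rewrite lt0n; apply: contra hk => /eqP/len_eq0 ->.
have tri (y : F) : len y <= len (y ^+ k.+1) + len (y ^+ k).
  have := lenM (y ^+ k.+1) (y ^+ k)^-1; rewrite lenV expgS mulgK; exact.
have pos1 : 0 < len al by rewrite lt0n; apply: contra al1 => /eqP/len_eq0 ->.
have pos2 : 0 < len be by rewrite lt0n; apply: contra be1 => /eqP/len_eq0 ->.
have prk : pr (h ^+ k) = ((al ^+ k), (be ^+ k)).
  elim: (k) => [|q IH]; first by rewrite (morph1 (@prM A B)).
  by rewrite !expgS prM IH pr_h.
have [ka kb] : len (al ^+ k) <= len (h ^+ k : F) /\ len (be ^+ k) <= len (h ^+ k : F).
  by have := len_pr (h ^+ k); rewrite prk /=; split; apply: leq_trans (_ : _ <= len (al ^+ k) + len (be ^+ k)) _; rewrite ?leq_addr ?leq_addl.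
have inlX q : (inj (inl al) : F) ^+ q = inj (inl (al ^+ q)).
  elim: q => [|q IH]; first by rewrite !expg0 inj_triv //= ?eqxx.
  by rewrite !expgS IH -inj_mul.
have inrX q : (inj (inr be) : F) ^+ q = inj (inr (be ^+ q)).
  elim: q => [|q IH]; first by rewrite !expg0 inj_triv //= ?eqxx.
  by rewrite !expgS IH -inj_mul.
(* Two lone letters [al] leave [be ^+ k.+1] in the third coordinate, and [tri] pushes the total
   above [len al + len be]; two letters [be] are symmetric. With one of each, [h ^+ k.+1] is already
   as long as [h], and [h ^+ k] would have length 0. *)
case: e1 => e1; case: e2 => e2; rewrite e1 e2 in key.
- have := key (fun x => ~~ isl x) _ erefl erefl; rewrite powX /= mul1g inrX !len_inj /=.
  have := tri (inj (inr be)); rewrite !inrX !len_inj /= => t1 t2.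
  have t3 : len al + len al + len (be ^+ k.+1) <= len (h ^+ k.+1 : F) by apply: t2 => x y /eqP ->.
  exact: pow_arith t1 t3 kb pos1 el.
- have := key pred0 _ erefl erefl; rewrite (powX pred0) /= mul1g !len_inj /= => t2.
  have {}t2 : len al + len be <= len (h ^+ k.+1 : F).
    by apply: leq_trans (t2 _); [exact: leq_addr|].
  by move: lenk; have := pow_arith2 t2 el; lia.
- have := key pred0 _ erefl erefl; rewrite (powX pred0) /= mul1g !len_inj /= => t2.
  have {}t2 : len al + len be <= len (h ^+ k.+1 : F).
    by rewrite addnC; apply: leq_trans (t2 _); [exact: leq_addr|].
  by move: lenk; have := pow_arith2 t2 el; lia.
- have := key (fun x => isl x) _ erefl erefl; rewrite (powX (fun x => isl x)) /= mulg1 inlX !len_inj /=.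
  have := tri (inj (inl al)); rewrite !inlX !len_inj /= => t1 t2.
  have t3 : len be + len be + len (al ^+ k.+1) <= len (h ^+ k.+1 : F) by apply: t2 => x y /eqP ->.
  rewrite addnC in el; rewrite addnC in el; rewrite [(len al + len be)%N]addnC in el.
  exact: pow_arith t1 t3 ka pos2 el.
Qed.
End Powers.

(** * The lift does not depend on the factorization *)

Section Uniqueness.
Variables A B : rsys.
Local Notation D := (A + B)%type.
Local Notation F := (fp A B).
Local Notation FF := (fp (fp A B) A).
Variables (al : A) (be : B).
Local Notation h := (inj (inl al) * inj (inr be) : F).
Implicit Types (w : seq D) (s : seq F).

Definition wcl (cl : nat -> bool) w x0 : seq (bool * D) := [seq (cl i, nth x0 w i) | i <- iota 0 (size w)].

Lemma prodl_wcl cl w x0 : gp [seq lift (cl i) (nth x0 w i) | i <- iota 0 (size w)] = prodl (wcl cl w x0).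
Proof. by rewrite /prodl /wcl -map_comp. Qed.

Lemma snd_wcl cl w x0 : map snd (wcl cl w x0) = w.
Proof. by rewrite /wcl -map_comp -[RHS](mkseq_nth x0). Qed.

Lemma lifting_letters w s x0 z cl : reduced w -> 1 < size w -> lifting al be w s x0 z cl ->
  forall i, i < size w -> if zcl (cl i) (nth x0 w i) then inH z (lval (nth x0 w i)) else okD (z^-1 * al) (nth x0 w i).
Proof.
move=> rw sw [_ _ _ lh _] i hi; rewrite prodl_wcl in lh.
have ok := le_hh_ok lh.
have hin : (cl i, nth x0 w i) \in wcl cl w x0 by apply: map_f; rewrite mem_iota.
have rw' : reduced (map snd (wcl cl w x0)) by rewrite snd_wcl.
case: (wcl cl w x0) hin rw' ok => // y v hin rw' ok.
by have [_ _ h3 _] := shape z (z^-1 * al) rw'; exact: h3 ok _ hin.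
Qed.

(** If [e] is marked for [s] but not for [s'], then its letter lies in the subgroup of [z^-1 al] by
    the second lifting, and by the first it or its inverse is carried below [z] by an element of the
    subgroup of [z]. Then [indep] makes it trivial, impossible in a reduced word. *)
Lemma class_half w s s' x0 z cl cl' : reduced w -> 1 < size w -> indep al ->
  lifting al be w s x0 z cl -> lifting al be w s' x0 z cl' ->
  forall e, e < size w -> isl (nth x0 w e) -> cl e -> cl' e.
Proof.
move=> rw sw ia H H' e he; case ee: (nth x0 w e) => [x|] // _ ce; case ce': (cl' e) => //.
have e0 : 0 < e.
  by rewrite lt0n; apply/eqP => e0; case: H' => c0 _ _ _ _; rewrite e0 c0 in ce'.
have ok := lifting_letters rw sw H; have ok' := lifting_letters rw sw H'.
case: H => _ lz _ _ /(_ e x); rewrite e0 he => /(_ isT ee ce) [sel hsel hl].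
have hx : inH (z^-1 * al) x by have := ok' e he; rewrite ee /zcl ce'.
set g := gp _ in hl; have hg : inH z g.
  apply: inH_gp => y /mapP[i]; rewrite mem_filter => /andP[/hsel [h1 h2 h3] _] ->.
  by have := ok i; rewrite /zcl h1 h2; apply; lia.
have eal : al = z * (z^-1 * al) by rewrite mulVKg.
have x1 : x = 1.
  case: hl => hl; first exact: ia _ _ eal lz _ _ hg hx hl.
  have := ia _ _ eal lz _ _ hg (inHV hx) hl => e1.
  by rewrite -[x]invgK e1 invg1.
move: rw => /andP[/allP /(_ (nth x0 w e))]; rewrite mem_nth // ee x1 => /(_ isT) /=.
by rewrite eqxx.
Qed.

Lemma class_uniq w s s' x0 z cl cl' : reduced w -> 1 < size w -> indep al ->
  lifting al be w s x0 z cl -> lifting al be w s' x0 z cl' ->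
  gp [seq lift (cl i) (nth x0 w i) | i <- iota 0 (size w)] =
  gp [seq lift (cl' i) (nth x0 w i) | i <- iota 0 (size w)] :> FF.
Proof.
move=> rw sw ia H H'; congr gp; apply/eq_in_map => i; rewrite mem_iota => hi.
have [c1 c2] := (class_half rw sw ia H H' (e := i), class_half rw sw ia H' H (e := i)).
case e: (nth x0 w i) => [a|b] //; rewrite e in c1 c2.
by congr (lift _ _); apply/idP/idP; [apply: c1|apply: c2].
Qed.

(** Two factorizations lift to reduced factorizations of one and the same element; if these are
    Hurwitz equivalent, folding carries the equivalence down. *)
Lemma lifting_single w x0 z : reduced w -> 1 < size w -> nth x0 w 0 = inl z -> indep al -> le (ev w : F) h ->
  (forall s cl, lifting al be w s x0 z cl ->
    single (gp [seq lift (cl i) (nth x0 w i) | i <- iota 0 (size w)] : FF) \/ single (ev w : F)) ->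
  single (ev w : F).
Proof.
move=> rw sw w0 ia lw H s t Hs Ht.
have [cl Hcl] := first_lift rw sw w0 lw Hs; have [cl' Hcl'] := first_lift rw sw w0 lw Ht.
have [S|S] := H s cl Hcl; last exact: S.
have := class_uniq rw sw ia Hcl Hcl'.
case: Hcl => _ _ [r Rr <-] _ _; case: Hcl' => _ _ [r' Rr' <-] _ _ e.
by apply: heq_map; [exact: foldM|apply: S => //; rewrite e].
Qed.

End Uniqueness.

(** * Appending a letter to a normal form *)

Section RightMultiplication.
Variables G H : rsys.
Lemma alt_rcons (x : G + H) w y : alt (rcons (x :: w) y) = alt (x :: w) && ~~ same (last x w) y.
Proof. exact: rcons_path. Qed.

Lemma reduced_rcons (x : G + H) w y : reduced (rcons (x :: w) y) = [&& reduced (x :: w), ~~ triv y & ~~ same (last x w) y].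
Proof.
rewrite /reduced alt_rcons all_rcons; by case: (~~ triv y); case: (all _ _); case: (alt _) => //=; rewrite ?andbF.
Qed.

(** Conjugation by [z^-1] moves [z] from the front of the lifted word to its end. The head survives,
    and the number of letters in the first factor is unchanged. *)
Lemma rmul_inr u L (z : H) : reduced (inl u :: L) -> z != 1 ->
  exists W, [/\ reduced (inl u :: W), ev (inl u :: W) = ev (inl u :: L) * inj (inr z) :> fp G H &
    count isl (inl u :: W) = count (@isl G H) (inl u :: L)].
Proof.
move=> r z1; have [E|ne] := eqVneq L [::].
  subst L; exists [:: inr z]; split=> //; first by rewrite -[_ :: _]/(rcons [:: inl u] (inr z)) reduced_rcons r /= z1.
  by rewrite !ev_cons /ev /= mulg1 mulg1.
case/lastP: L r ne => // L y; rewrite -rcons_cons => r _.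
have := r; rewrite reduced_rcons => /and3P[rL ty sy].
case: y r ty sy => [u'|a] r ty sy.
  exists (rcons (rcons L (inl u')) (inr z)); rewrite -!rcons_cons; split.
  - by rewrite rcons_cons reduced_rcons -rcons_cons r /= z1 last_rcons.
  - by rewrite -!cats1 !ev_cat !ev1.
  - by rewrite -!cats1 !count_cat /= !addn0.
have [e|ne] := eqVneq (a * z) 1.
  exists L; split=> //; last by rewrite -cats1 count_cat /= !addn0.
  by rewrite -cats1 ev_cat ev1 -mulgA -inj_mul //= e inj_triv ?mulg1 //= eqxx.
exists (rcons L (inr (a * z))); rewrite -!rcons_cons; split.
- by rewrite reduced_rcons rL /= ne.
- by rewrite -!cats1 !ev_cat !ev1 -[RHS]mulgA -inj_mul.
- by rewrite -!cats1 !count_cat.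
Qed.
End RightMultiplication.

Lemma alt_nth (A B : groupType) (x : A + B) w x0 i : alt (x :: w) -> i < size (x :: w) ->
  isl (nth x0 (x :: w) i) = isl x (+) odd i.
Proof.
elim: w x i => [|y w IH] x [|i] //; rewrite ?addbF //= => /andP[s a] hi.
rewrite (IH y i a hi); move: s; rewrite /same; case: (isl x) (isl y) (odd i) => [] [] [] //.
Qed.

Lemma squeeze4 (a b v c d z e : nat) : b + v <= c -> a <= d -> z + e <= a + b ->
  (d + c)%N = (z + (v + e))%N -> (a + b)%N = (z + e)%N.
Proof. lia. Qed.

(** * The case in which every letter of the first factor is marked *)

Section KillClass.
Variables A B : rsys.
Local Notation F := (fp A B).
Local Notation FF := (fp (fp A B) A).
Variables (al : A) (be : B).

(** With [kL], this sends the unmarked copy of [A] to the second coordinate and keeps the marked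
    copy together with [B] in the first. *)
Definition kD (x : A + B) : prs F A := match x with inl a => (1, a) | inr b => (inj (inr b), 1) end.
Definition kL (y : F + A) : prs F A := match y with inl u => hom kD u | inr a => (inj (inl a), 1) end.
Lemma kDM x y : same x y -> kD (dmul x y) = kD x * kD y.
Proof. by case: x y => [a|a] [b|b] //= _; congr pair; rewrite /= ?mulg1 // -inj_mul. Qed.
Lemma kLM x y : same x y -> kL (dmul x y) = kL x * kL y.
Proof.
case: x y => [a|a] [b|b] //= _; first exact: (homM kDM).
by congr pair; rewrite /= ?mulg1 // -inj_mul.
Qed.
Lemma kL_refl y : drefl y -> refl (kL y).
Proof.
case: y => [u|a] /= hu; last by left; split=> //; exact: fprefl_inj.
apply: (hom_refl kDM) hu => x hx; case: x hx => a ha; first by right.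
by left; split=> //; exact: fprefl_inj.
Qed.

(* If every letter of the first factor is in class [true], the other part of the content can be dropped. *)
Lemma kill_class w s x0 z cl : lifting al be w s x0 z cl ->
  (forall i, i < size w -> isl (nth x0 w i) -> cl i) ->
  le (ev w : F) (inj (inl z) * inj (inr be)).
Proof.
move=> [_ _ _ lh _] hc; set U := gp _ in lh; set hh := _ * _ in lh.
have KM := homM kLM.
have kU : hom kL U = (ev w, 1).
  rewrite /U (morph_gp KM) -map_comp.
  have -> : ev w = gp [seq inj (nth x0 w i) | i <- iota 0 (size w)] :> F.
    by rewrite -{1}(mkseq_nth x0 w) /ev /mkseq -map_comp.
  have : forall i, i \in iota 0 (size w) -> isl (nth x0 w i) -> cl i by move=> i; rewrite mem_iota => /hc.
  elim: (iota _ _) => //= i js IH H; rewrite IH => [|j hj]; last by apply: H; rewrite inE hj orbT.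
  have := H i (mem_head _ _); case: (nth x0 w i) => a /=.
    by move=> /(_ isT) ->; rewrite hom_inj; [|exact: kLM]; congr pair; rewrite /= mulg1.
  move=> _; rewrite hom_inj; [|exact: kLM]; rewrite /= hom_inj; [|exact: kDM].
  by congr pair; rewrite /= mulg1.
have kh : hom kL hh = (inj (inl z) * inj (inr be), z^-1 * al).
  rewrite /hh KM !(hom_inj kLM) /= (homM kDM) !(hom_inj kDM) /=.
  by congr pair; rewrite /= ?mul1g ?mulg1.
have kl (x : FF) : len (hom kL x) <= len x.
  by apply: (@len_hom FF (prs F A) (hom kL) KM) => t ht; left; exact: (hom_refl kLM kL_refl ht).
have := kl U; have := kl (U^-1 * hh); rewrite KM (morphV KM) kU kh !len_prs /= invg1 mul1g len1 addn0.
move=> k1 k2; have := len_hh be z (z^-1 * al); rewrite -/hh => eh.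
have t := lenM (ev w : F) ((ev w)^-1 * (inj (inl z) * inj (inr be))); rewrite mulVKg in t.
rewrite len_inj2 in t; rewrite /le len_inj2.
by move: lh; rewrite /le eh; exact: squeeze4 k1 k2 t.
Qed.
End KillClass.

(** * The double induction for words that begin in the first factor *)

Definition pant_indep (G : rsys) (c : G) := pant c /\ indep c.

Section Induction.
Variable n : nat.
Hypothesis IHn : forall (A B : rsys) (al : A) (be : B), pant_indep al -> pant_indep be -> len al + len be < n ->
  pant (inj (inl al) * inj (inr be) : fp A B).

(** All systems are quantified inside, because a lifting step replaces the pair [A], [B] by [A * B],
    [A]. *)
Definition single_inl_upto q := forall (A B : rsys) (al : A) (be : B), pant_indep al -> pant_indep be -> len al + len be <= n ->
  forall z w, reduced (inl z :: w) -> count isl (inl z :: w) <= q ->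
  le (ev (inl z :: w) : fp A B) (inj (inl al) * inj (inr be)) -> single (ev (inl z :: w) : fp A B).

Lemma len_gt0 (G : rsys) (x : G) : x != 1 -> 0 < len x.
Proof. by move=> x1; rewrite lt0n; apply: contra x1 => /eqP/len_eq0 ->. Qed.

Lemma pant_indep_le (G : rsys) (x c : G) : le x c -> pant_indep c -> pant_indep x.
Proof. by move=> l [h1 h2]; split; [exact: pant_le l h1|exact: indep_le l h2]. Qed.

(** If all first-factor letters are marked and the length is even, [kill_class] allows [al] to be
    replaced by the shorter [z]. Otherwise the lift conjugated by [z^-1] lies below [(v be) z],
    whose total length is that of [h], and it has fewer letters in its first factor. *)
Lemma single_inl_nonfull q : (forall q', q' < q -> single_inl_upto q') -> forall (A B : rsys) (al : A) (be : B),
  pant_indep al -> pant_indep be -> len al + len be <= n ->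
  forall z w, reduced (inl z :: w) -> count isl (inl z :: w) <= q ->
  le (ev (inl z :: w) : fp A B) (inj (inl al) * inj (inr be)) ->
  z != al \/ odd (size (inl z :: w : seq (A + B))) -> single (ev (inl z :: w) : fp A B).
Proof.
move=> IHq A B al be ga gb ln z w rw cq lw zodd.
have [w0|wn] := eqVneq w [::].
  subst w; rewrite ev1 in lw *; exact: single_letter ga.1 gb.1 lw.
have z1 : z != 1 by move: rw => /andP[/andP[]].
have sw : 1 < size (inl z :: w : seq (A + B)) by case: (w) wn.
apply: (lifting_single (x0 := inl 1) rw sw erefl ga.2 lw) => s cl Hcl.
have ok := lifting_letters rw sw Hcl.
set ww := inl z :: w in rw cq lw zodd sw ok Hcl *.
case: (Hcl) => c0 lz _ lh _; rewrite prodl_wcl in lh *.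
set v := z^-1 * al in lz lh ok.
have eal : al = z * v by rewrite /v mulVKg.
have zle : le z al by rewrite eal; apply: le_factorl; rewrite -eal lz.
have vle : le v al by rewrite eal; apply: le_factorr; rewrite -eal lz.
have gz := pant_indep_le zle ga; have gv := pant_indep_le vle ga.
have pz := len_gt0 z1.
have Ew : wcl cl ww (inl 1) = (true, inl z) :: [seq (cl i.+1, nth (inl 1) w i) | i <- iota 0 (size w)].
  by rewrite /wcl /ww /= c0 -add1n iotaDl -map_comp.
set cw := [seq _ | i <- iota 0 (size w)] in Ew.
have scw : map snd cw = w by rewrite /cw -map_comp -[RHS](mkseq_nth (inl 1)).
(* This is the one situation in which the count of letters need not drop. *)
have [allz|notall] := boolP (~~ odd (size ww) && all (fun y => isl y.2 ==> y.1) cw).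
  right; move: allz => /andP[ev_ allz].
  have zal : z != al by case: zodd => //; rewrite (negbTE ev_).
  have v1 : v != 1 by apply: contra zal => /eqP ev1; rewrite eal ev1 mulg1.
  have pv := len_gt0 v1.
  have lzb := kill_class Hcl; rewrite -/v in lzb.
  have {}lzb : le (ev ww : fp A B) (inj (inl z) * inj (inr be)).
    apply: lzb => i hi il; have [->|i0] := eqVneq i 0; first by [].
    have hi' : (cl i, nth (inl 1) ww i) \in cw.
      apply/mapP; exists i.-1; first by rewrite mem_iota; move: hi; rewrite /ww /=; lia.
      by rewrite -[in LHS](prednK (n := i)) ?lt0n.
    by have /allP/(_ _ hi') := allz; rewrite /= il.
  by apply: (IHn gz gb _ lzb); move: ln; rewrite -lz; lia.
left; case ecw: cw => [|y cw'].
  by move: wn; rewrite -scw ecw.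
have rw2 : reduced (map snd cw) by rewrite scw; exact: reduced_tail rw.
have sy : ~~ isl y.2.
  by move: rw; rewrite /ww -scw ecw /= => /andP[_ /andP[]]; rewrite /same /=; case: (isl y.2).
have ny : ~~ zcl y.1 y.2 by rewrite /zcl negb_and sy orbT.
rewrite ecw in rw2; have [_ h2 _ h4] := shape z v rw2.
have [u [u' [L [enf _]]]] := h2 ny.
have rN : reduced (inl u :: L) by rewrite -enf; exact: nf_red.
have [W [rW eW cW]] := rmul_inr rN z1.
(* Conjugation by [z^-1] makes the word begin in the factor [A * B], as the inner induction
   requires. *)
rewrite Ew ecw; set g : fp (fp A B) A := (inj (inr z))^-1; apply/(single_cj g).
have eU : cj g (prodl ((true, inl z) :: y :: cw')) = ev (inl u :: W) :> fp (fp A B) A.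
  by rewrite eW -enf ev_nf /prodl !map_cons !gp_cons /cj invgK !mulgA mulVg mul1g.
rewrite eU; have lU : le (ev (inl u :: W) : fp (fp A B) A)
    (inj (inl (inj (inl v) * inj (inr be))) * inj (inr z)).
  have /(le_cj g) := lh; rewrite Ew ecw eU => l.
  have e3 : cj g (inj (inr z) * inj (inl (inj (inl v) * inj (inr be)))) = inj (inl (inj (inl v) * inj (inr be))) * inj (inr z).
    by rewrite /cj invgK mulKg.
  by rewrite -e3.
have lnv : len v + len be < n by clear -ln lz pz; move: ln; rewrite -lz; lia.
have gZ : pant_indep (inj (inl v) * inj (inr be) : fp A B).
  by split; [exact: IHn gv gb lnv|exact: indep_fp gv.2 gb.2].
have lnZ : len (inj (inl v) * inj (inr be) : fp A B) + len z <= n.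
  by rewrite len_inj2; clear -ln lz; move: ln; rewrite -lz; lia.
apply: (IHq (count isl (inl u :: W)) _ _ _ _ _ gZ gz lnZ) => //.
rewrite cW -enf -/(cnt _); apply: leq_trans cq.
have cz : count (fun y => zcl y.1 y.2) (y :: cw') <= count isl w.
  by rewrite -scw ecw count_map; apply: sub_count => -[c x] /= /andP[].
rewrite /ww [count _ (_ :: w)]/= add1n ltnS.
have strict : (exists2 y', y' \in y :: cw' & isl y'.2 && ~~ y'.1) -> count (fun y => zcl y.1 y.2) (y :: cw') < count isl w.
  case=> y' hy' /andP[i1 i2]; rewrite -scw ecw count_map.
  elim: (y :: cw') hy' => //= t r IH; rewrite inE => /orP[/eqP<-|/IH {}IH].
    rewrite /zcl (negbTE i2) i1 /= add0n add1n ltnS; apply: sub_count => -[c x] /= /andP[] //.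
  by rewrite -addnS leq_add //; case: (t) => [[] x] //=; rewrite /zcl /=; case: (isl x).
rewrite ny addn1 in h4.
(* The count drops because some letter of [A] is unmarked and is absorbed into a run, or else
   because the word ends in a marked letter, so that no run follows it. *)
have [/strict st|ns] := pselect (exists2 y', y' \in y :: cw' & isl y'.2 && ~~ y'.1).
  by apply: leq_trans st; apply: leq_trans h4; exact: leq_addr.
have al' : all (fun y => isl y.2 ==> y.1) cw.
  apply/allP => y' hy'; apply/implyP => iy; apply: contrapT => /negP ny'.
  by apply: ns; exists y'; rewrite -?ecw // iy.
rewrite al' andbT negbK in notall.
have lz1 : zcl (last y cw').1 (last y cw').2.
  have hl : last y cw' \in cw by rewrite ecw mem_last.
  have il : isl (last y cw').2.
    have -> : (last y cw').2 = last (inl z) w by rewrite -scw ecw /= -(last_map snd).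
    rewrite (last_nth (inl 1)) alt_nth //; last by case/andP: rw.
  by rewrite /zcl il andbT; have /allP/(_ _ hl) := al'; rewrite il.
by rewrite lz1 addn1 ltnS in h4; apply: leq_trans h4 cz.
Qed.

End Induction.

(** * Rotating words, and the end of the argument for first-factor heads *)

Lemma alt_count (A B : groupType) (x : A + B) w : alt (x :: w) ->
  count isl (x :: w) = if isl x then uphalf (size (x :: w)) else (size (x :: w))./2.
Proof.
elim: w x => [|y w IH] x; first by case: (x).
move=> /andP[s a]; have := IH y a; rewrite /= => ->; move: s; rewrite /same; case: (isl x) (isl y) => [] [] //= _; lia.
Qed.

Lemma alt_last (A B : groupType) (x : A + B) w : alt (x :: w) -> isl (last x w) = isl x (+) odd (size w).
Proof. by move=> a; rewrite (last_nth x) alt_nth. Qed.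

Lemma single1 (G : rsys) : single (1 : G).
Proof. by move=> s t [_]; rewrite len1 => /size0nil -> [_]; rewrite len1 => /size0nil ->; exact: heq_refl. Qed.

Section Rotation.
Variables (A B : rsys) (al : A) (be : B).
Local Notation F := (fp A B).
Local Notation h := (inj (inl al) * inj (inr be) : F).

Lemma rotate_le (g a : F) : cj g h = inj (inr be) * inj (inl al) -> le a h ->
  le (swp (cj g a)) (inj (inl be) * inj (inr al)).
Proof.
move=> e l; have -> : inj (inl be) * inj (inr al) = swp (cj g h) by rewrite e swpM !swp_inj.
by apply/swp_le/le_cj.
Qed.

Lemma rotate_single (g a : F) : single (swp (cj g a)) -> single a.
Proof. by move=> /swp_single/single_cj. Qed.

Lemma cj_alV : cj (inj (inl al))^-1 h = inj (inr be) * inj (inl al).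
Proof. by rewrite /cj invgK mulKg. Qed.

Lemma cj_be : cj (inj (inr be)) h = inj (inr be) * inj (inl al).
Proof. by rewrite /cj mulgA mulgK. Qed.

Lemma swp_cj_head (x : A + B) w : swp (cj (inj x)^-1 (ev (x :: w))) = ev (map (@dswap A B) (rcons w x)).
Proof. by rewrite /cj invgK ev_cons mulKg -ev1 -ev_cat cats1 swp_ev. Qed.
End Rotation.

Lemma all_full (T : Type) (x y : T) w : ~~ odd (size w) ->
  (forall i, i < size w -> nth x w i = if odd i then y else x) -> w = flatten (nseq (size w)./2 [:: x; y]).
Proof.
have [k] := ubnP (size w); elim: k w => // k IH [|a [|b w]] //= hk; rewrite negbK => ev H.
have /= e0 := H 0 isT; have /= e1 := H 1%N isT; subst a b; congr [:: _, _ & _].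
by apply: IH ev _ => // [|i hi]; [lia|have := H i.+2; rewrite /= negbK; apply].
Qed.

Section Induction.
Variable n : nat.
Hypothesis IHn : forall (A B : rsys) (al : A) (be : B), pant_indep al -> pant_indep be -> len al + len be < n ->
  pant (inj (inl al) * inj (inr be) : fp A B).

(** The index [i] points at a letter that deviates from the pattern [al be al be]. Moving the head
    [al] to the end and exchanging the factors brings the deviation one step closer to the front,
    where [single_inl_nonfull] applies. *)
Lemma single_inl_rotate q i : (forall q', q' < q -> single_inl_upto n q') -> forall (A B : rsys) (al : A) (be : B),
  pant_indep al -> pant_indep be -> len al + len be <= n ->
  forall z w, reduced (inl z :: w) -> count isl (inl z :: w) <= q ->
  le (ev (inl z :: w) : fp A B) (inj (inl al) * inj (inr be)) ->
  i < size (inl z :: w : seq (A + B)) ->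
  nth (inl al) (inl z :: w) i <> (if odd i then inr be else inl al) -> single (ev (inl z :: w) : fp A B).
Proof.
move=> IHq; elim: i => [|i IH] A B al be ga gb ln z w rw cq lw hi ni.
  by apply: (single_inl_nonfull IHn IHq ga gb ln rw cq lw); left; apply: contra_notN ni => /eqP->.
have [o|oe] := boolP (odd (size (inl z :: w : seq (A + B)))).
  by apply: (single_inl_nonfull IHn IHq ga gb ln rw cq lw); right.
have [ze|zn] := eqVneq z al; last by apply: (single_inl_nonfull IHn IHq ga gb ln rw cq lw); left.
subst z; case: w rw cq lw hi ni oe => [|y w] // rw cq lw hi ni oe.
have aw : alt [:: inl al, y & w] by case/andP: rw.
case: y rw cq lw hi ni oe aw => [c|b] rw cq lw hi ni oe aw; first by case/andP: aw.
apply: (rotate_single (g := (inj (inl al))^-1)).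
have := rotate_le (cj_alV al be) lw; rewrite swp_cj_head rcons_cons /= => l'.
have ln' : len be + len al <= n by rewrite addnC.
have rw' : reduced (inl b :: map (@dswap A B) (rcons w (inl al))).
  rewrite -[_ :: _]/(map (@dswap A B) (rcons (inr b :: w) (inl al))) reduced_dswap reduced_rcons.
  rewrite (reduced_tail rw); case/andP: (rw) => /andP[-> _] _ /=.
  have := alt_last aw; rewrite /= /same => ->.
  by move: oe => /=; rewrite negbK => ->.
(* An alternating word of even length has equally many letters on both sides, so the exchange keeps
   the bound [q]. *)
have cw : count isl (inl b :: map (@dswap A B) (rcons w (inl al))) <= q.
  have ab : alt (inl b :: map (@dswap A B) (rcons w (inl al))) by case/andP: rw'.
  rewrite (alt_count ab); apply: leq_trans cq; rewrite (alt_count aw) /= size_map size_rcons //.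
apply: (IH _ _ _ _ gb ga ln' _ _ rw' cw l'); first by rewrite /= size_map size_rcons; exact: ltnW.
have -> : inl b :: map (@dswap A B) (rcons w (inl al)) = map (@dswap A B) (rcons (inr b :: w) (inl al)) by [].
rewrite (nth_map (inl al)); last by rewrite size_rcons; exact: ltnW.
rewrite nth_rcons; move: ni => /=.
have -> : (i < size (inr b :: w)) by move: hi => /=; lia.
by case: (nth _ _ _) => c /=; case: (odd i) => //= nc [] ec; apply: nc; rewrite ec.
Qed.

(** Without odd length and without a deviating letter the word is a power of [h]: trivial, [h]
    itself, or excluded by [no_power]. *)
Lemma single_head_inl q : single_inl_upto n q.
Proof.
have [k] := ubnP q; elim: k q => // k IH q hq A B al be ga gb ln z w rw cq lw.
have IHq q' : q' < q -> single_inl_upto n q' by move=> h; apply: IH; lia.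
have [o|e] := boolP (odd (size (inl z :: w : seq (A + B)))).
  by apply: (single_inl_nonfull IHn IHq ga gb ln rw cq lw); right.
have [[i [hi ni]]|H] := pselect (exists i, i < size (inl z :: w : seq (A + B)) /\
    nth (inl al) (inl z :: w) i <> (if odd i then inr be else inl al)).
  exact: (single_inl_rotate IHq ga gb ln rw cq lw hi ni).
have /(all_full e) Ew i : i < size (inl z :: w : seq (A + B)) ->
    nth (inl al) (inl z :: w) i = (if odd i then inr be else inl al).
  by move=> hi; apply: contrapT => ni; apply: H; exists i.
set p := (_./2) in Ew; rewrite Ew in rw lw *.
case: p {Ew} rw lw => [|p] rw lw.
  exact: single1.
have al1 : al != 1 by move: rw => /andP[/andP[]].
have be1 : be != 1 by move: rw => /andP[/and3P[]].
move: lw; rewrite -/(pword al be _) ev_pword; case: p rw => [|p] rw lw.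
  rewrite expg1; apply: single_h; [exact: ga.1 (le_refl _)|exact: gb.1 (le_refl _)].
(* The complement of [h ^+ p.+2] in [h] is the inverse of [h ^+ p.+1], so being below [h] is the
   length equation of [no_power]. *)
exfalso; apply: (no_power al1 be1 (k := p.+1)) => //.
move: lw; rewrite /le; set h := inj (inl al) * inj (inr be).
by rewrite -(lenV (_^-1 * _)) invgM invgK (expgS h p.+1) mulKg addnC.

Qed.

End Induction.

(** * Words that begin in the second factor, and the theorem for reflection systems *)

Lemma rmul_head (G H : rsys) (x z : G + H) w : reduced (x :: w) -> w != [::] ->
  exists W, [/\ reduced (x :: W), ev (x :: W) = ev (x :: w) * inj z :> fp G H &
    size W <= size w + ~~ same (last x w) z].
Proof.
case/lastP: w => // w t; rewrite -rcons_cons last_rcons => rw _.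
have [tz|tz] := boolP (triv z).
  by exists (rcons w t); rewrite // inj_triv // mulg1 leq_addr.
have := rw; rewrite reduced_rcons => /and3P[rx tt st].
have [sm|sm] := boolP (same t z); last first.
  exists (rcons (rcons w t) z); split.
  - by rewrite -!rcons_cons reduced_rcons rw tz last_rcons.
  - by rewrite -!rcons_cons -!cats1 !ev_cat !ev1.
  - by rewrite [X in X <= _]size_rcons addn1.
have [tm|tm] := boolP (triv (dmul t z)).
  exists w; split=> //; last by rewrite size_rcons addn0.
  by rewrite -cats1 ev_cat ev1 -[RHS]mulgA -inj_mul // (inj_triv tm) mulg1.
exists (rcons w (dmul t z)); split.
- by rewrite -rcons_cons reduced_rcons rx tm /same isl_dmul.
- by rewrite -rcons_cons -!cats1 !ev_cat !ev1 inj_mul // mulgA.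
- by rewrite !size_rcons addn0.
Qed.

Lemma reduced_head (A B : groupType) (x y : A + B) w :
  reduced (x :: w) -> same x y -> ~~ triv y -> reduced (y :: w).
Proof.
rewrite /reduced /= => /andP[/andP[_ ->] a] s ->.
by case: w a => //= z w /andP[sz ->]; rewrite andbT; move: sz; rewrite /same (eqP s).
Qed.

Section Induction.
Variable n : nat.
Hypothesis IHn : forall (A B : rsys) (al : A) (be : B), pant_indep al -> pant_indep be -> len al + len be < n ->
  pant (inj (inl al) * inj (inr be) : fp A B).

Lemma swp_cj_inr (A B : rsys) (be b : B) w :
  swp (cj (inj (inr be)) (ev (inr b :: w) : fp A B)) = ev (inl (be * b) :: map (@dswap A B) w) * inj (inl be^-1).
Proof.
rewrite /cj -inj_inv ev_cons mulgA -inj_mul // -ev_cons swpM swp_inj; congr (_ * _).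
by rewrite swp_ev.
Qed.

(** Conjugating by [be] turns the head into [be b]. It is nontrivial, and after exchanging the
    factors the word begins in the first one, a case already settled. *)
Lemma single_inr_nonfull (A B : rsys) (al : A) (be : B) : pant_indep al -> pant_indep be -> len al + len be <= n ->
  forall b w, reduced (inr b :: w) -> w != [::] -> b != be^-1 ->
  le (ev (inr b :: w) : fp A B) (inj (inl al) * inj (inr be)) -> single (ev (inr b :: w) : fp A B).
Proof.
move=> ga gb ln b w rw wn bn lw; apply: (rotate_single (g := inj (inr be))).
have := rotate_le (cj_be al be) lw; rewrite swp_cj_inr => l'.
have r1 : reduced (inl (be * b) :: map (@dswap A B) w).
  apply: (@reduced_head _ _ (inl b)) => //; first by rewrite -[_ :: _]/(map (@dswap A B) (inr b :: w)) reduced_dswap.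
  by apply: contra bn; rewrite /= mulg_eq1 => /eqP ->; rewrite invgK.
have [|W [rW eW _]] := rmul_head (inl be^-1) r1; first by case: (w) wn.
rewrite -eW in l' *; apply: (single_head_inl IHn gb ga _ rW (leqnn _) l').
by rewrite addnC.
Qed.

(** When the head is [be^-1], conjugation by [be] is a rotation of the word. It brings a letter
    deviating from the pattern of [h^-1] to the front. *)
Lemma single_inr_even i : forall (A B : rsys) (al : A) (be : B), pant_indep al -> pant_indep be -> len al + len be <= n ->
  forall b w, reduced (inr b :: w) -> ~~ odd (size (inr b :: w : seq (A + B))) ->
  le (ev (inr b :: w) : fp A B) (inj (inl al) * inj (inr be)) ->
  i < size (inr b :: w : seq (A + B)) ->
  nth (inl 1) (inr b :: w) i <> (if odd i then inl al^-1 else inr be^-1) -> single (ev (inr b :: w) : fp A B).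
Proof.
elim: i => [|i IH] A B al be ga gb ln b w rw oe lw hi ni.
  apply: (single_inr_nonfull ga gb ln rw _ _ lw); first by case: (w) oe.
  by apply: contra_notN ni => /eqP ->.
have wn : w != [::] by case: (w) oe.
have [be_|bn] := eqVneq b be^-1; last exact: (single_inr_nonfull ga gb ln rw wn bn lw).
subst b; case: w wn rw oe lw hi ni => // y w _ rw oe lw hi ni.
have aw : alt [:: inr be^-1, y & w] by case/andP: rw.
case: y rw oe lw hi ni aw => [a|b] rw oe lw hi ni aw; last by case/andP: aw.
apply: (rotate_single (g := inj (inr be))).
have eg : inj (inr be) = (inj (inr be^-1))^-1 :> fp A B by rewrite -inj_inv /= invgK.
have := rotate_le (cj_be al be) lw; rewrite {1 2}eg swp_cj_head rcons_cons /= => l'.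
have ln' : len be + len al <= n by rewrite addnC.
have rw' : reduced (inr a :: map (@dswap A B) (rcons w (inr be^-1))).
  rewrite -[_ :: _]/(map (@dswap A B) (rcons (inl a :: w) (inr be^-1))) reduced_dswap reduced_rcons.
  rewrite (reduced_tail rw); case/andP: (rw) => /andP[-> _] _ /=.
  have := alt_last aw; rewrite /= /same => ->.
  by move: oe => /=; rewrite negbK => ->.
apply: (IH _ _ _ _ gb ga ln' _ _ rw' _ l').
- by rewrite /= size_map size_rcons.
- by rewrite /= size_map size_rcons; exact: ltnW.
have -> : inr a :: map (@dswap A B) (rcons w (inr be^-1)) = map (@dswap A B) (rcons (inl a :: w) (inr be^-1)) by [].
rewrite (nth_map (inl 1)); last by rewrite size_rcons; exact: ltnW.
rewrite nth_rcons; move: ni => /=.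
have -> : (i < size (inl a :: w)) by move: hi => /=; lia.
by case: (nth _ _ _) => c /=; case: (odd i) => //= nc [] ec; apply: nc; rewrite ec.
Qed.

(** A head different from [be^-1] is settled, an odd word with head [be^-1] gets shorter by
    conjugation, and an even one rotates unless it is a negative power of [h]. *)
Lemma single_head_inr k : forall (A B : rsys) (al : A) (be : B), pant_indep al -> pant_indep be -> len al + len be <= n ->
  forall b w, size w < k -> reduced (inr b :: w) ->
  le (ev (inr b :: w) : fp A B) (inj (inl al) * inj (inr be)) -> single (ev (inr b :: w) : fp A B).
Proof.
elim: k => // k IH A B al be ga gb ln b w hk rw lw.
have [w0|wn] := eqVneq w [::].
  by subst w; rewrite ev1 in lw *; exact: single_letter ga.1 gb.1 lw.
have [be_|bn] := eqVneq b be^-1; last exact: (single_inr_nonfull ga gb ln rw wn bn lw).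
subst b; have aw : alt (inr be^-1 :: w) by case/andP: rw.
have [o|e] := boolP (odd (size (inr be^-1 :: w : seq (A + B)))).
  case: w wn rw hk lw aw o => // y w _ rw hk lw aw o.
  case: y rw hk lw aw o => [a|b] rw hk lw aw o; last by case/andP: aw.
  have wn : map (@dswap A B) w != [::] by case: (w) o.
  apply: (rotate_single (g := inj (inr be))).
  have := rotate_le (cj_be al be) lw; rewrite swp_cj_inr => l'.
  have r1 : reduced (map (@dswap A B) (inl a :: w)) by rewrite reduced_dswap; exact: reduced_tail rw.
  (* In an odd word the last letter is in the factor of [be], so the trailing [be^-1] merges with it
     while the head cancels. *)
  have [W [rW eW sW]] := rmul_head (inl be^-1) r1 wn.
  rewrite ev_cons inj_triv ?mul1g /= ?mulgV // in l' *; rewrite -eW in l' *.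
  apply: (IH _ _ _ _ gb ga _ _ _ _ rW l'); first by rewrite addnC.
  apply: leq_ltn_trans sW _; rewrite last_map size_map.
  have := alt_last aw; move: o; rewrite /= negbK => o.
  by rewrite o /same; case: (last _ _) => // c _; rewrite addn0.
have [[i [hi ni]]|H] := pselect (exists i, i < size (inr be^-1 :: w : seq (A + B)) /\
    nth (inl 1) (inr be^-1 :: w) i <> (if odd i then inl al^-1 else inr be^-1)).
  exact: (single_inr_even ga gb ln rw e lw hi ni).
have full i : i < size (inr be^-1 :: w : seq (A + B)) ->
    nth (inr be^-1) (inr be^-1 :: w) i = (if odd i then inl al^-1 else inr be^-1).
  move=> hi; rewrite (set_nth_default (inl 1)) //.
  by apply: contrapT => ni; apply: H; exists i.
have Ew := all_full e full; set p := (_./2) in Ew; rewrite Ew in rw lw *.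
case: p {Ew} rw lw => [|p] rw lw; first exact: single1.
have al1 : al != 1 by move: rw => /andP[/and3P[_ /=]]; rewrite invg_eq1.
have be1 : be != 1 by move: rw => /andP[/and3P[/=]]; rewrite invg_eq1.
exfalso; apply: (no_power al1 be1 (k := p.+1)) => //.
set h := inj (inl al) * inj (inr be) in lw *.
have E q : ev (flatten (nseq q [:: inr be^-1; inl al^-1])) = (h ^+ q)^-1 :> fp A B.
  elim: q => [|q IHq]; first by rewrite invg1.
  by rewrite expgSr invgM -IHq [ev _]/= /h !invgM !ev_cons -mulgA -!inj_inv.
by move: lw; rewrite E /le lenV invgK -expgSr.
Qed.
End Induction.

Theorem pant_indep_fp (A B : rsys) (al : A) (be : B) :
  pant_indep al -> pant_indep be -> pant_indep (inj (inl al) * inj (inr be) : fp A B).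
Proof.
have [n] := ubnP (len al + len be).
elim: n A B al be => // n IH A B al be ln ga gb; split; last exact: indep_fp ga.2 gb.2.
have IHn (A' B' : rsys) (al' : A') (be' : B') : pant_indep al' -> pant_indep be' -> len al' + len be' < n ->
    pant (inj (inl al') * inj (inr be') : fp A' B').
  by move=> ga' gb' h; case: (IH A' B' al' be' h ga' gb').
rewrite ltnS in ln => a; rewrite -[a]ev_nf.
have := nf_red a; case: (nf a) => [|[z|b] w] rw lw; first exact: single1.
  exact: (single_head_inl IHn ga gb ln rw (leqnn _) lw).
exact: (single_head_inr IHn ga gb ln (ltnSn _) rw lw).
Qed.

(** * The Coxeter group as a quotient, and translation of the given notions *)

Section Congruence.
Local Open Scope quotient_scope.
Variables (I : finType) (m : I -> I -> nat).

Lemma coxeq_cat p q u v : coxeq m u v -> coxeq m (p ++ u ++ q) (p ++ v ++ q).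
Proof.
elim=> [a b s t h|w|a b _ IH|a b c _ IH1 _ IH2].
- have E z : p ++ (a ++ z ++ b) ++ q = (p ++ a) ++ z ++ (b ++ q) by rewrite !catA.
  by rewrite E -[a ++ b]/(a ++ [::] ++ b) E; exact: ce_rel.
- exact: ce_refl.
- exact: ce_sym.
- exact: ce_trans IH1 IH2.
Qed.

Lemma coxeq_cat2 u v u' v' : coxeq m u v -> coxeq m u' v' -> coxeq m (u ++ u') (v ++ v').
Proof.
move=> h h'; apply: ce_trans (coxeq_cat [::] u' h) _.
by have := coxeq_cat v [::] h'; rewrite !cats0.
Qed.

Lemma coxeq_gp (K : groupType) (f : I -> K) :
  (forall s t, 0 < m s t -> gp (map f (relator m s t)) = 1) ->
  forall u v, coxeq m u v -> gp (map f u) = gp (map f v).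
Proof.
move=> H u v; elim=> [a b s t h|//|//|a b c _ -> _ -> //].
by rewrite !map_cat !gp_cat H // mul1g.
Qed.

Hypothesis m1 : forall s, m s s = 1%N.

Lemma coxeq_rev w : coxeq m (w ++ rev w) [::].
Proof.
elim: w => [|s w IH]; first exact: ce_refl.
rewrite rev_cons -cats1 cat_cons -cat1s (catA w); apply: ce_trans (coxeq_cat [:: s] [:: s] IH) _.
by have := ce_rel (m := m) [::] [::] (s := s) (t := s); rewrite /relator m1; apply.
Qed.

Lemma coxeq_winv u v : coxeq m u v -> coxeq m (rev u) (rev v).
Proof.
move=> h; have h1 : coxeq m (rev u ++ u ++ rev v) (rev v).
  by rewrite catA; have := coxeq_cat [::] (rev v) (coxeq_rev (rev u)); rewrite revK.
apply: ce_trans h1; have h2 : coxeq m (u ++ rev v) [::].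
  apply: ce_trans (coxeq_rev v); exact: (coxeq_cat [::] (rev v) h).
by apply: ce_sym; have := coxeq_cat (rev u) [::] h2; rewrite !cats0.
Qed.

Definition coxrel : rel (seq I) := fun u v => `[< coxeq m u v >].
Lemma coxrel_refl : reflexive coxrel. Proof. by move=> u; apply/asboolP; exact: ce_refl. Qed.
Lemma coxrel_sym : symmetric coxrel.
Proof. by move=> u v; apply/asboolP/asboolP; exact: ce_sym. Qed.
Lemma coxrel_trans : transitive coxrel.
Proof. by move=> v u w /asboolP h1 /asboolP h2; apply/asboolP; exact: ce_trans h1 h2. Qed.
Definition coxrelE := EquivRel coxrel coxrel_refl coxrel_sym coxrel_trans.

(** The hypothesis is an argument of the type so that the group structure, whose inverses reverse
    words of involutions, can be attached to it. *)
Definition cox of (forall s, m s s = 1%N) := {eq_quot coxrelE}.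
Local Notation W := (cox m1).
HB.instance Definition _ := Choice.copy W {eq_quot coxrelE}.

Definition wd (w : seq I) : W := \pi_{eq_quot coxrelE} w.
Definition rep (x : W) : seq I := repr (x : {eq_quot coxrelE}).

Lemma repK : cancel rep wd. Proof. by move=> x; exact: reprK. Qed.
Lemma wdP u v : wd u = wd v <-> coxeq m u v.
Proof.
split=> [/eqP|h]; first by rewrite eqmodE => /asboolP.
by apply/eqP; rewrite eqmodE; apply/asboolP.
Qed.
Lemma rep_wd u : coxeq m (rep (wd u)) u. Proof. by apply/wdP; exact: repK. Qed.

Definition coxmul (x y : W) := wd (rep x ++ rep y).
Definition coxinv (x : W) := wd (rev (rep x)).

Lemma coxmulE u v : coxmul (wd u) (wd v) = wd (u ++ v).
Proof. by apply/wdP/coxeq_cat2; exact: rep_wd. Qed.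
Lemma coxinvE u : coxinv (wd u) = wd (rev u).
Proof. by apply/wdP/coxeq_winv; exact: rep_wd. Qed.

Lemma coxmulA : associative coxmul.
Proof. by move=> x y z; rewrite -[x]repK -[y]repK -[z]repK !coxmulE catA. Qed.
Lemma coxmul1 : left_id (wd [::]) coxmul.
Proof. by move=> x; rewrite -[x]repK coxmulE. Qed.
Lemma coxmulr1 : right_id (wd [::]) coxmul.
Proof. by move=> x; rewrite -[x]repK coxmulE cats0. Qed.
Lemma coxmulrV : right_inverse (wd [::]) coxinv coxmul.
Proof. by move=> x; rewrite -[x]repK coxinvE coxmulE; apply/wdP/coxeq_rev. Qed.
Lemma coxmulV : left_inverse (wd [::]) coxinv coxmul.
Proof.
move=> x; rewrite -[x]repK coxinvE coxmulE; apply/wdP.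
by have := coxeq_rev (rev (rep x)); rewrite revK.
Qed.
HB.instance Definition _ := isGroup.Build W coxmulA coxmul1 coxmulr1 coxmulV coxmulrV.

Lemma wd_cat u v : wd (u ++ v) = wd u * wd v. Proof. by rewrite -coxmulE. Qed.
Lemma wd_rev u : wd (rev u) = (wd u)^-1. Proof. by rewrite -coxinvE. Qed.
Lemma wd0 : wd [::] = 1. Proof. by []. Qed.
Lemma wd_flatten ts : wd (flatten ts) = gp (map wd ts).
Proof. by elim: ts => //= t ts <-; rewrite wd_cat. Qed.
Lemma wd_gp u : wd u = gp [seq wd [:: s] | s <- u].
Proof. by elim: u => // s u IH; rewrite -cat1s wd_cat IH. Qed.

Definition coxrefl (x : W) := exists w s, x = cj (wd w) (wd [:: s]).
Lemma wd_refl x : coxrefl (wd x) <-> is_refl m x.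
Proof.
have E w s : wd (w ++ s :: Defs.winv w) = cj (wd w) (wd [:: s]).
  by rewrite -cat1s !wd_cat wd_rev /cj mulgA.
split=> [[w [s e]]|[w [s h]]]; exists w, s; first by apply/wdP; rewrite E.
by rewrite -E; apply/wdP.
Qed.
Lemma wd_sq s : wd [:: s] * wd [:: s] = 1.
Proof. by rewrite -wd_cat; apply/wdP/(coxeq_rev [:: s]). Qed.
Lemma coxreflJ g t : coxrefl t -> coxrefl (cj g t).
Proof. by case=> w [s ->]; exists (rep g ++ w), s; rewrite wd_cat repK cjJ. Qed.
Lemma coxreflV t : coxrefl t -> coxrefl t^-1.
Proof.
case=> w [s ->]; exists w, s; rewrite -cjV; congr cj.
by apply/eqP; rewrite eq_sym -mulg_eq1 wd_sq.
Qed.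
Lemma coxrefl_simple s : coxrefl (wd [:: s]).
Proof. by exists [::], s; rewrite wd0 cj1. Qed.
Lemma coxrefl_gen x : exists s, (forall t, t \in s -> coxrefl t) /\ gp s = x.
Proof.
exists [seq wd [:: s] | s <- rep x]; split; last by rewrite -wd_gp repK.
by move=> t /mapP[s _ ->]; exact: coxrefl_simple.
Qed.
Definition csys := Rsys coxreflJ coxreflV coxrefl_gen.

Section Hom.
Variables (K : groupType) (f : I -> K).
Hypothesis fR : forall s t, 0 < m s t -> gp (map f (relator m s t)) = 1.
Definition coxhom (x : W) : K := gp (map f (rep x)).
Lemma coxhom_wd u : coxhom (wd u) = gp (map f u).
Proof. by apply: coxeq_gp => //; exact: rep_wd. Qed.
Lemma coxhomM : {morph coxhom : x y / x * y}.
Proof. by move=> x y; rewrite -[x]repK -[y]repK -wd_cat !coxhom_wd map_cat gp_cat. Qed.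
End Hom.

Lemma factT_rfac a ts : factT m a ts <-> rfac (G := csys) (wd a) (map wd ts).
Proof.
split=> [[h1 h2]|[h1 h2]]; split.
- by move=> t /mapP[x /h1 hx ->]; apply/wd_refl.
- by rewrite -wd_flatten; apply/wdP.
- by move=> t ht; apply/wd_refl/h1; apply: map_f.
- by apply/wdP; rewrite wd_flatten.
Qed.

Lemma map_repK s : map wd (map rep s) = s.
Proof. by rewrite -map_comp -[RHS]map_id; apply: eq_map => x; exact: repK. Qed.

Lemma lenT_len a n : lenT m a n <-> len (G := csys) (wd a) = n.
Proof.
split=> [[[ts [<- hts]] hmin]|<-].
  apply/eqP; rewrite eqn_leq -{1}(size_map wd) len_min; last exact/factT_rfac.
  have [s [hs <-]] := len_red (G := csys) (wd a); rewrite -(size_map rep).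
  by apply: hmin; apply/factT_rfac; rewrite map_repK.
split=> [|ts hts]; last by rewrite -(size_map wd); apply: len_min; apply/factT_rfac.
have [s [hs <-]] := len_red (G := csys) (wd a); exists (map rep s); rewrite size_map; split=> //.
by apply/factT_rfac; rewrite map_repK.
Qed.

Lemma redT_Red a ts : redT m a ts <-> Red (G := csys) (wd a) (map wd ts).
Proof.
split=> [[/factT_rfac h1 /lenT_len h2]|[h1 h2]]; split; rewrite ?size_map ?h2 //; first exact/factT_rfac.
by apply/lenT_len; rewrite -h2 size_map.
Qed.

Lemma leT_le a b : leT m a b <-> le (G := csys) (wd a) (wd b).
Proof.
have E : (wd a)^-1 * wd b = wd (Defs.winv a ++ b) by rewrite wd_cat wd_rev.
split=> [[la [lab [lb [/lenT_len h1 /lenT_len h2 /lenT_len h3 e]]]]|].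
  by rewrite /le E h1 h2 h3.
rewrite /le E => e; exists (len (G := csys) (wd a)), (len (G := csys) (wd (Defs.winv a ++ b))), (len (G := csys) (wd b)).
by split=> //; apply/lenT_len.
Qed.

Lemma tupeq_wd ts us : tupeq m ts us <-> map wd ts = map wd us.
Proof.
split=> [[e h]|e].
  apply: (@eq_from_nth _ (wd [::])); rewrite ?size_map // => i hi.
  by rewrite !(nth_map [::]) -?e //; apply/wdP/h.
have es : size ts = size us by rewrite -(size_map wd) e size_map.
split=> // i hi; apply/wdP.
by have := congr1 (fun s => nth (wd [::]) s i) e; rewrite /= !(nth_map [::]) -?es.
Qed.

Lemma orbit_heq ts us : hurwitz_orbit m ts us -> heq (map wd ts) (map wd us).
Proof.
elim=> {ts us} [ts us [[i [hi ->]]|/tupeq_wd ->]|ts|ts us _|ts us vs _ h1 _ h2].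
- have E : ts = take i ts ++ nth [::] ts i :: nth [::] ts i.+1 :: drop i.+2 ts.
    by rewrite -!drop_nth ?cat_take_drop //; exact: ltnW.
  rewrite {1}E /hurwitz !map_cat /= !wd_cat wd_rev mulgA; exact: heq_step.
- exact: heq_refl.
- exact: heq_refl.
- exact: heq_sym.
- exact: heq_trans h1 h2.
Qed.

(** Intermediate tuples are represented by arbitrary words; a change of representatives is a [tupeq]
    step of the orbit relation. *)
Lemma heq_orbit (s t : seq W) : heq s t ->
  forall ts us, map wd ts = s -> map wd us = t -> hurwitz_orbit m ts us.
Proof.
elim=> {s t} [p x y q|s|s t _ IH|s t v _ IH1 _ IH2] ts us.
- move=> /map_eq_cat [p' [[|a [|b q']] [-> <-]]] //= [<- <- <-] e.
  apply: Relation_Operators.rst_trans (p' ++ (a ++ b ++ Defs.winv a) :: a :: q') _ _ _.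
    apply: Relation_Operators.rst_step; left; exists (size p'); split; first by rewrite size_cat /=; lia.
    rewrite /hurwitz !nth_cat ltnn subnn ltnNge leqnSn /= subSnn take_size_cat // drop_cat.
    have -> : (size p').+2 < size p' = false by lia.
    have -> : ((size p').+2 - size p' = 2)%N by lia.
    by rewrite /= drop0.
  apply: Relation_Operators.rst_step; right; apply/tupeq_wd; apply: etrans (esym e).
  by rewrite map_cat /= !wd_cat wd_rev /cj !mulgA.
- by move=> e1 e2; apply: Relation_Operators.rst_step; right; apply/tupeq_wd; rewrite e1 e2.
- by move=> e1 e2; apply: Relation_Operators.rst_sym; exact: IH.
- move=> e1 e2; apply: (Relation_Operators.rst_trans _ _ _ (map rep t)); first by apply: IH1 => //; exact: map_repK.
  by apply: IH2 => //; exact: map_repK.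
Qed.

Lemma pant_wd c : pan_transitive m c <-> pant (G := csys) (wd c).
Proof.
split=> [h a|h a /leT_le/h S ts us /redT_Red h1 /redT_Red h2]; last exact: (heq_orbit (S _ _ h1 h2)).
rewrite -[a]repK => /leT_le/h {}h s t hs ht.
rewrite -(map_repK s) -(map_repK t); apply: orbit_heq; apply: h; apply/redT_Red; by rewrite map_repK.
Qed.
End Congruence.

(** * The Coxeter group of the combined matrix is the free product *)

Section CoxeterFreeProduct.
Variables (I1 I2 : finType) (m1 : I1 -> I1 -> nat) (m2 : I2 -> I2 -> nat).
Hypotheses (d1 : forall s, m1 s s = 1%N) (d2 : forall s, m2 s s = 1%N).
Local Notation m := (free_prod_matrix m1 m2).
Local Notation F := (fp (csys d1) (csys d2)).

Lemma free_prod_diag s : m s s = 1%N.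
Proof. by case: s. Qed.
Local Notation C := (csys free_prod_diag).

Lemma relator_inl s t : relator m (inl s) (inl t) = map inl (relator m1 s t).
Proof. by rewrite /relator /= map_flatten map_nseq. Qed.
Lemma relator_inr s t : relator m (inr s) (inr t) = map inr (relator m2 s t).
Proof. by rewrite /relator /= map_flatten map_nseq. Qed.

Lemma coxeq_inl u v : coxeq m1 u v -> coxeq m (map inl u) (map inl v).
Proof.
elim=> [a b s t h|w|a b _ IH|a b c _ IH1 _ IH2]; last exact: ce_trans IH1 IH2.
- by rewrite !map_cat -relator_inl; exact: (ce_rel (m := m)).
- exact: ce_refl.
- exact: ce_sym.
Qed.
Lemma coxeq_inr u v : coxeq m2 u v -> coxeq m (map inr u) (map inr v).
Proof.
elim=> [a b s t h|w|a b _ IH|a b c _ IH1 _ IH2]; last exact: ce_trans IH1 IH2.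
- by rewrite !map_cat -relator_inr; exact: (ce_rel (m := m)).
- exact: ce_refl.
- exact: ce_sym.
Qed.

Definition to_letter (x : I1 + I2) : csys d1 + csys d2 :=
  match x with inl s => inl (wd d1 [:: s]) | inr s => inr (wd d2 [:: s]) end.
Definition to_simple (x : I1 + I2) : F := inj (to_letter x).

Lemma to_simple_inl u : gp (map to_simple (map inl u)) = inj (inl (wd d1 u)).
Proof.
elim: u => [|s u IH] /=; first by rewrite inj_triv //= wd0.
by rewrite IH -cat1s wd_cat -inj_mul.
Qed.
Lemma to_simple_inr u : gp (map to_simple (map inr u)) = inj (inr (wd d2 u)).
Proof.
elim: u => [|s u IH] /=; first by rewrite inj_triv //= wd0.
by rewrite IH -cat1s wd_cat -inj_mul.
Qed.

Lemma wd_relator (I : finType) (m0 : I -> I -> nat) (d : forall s, m0 s s = 1%N) s t :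
  0 < m0 s t -> wd d (relator m0 s t) = 1.
Proof. by move=> h; rewrite -wd0; apply/wdP; have := ce_rel [::] [::] h; rewrite cats0. Qed.

Lemma to_simpleR s t : 0 < m s t -> gp (map to_simple (relator m s t)) = 1.
Proof.
case: s t => [s|s] [t|t] //= h.
  by rewrite relator_inl to_simple_inl wd_relator // inj_triv //=.
by rewrite relator_inr to_simple_inr wd_relator // inj_triv //=.
Qed.

Definition to_fp : C -> F := coxhom to_simple.
Lemma to_fpM : {morph to_fp : x y / x * y}.
Proof. exact: coxhomM to_simpleR. Qed.
Lemma to_fp_wd u : to_fp (wd free_prod_diag u) = gp (map to_simple u).
Proof. exact: coxhom_wd to_simpleR u. Qed.

Definition of_letter (x : csys d1 + csys d2) : C :=
  match x with inl a => wd _ (map inl (rep a)) | inr b => wd _ (map inr (rep b)) end.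
Lemma of_letter_inl u : of_letter (inl (wd d1 u)) = wd _ (map inl u).
Proof. by apply/wdP/coxeq_inl/rep_wd. Qed.
Lemma of_letter_inr u : of_letter (inr (wd d2 u)) = wd _ (map inr u).
Proof. by apply/wdP/coxeq_inr/rep_wd. Qed.
Lemma of_letterM x y : same x y -> of_letter (dmul x y) = of_letter x * of_letter y.
Proof.
case: x y => [a|a] [b|b] //= _; rewrite -wd_cat -map_cat.
  by rewrite -[RHS]of_letter_inl wd_cat !repK.
by rewrite -[RHS]of_letter_inr wd_cat !repK.
Qed.
Definition of_fp : F -> C := hom of_letter.
Lemma of_fpM : {morph of_fp : x y / x * y}.
Proof. exact: homM of_letterM. Qed.

Lemma to_fpK : cancel to_fp of_fp.
Proof.
move=> x; rewrite -[x]repK to_fp_wd (morph_gp of_fpM) -map_comp wd_gp.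
by congr gp; apply: eq_map => -[s|s]; rewrite /= /of_fp (hom_inj of_letterM) ?of_letter_inl ?of_letter_inr.
Qed.
Lemma to_fp_refl t : refl t -> refl (to_fp t).
Proof.
case=> w [s ->]; rewrite (morphcj to_fpM); exists (to_fp (wd _ w)), (to_letter s).
by split; [case: s => s; exact: coxrefl_simple|congr cj; rewrite to_fp_wd; exact: gp1].
Qed.
Lemma of_letter_refl x : drefl x -> refl (of_letter x).
Proof.
case: x => a [w [s ->]].
  have M : {morph (fun x => of_letter (inl x)) : x y / x * y} by move=> x y; rewrite -of_letterM.
  have /= -> := morphcj M (wd d1 w) (wd d1 [:: s]).
  by exists (map inl w), (inl s); congr cj; exact: of_letter_inl.
have M : {morph (fun x => of_letter (inr x)) : x y / x * y} by move=> x y; rewrite -of_letterM.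
have /= -> := morphcj M (wd d2 w) (wd d2 [:: s]).
by exists (map inr w), (inr s); congr cj; exact: of_letter_inr.
Qed.
Lemma of_fp_refl t : refl t -> refl (of_fp t).
Proof. exact: hom_refl of_letterM of_letter_refl t. Qed.

Lemma pant_free_prod h1 h2 : pant (inj (inl (wd d1 h1)) * inj (inr (wd d2 h2)) : F) ->
  pan_transitive m (map inl h1 ++ map inr h2).
Proof.
move=> P; apply/(pant_wd free_prod_diag) => a.
move=> /(iso_le to_fpM of_fpM to_fpK to_fp_refl of_fp_refl).
rewrite to_fp_wd map_cat gp_cat to_simple_inl to_simple_inr => /P S.
exact: (iso_single to_fpM of_fpM to_fpK to_fp_refl of_fp_refl) S.
Qed.
End CoxeterFreeProduct.

From mathcomp Require Import all_algebra all_field ring.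
Local Open Scope group_scope.

(** * Independence from a representation in which reflections have rank one *)

Section LinearCriterion.
Import GRing.Theory.
Local Open Scope ring_scope.
Variables (G : rsys) (F : fieldType) (N : nat) (rho : G -> 'M[F]_N).
Hypotheses (rho1 : rho 1%g = 1%:M) (rhoM : forall x y : G, rho (x * y)%g = rho x *m rho y).
Hypothesis rho_refl : forall t, refl t -> (\rank (rho t - 1%:M)%R <= 1)%N.
Implicit Types (x y g t : G) (s : seq G).

(** Matrices act on row vectors from the right, so the row space is the space moved by [x]; for a
    reflection it is spanned by the root, if it is not 0. *)
Definition mv x := rho x - 1%:M.

Lemma rhoV x : rho x^-1%g *m rho x = 1%:M.
Proof. by rewrite -rhoM mulVg. Qed.
Lemma rhoE x : rho x = mv x + 1%:M.
Proof. by rewrite /mv subrK. Qed.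
Lemma mv1 : mv 1%g = 0.
Proof. by rewrite /mv rho1 subrr. Qed.
Lemma mvM x y : mv (x * y)%g = mv x + (mv x + 1%:M) *m mv y.
Proof. by rewrite -rhoE /mv mulmxBr mulmx1 -rhoM [RHS]addrC addrA subrK. Qed.

Section Sub.
Variables (k : nat) (X : 'M[F]_(k, N)).
Lemma mvM_sub x y : (mv x <= X)%MS -> (mv y <= X)%MS -> (mv (x * y)%g <= X)%MS.
Proof. by move=> hx hy; rewrite mvM addmx_sub // (submx_trans (submxMl _ _)). Qed.
Lemma mvV_sub x : (mv x <= X)%MS -> (mv x^-1%g <= X)%MS.
Proof.
move=> hx; have -> : mv x^-1%g = - (rho x^-1%g *m mv x).
  by rewrite /mv mulmxBr mulmx1 rhoV opprB.
by rewrite eqmx_opp (submx_trans (submxMl _ _)).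
Qed.
Lemma mv_gp_sub s : (forall x, x \in s -> (mv x <= X)%MS) -> (mv (gp s) <= X)%MS.
Proof.
elim: s => [|x s IH] H; first by rewrite mv1 sub0mx.
by apply: mvM_sub; [exact: H (mem_head _ _)|apply: IH => y hy; apply: H; rewrite inE hy orbT].
Qed.
Lemma mv_cj_sub x y : (mv x <= X)%MS -> (mv y <= X)%MS -> (mv (cj x y) <= X)%MS.
Proof. by move=> hx hy; rewrite /cj !mvM_sub // mvV_sub. Qed.
End Sub.

Definition spn s : 'M[F]_N := (\sum_(t <- s) mv t)%MS.

Lemma spn_cons x s : spn (x :: s) = (mv x + spn s)%MS.
Proof. by rewrite /spn big_cons. Qed.

Lemma spn_sub s k (X : 'M[F]_(k, N)) : (spn s <= X)%MS <-> forall t, t \in s -> (mv t <= X)%MS.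
Proof.
elim: s => [|x s IH]; first by rewrite /spn big_nil sub0mx; split.
rewrite spn_cons addsmx_sub; split=> [/andP[hx /IH hs] t|H].
  by rewrite inE => /orP[/eqP->|/hs].
rewrite H ?mem_head //; apply/IH => t ht; apply: H; by rewrite inE ht orbT.
Qed.

Lemma mv_spn s t : t \in s -> (mv t <= spn s)%MS.
Proof. by move=> ht; have /spn_sub := submx_refl (spn s); apply. Qed.

(** Elements whose moved space lies in a given subspace are closed under conjugation by each other,
    so a move cannot leave the span. *)
Lemma heq_spn s s' : heq s s' -> (spn s' <= spn s)%MS.
Proof.
move=> h; apply/spn_sub; apply/(heq_sub _ _ h); last by move=> x; exact: mv_spn.
  by move=> x y; exact: mv_cj_sub.
by move=> x y hx hy; apply: mv_cj_sub => //; exact: mvV_sub.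
Qed.

Lemma spn_rank s : (forall t, t \in s -> refl t) -> (\rank (spn s) <= size s)%N.
Proof.
elim: s => [|x s IH] H; first by rewrite /spn big_nil mxrank0.
rewrite spn_cons; apply: leq_trans (mxrank_adds_leqif _ _) _.
apply: (@leq_add _ _ 1%N); first exact: rho_refl (H _ (mem_head _ _)).
by apply: IH => t ht; apply: H; rewrite inE ht orbT.
Qed.

(* The rank hypothesis says that the roots of the reflections in [s] are independent. *)
Lemma fixed_by_product s : (forall t, t \in s -> refl t) -> \rank (spn s) = size s ->
  forall k (v : 'M[F]_(k, N)), v *m mv (gp s) = 0 -> forall t, t \in s -> v *m mv t = 0.
Proof.
elim: s => // x s IH H r k v; rewrite gp_cons mvM => e.
have Hs t : t \in s -> refl t by move=> ht; apply: H; rewrite inE ht orbT.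
have := mxrank_sum_cap (mv x) (spn s); rewrite -spn_cons r => rk.
have r1 := rho_refl (H _ (mem_head _ _)); have r2 := spn_rank Hs; rewrite -/(mv x) in r1.
have /= [rs /eqP rc] : \rank (spn s) = size s /\ \rank (mv x :&: spn s)%MS = 0%N.
  by clear -rk r1 r2; move: rk => /=; lia.
rewrite mxrank_eq0 in rc.
have vx : v *m mv x = 0.
  apply/eqP; rewrite -submx0 -(eqP rc) sub_capmx submxMl.
  move: e; rewrite mulmxDr => /eqP; rewrite addr_eq0 => /eqP ->.
  rewrite eqmx_opp mulmxA; apply: submx_trans (submxMl _ _) _.
  by apply: mv_gp_sub => t; exact: mv_spn.
move=> t; rewrite inE => /orP[/eqP->//|]; apply: IH => //.
by move: e; rewrite mulmxDr vx add0r mulmxA (mulmxDr v) mulmx1 vx add0r.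
Qed.

Variables (c : G) (sg : seq G).
Hypotheses (Pc : pant c) (hsg : rfac c sg) (rsg : \rank (spn sg) = size sg).
Hypothesis Ksg : forall k (X : 'M[F]_(k, N)), (forall t, t \in sg -> X *m mv t = 0) -> (\rank X + size sg <= N)%N.

(** A product of [k] reflections moves a space of dimension at most [k]. Vectors fixed by [c] are
    fixed by all of [sg] by [fixed_by_product], so [Ksg] bounds the space moved by [c] from
    below. *)
Lemma len_lin : len c = size sg.
Proof.
apply/eqP; rewrite eqn_leq len_min //=.
have [s [[hs es] <-]] := len_red c.
have r1 : (\rank (mv c) <= size s)%N.
  rewrite -es; apply: leq_trans (spn_rank hs); apply: mxrankS.
  by apply: mv_gp_sub => t; exact: mv_spn.
apply: leq_trans r1; have := Ksg (X := kermx (mv c)); rewrite mxrank_ker.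
have /[swap] /[apply] : forall t, t \in sg -> kermx (mv c) *m mv t = 0.
  by apply: (fixed_by_product hsg.1 rsg); rewrite hsg.2 mulmx_ker.
have := rank_leq_row (mv c); lia.
Qed.

(** Pan-transitivity at [c] itself connects [s] with [sg], whose roots are independent. *)
Lemma Red_rank_lin s : Red c s -> \rank (spn s) = size s.
Proof.
move=> hs; have e : size s = size sg by rewrite hs.2 len_lin.
have hsg' : Red c sg by split=> //; rewrite len_lin.
apply/eqP; rewrite eqn_leq spn_rank ?e -?rsg; last by case: hs => -[].
by apply/mxrankS/heq_spn; exact: (Pc (le_refl c) hs hsg').
Qed.

Lemma spn_cat s s' : (spn (s ++ s') <= spn s + spn s')%MS.
Proof.
apply/spn_sub => x; rewrite mem_cat => /orP[/mv_spn h|/mv_spn h].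
  exact: submx_trans h (addsmxSl _ _).
exact: submx_trans h (addsmxSr _ _).
Qed.

(** Reduced factorizations of [z] and [v] together have independent roots, so their spans meet in 0.
    The element [cj g x] moves vectors into the span of [z], and composed with [rho g] also into
    that of [v]; hence it acts trivially, and independence of its own roots makes its factorization
    empty. *)
Lemma indep_lin : indep c.
Proof.
move=> z v ec elen g x hg hx hy.
have zc : le z c by rewrite ec; apply: le_factorl; rewrite -ec elen.
have vc : le v c by rewrite ec; apply: le_factorr; rewrite -ec elen.
have [sz hz] := len_red z; have [sv hv] := len_red v.
have hc : Red c (sz ++ sv) by rewrite ec; apply: Red_cat; rewrite -?ec.
have rz := spn_rank hz.1.1; have rv := spn_rank hv.1.1.
have rc := Red_rank_lin hc.
have [rz' cap0] : \rank (spn sz) = size sz /\ (spn sz :&: spn sv)%MS = 0.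
  have := mxrank_sum_cap (spn sz) (spn sv).
  have := mxrankS (spn_cat sz sv); rewrite rc size_cat => l1 l2.
  have [? /eqP h0] : \rank (spn sz) = size sz /\ \rank (spn sz :&: spn sv)%MS = 0%N.
    by clear -rz rv l1 l2; lia.
  by split=> //; apply/eqP; rewrite -mxrank_eq0.
have below u su w : le u c -> Red u su -> le w u -> (mv w <= spn su)%MS.
  move=> uc hu wu; have [sw hw] := len_red w; have [sw' hw'] := len_red (w^-1 * u)%g.
  have hu' := le_Red wu hw hw'.
  have := heq_spn (Pc uc hu hu') => /spn_sub H.
  by rewrite -hw.1.2; apply: mv_gp_sub => t ht; apply: H; rewrite mem_cat ht.
have inHspn u su y : le u c -> Red u su -> inH u y -> (mv y <= spn su)%MS.
  move=> uc hu [s [Hs <-]]; apply: mv_gp_sub => t /Hs[_ [l|l]]; first exact: (below _ _ _ uc hu l).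
  by rewrite -[t]invgK; apply: mvV_sub; exact: (below _ _ _ uc hu l).
have mg := inHspn _ _ _ zc hz hg; have mx := inHspn _ _ _ vc hv hx.
have my := below _ _ _ zc hz hy.
have E : mv (cj g x) *m rho g = rho g *m mv x.
  by rewrite /mv mulmxBl mul1mx mulmxBr mulmx1 -!rhoM /cj mulgVK.
(* The first expression lies in the span of [z], since [g] and [cj g x] move vectors only there; by
   [E] it also lies in that of [v]. *)
have y0 : mv (cj g x) *m rho g = 0.
  apply/eqP; rewrite -submx0 -cap0 sub_capmx; apply/andP; split.
    rewrite rhoE mulmxDr mulmx1; apply: addmx_sub => //.
    exact: submx_trans (submxMl _ _) mg.
  by rewrite E; exact: submx_trans (submxMl _ _) mx.
have {}y0 : mv (cj g x) = 0.
  have gV : rho g *m rho g^-1%g = 1%:M by rewrite -rhoM mulgV.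
  by rewrite -[LHS]mulmx1 -gV mulmxA y0 mul0mx.
have [sy hsy] := len_red (cj g x); have [sy' hsy'] := len_red ((cj g x)^-1 * z)%g.
have hz' := le_Red hy hsy hsy'; have [sw hw] := len_red (z^-1 * c)%g.
have hc' := le_Red zc hz' hw.
(* A factorization of [cj g x] extends through [z] to a reduced one of [c], so its roots are
   independent as well. *)
have ry : \rank (spn sy) = size sy.
  have := Red_rank_lin hc'; rewrite -catA => r; move: r; rewrite size_cat.
  have := mxrankS (spn_cat sy (sy' ++ sw)).
  have l3 := mxrank_adds_leqif (spn sy) (spn (sy' ++ sw)).
  have l1 := spn_rank hsy.1.1.
  have l2 : (\rank (spn (sy' ++ sw)) <= size (sy' ++ sw))%N.
    apply: spn_rank => t ht; case: hc' => -[H _] _; apply: H.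
    by move: ht; rewrite !mem_cat => /orP[->|->]; rewrite ?orbT.
  by move: l3 => [l3 _]; clear -l1 l2 l3; lia.
have f0 t : t \in sy -> mv t = 0.
  move=> ht; rewrite -[LHS]mul1mx; apply: (fixed_by_product hsy.1.1 ry) => //.
  by rewrite hsy.1.2 y0 mulmx0.
have : (spn sy <= (0 : 'M[F]_N))%MS by apply/spn_sub => t /f0 ->; exact: sub0mx.
rewrite submx0 -mxrank_eq0 ry => /eqP/size0nil sy0.
have /= : cj g x = 1%g by rewrite -hsy.1.2 sy0.
by move=> h1; rewrite -[x](cjK g) h1 cjg1.
Qed.
End LinearCriterion.

(** * The order of a product of two reflections *)

Section DihedralRelation.
Import GRing.Theory.
Local Open Scope ring_scope.
Variable F : fieldType.

Lemma geom0 (a : F) k : a ^+ k = 1 -> a != 1 -> \sum_(i < k) a ^+ i = 0.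
Proof.
move=> ak a1; have := subrX1 a k; rewrite ak subrr => /esym/eqP.
by rewrite mulf_eq0 subr_eq0 (negbTE a1) => /eqP.
Qed.

Lemma eigen_sum N (P : 'M[F]_N) (U : 'rV[F]_N) (a : F) k : U *m P = a *: U -> a ^+ k = 1 -> a != 1 ->
  U *m (\sum_(i < k) P ^+ i) = 0.
Proof.
move=> e ak a1; rewrite mulmx_sumr.
have E i : U *m P ^+ i = a ^+ i *: U.
  elim: i => [|i IH]; first by rewrite !expr0 mulmx1 scale1r.
  by rewrite exprS -mulmxE mulmxA e -scalemxAl IH scalerA -exprS.
by rewrite (eq_bigr (fun i : 'I_k => a ^+ i *: U)) => [|i _ //]; first by rewrite -scaler_suml geom0 // scale0r.
Qed.

Lemma mul_transvection N (w u : 'rV[F]_N) (f : 'cV[F]_N) (a : F) : w *m f = a%:M ->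
  w *m (1%:M - f *m u) = w - a *: u.
Proof. by move=> e; rewrite mulmxBr mulmx1 mulmxA e mul_scalar_mx. Qed.

(* The product [P] of two reflections has the eigenvectors [u + q v] and [u + q^-1 v], with eigenvalues
   [q ^+ 2] and [q ^- 2]; they span the image of [P - 1]. *)
Lemma dihedral N (u v : 'rV[F]_N) (f g : 'cV[F]_N) (q : F) k :
  u *m f = 2%:M -> v *m g = 2%:M -> u *m g = (- (q + q^-1))%:M -> v *m f = (- (q + q^-1))%:M ->
  q != 0 -> q ^+ 2 != 1 -> (q ^+ 2) ^+ k = 1 ->
  ((1%:M - f *m u) *m (1%:M - g *m v)) ^+ k = 1 :> 'M[F]_N.
Proof.
move=> uf vg ug vf q0 q1 qk; set P := _ *m _; set c := - (q + q^-1) in ug vf.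
have uP : u *m P = - u + c *: v.
  rewrite /P mulmxA (mul_transvection _ uf) (@mul_transvection _ _ v g (- c)); last first.
    by rewrite mulmxBl -scalemxAl ug; apply/matrixP => i j; rewrite !ord1 !mxE /= !mulr1n; ring.
  by apply/rowP => j; rewrite !mxE; ring.
have vP : v *m P = - c *: u + (c ^+ 2 - 1) *: v.
  rewrite /P mulmxA (mul_transvection _ vf) (@mul_transvection _ _ v g (2 - c ^+ 2)); last first.
    by rewrite mulmxBl -scalemxAl vg ug; apply/matrixP => i j; rewrite !ord1 !mxE /= !mulr1n; ring.
  by apply/rowP => j; rewrite !mxE; ring.
set S := \sum_(i < k) P ^+ i.
have qU : (u + q *: v) *m S = 0.
  apply: (@eigen_sum _ _ _ (q ^+ 2)) => //.
  by rewrite mulmxDl -scalemxAl uP vP; apply/rowP => j; rewrite !mxE /c; field.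
have qV : (u + q^-1 *: v) *m S = 0.
  apply: (@eigen_sum _ _ _ (q ^- 2)); last 2 first.
  - by rewrite exprVn qk invr1.
  - by rewrite invr_eq1.
  by rewrite mulmxDl -scalemxAl uP vP; apply/rowP => j; rewrite !mxE /c; field.
have vS : v *m S = 0.
  have : (q - q^-1) *: (v *m S) = 0.
    rewrite -[RHS](subrr 0) -{1}qU -qV -mulmxBl scalemxAl; congr (_ *m _).
    by apply/rowP => j; rewrite !mxE; ring.
  move/eqP; rewrite scaler_eq0 => /orP[|/eqP //]; rewrite subr_eq0 => /eqP e.
  by move: q1; rewrite expr2 {2}e mulfV // eqxx.
have uS : u *m S = 0 by move: qU; rewrite mulmxDl -scalemxAl vS scaler0 addr0.
apply/eqP; rewrite -subr_eq0 subrX1 -/S -mulmxE.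
have -> : P - 1 = - (f *m u) + (c *: f - g) *m v.
  rewrite /P mulmxBl mul1mx mulmxBr mulmx1 -mulmxA (mulmxA u) ug mul_scalar_mx -scalemxAr mulmxBl -scalemxAl.
  by apply/matrixP => i j; rewrite !mxE; ring.
by rewrite mulmxDl mulNmx -!mulmxA uS vS !mulmx0 oppr0 addr0.
Qed.
End DihedralRelation.

(** * A reflection representation of dimension twice the rank *)

Section ReflectionRepresentation.
Import GRing.Theory.
Local Open Scope ring_scope.
Variables (I : finType) (m : I -> I -> nat).
Hypotheses (msym : forall s t, m s t = m t s) (d : forall s, m s s = 1%N).
Hypothesis mne : forall s t, s != t -> m s t != 1%N.
Variables (F : fieldType) (q : nat -> F).
Hypothesis q0 : forall k, q k != 0.
Hypothesis q1 : forall k, (1 < k)%N -> q k ^+ 2 != 1.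
Hypothesis qk : forall k, (1 < k)%N -> (q k ^+ 2) ^+ k = 1.
Local Notation n := #|I|.

(** For [q k = exp(i pi / k)] the entry is [-2 cos(pi / k)], twice the usual Coxeter form; [q = 1]
    gives -2 for an infinite order. *)
Definition cform (s t : I) : F := if s == t then 2 else - (q (m s t) + (q (m s t))^-1).
(* The second summand makes the linear forms [col i coroots] independent; the form [cform] alone may be degenerate. *)
Definition roots : 'M[F]_(n, n + n) := row_mx 1%:M 0.
Definition coroots : 'M[F]_(n + n, n) := col_mx (\matrix_(i, j) cform (enum_val i) (enum_val j)) 1%:M.
Definition root s := row (enum_rank s) roots.
Definition coroot s := col (enum_rank s) coroots.
Definition srefl s : 'M[F]_(n + n) := 1%:M - coroot s *m root s.
Definition rep_word (w : seq I) : 'M[F]_(n + n) := foldr (fun s A => srefl s *m A) 1%:M w.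

Lemma row_mul_col a b c (A : 'M[F]_(a, b)) (B : 'M[F]_(b, c)) i j : row i A *m col j B = ((A *m B) i j)%:M.
Proof. by apply/matrixP => k l; rewrite !ord1 !mxE /= mulr1n; apply: eq_bigr => x _; rewrite !mxE. Qed.

Lemma root_coroot s t : root s *m coroot t = (cform s t)%:M.
Proof. by rewrite /root /coroot row_mul_col mul_row_col mul1mx mul0mx addr0 mxE !enum_rankK. Qed.

Lemma rep_word_cat u v : rep_word (u ++ v) = rep_word u *m rep_word v.
Proof. by elim: u => [|s u IH] /=; rewrite ?mul1mx // IH mulmxA. Qed.

Lemma rep_relator s t : (0 < m s t)%N -> rep_word (relator m s t) = 1%:M.
Proof.
move=> h; have -> : rep_word (relator m s t) = (srefl s *m srefl t) ^+ m s t.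
  by rewrite /relator; elim: (m s t) => [|k IH] //=; rewrite exprS -mulmxE -mulmxA -IH.
have [<-|st] := eqVneq s t.
  rewrite d expr1 {1}/srefl mulmxBl mul1mx -mulmxA (mul_transvection _ (root_coroot s s)).
  rewrite /cform eqxx mulmxBr -scalemxAr /srefl; set A := _ *m _.
  by apply/matrixP => i j; rewrite !mxE; ring.
have m1 : (1 < m s t)%N by move: h (mne st); case: (m s t) => [|[]].
apply: (@dihedral _ _ _ _ _ _ (q (m s t))) => //; rewrite ?root_coroot /cform ?eqxx //; try exact: q1; try exact: qk.
  by rewrite (negbTE st).
by rewrite eq_sym (negbTE st) msym.
Qed.

Lemma rep_coxeq u v : coxeq m u v -> rep_word u = rep_word v.
Proof.
elim=> [a b s t h|//|//|a b c _ -> _ -> //].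
by rewrite !rep_word_cat rep_relator // mul1mx.
Qed.

Local Notation W := (csys d).
Definition rho (x : W) := rep_word (rep x).
Lemma rho_wd u : rho (wd d u) = rep_word u.
Proof. exact: rep_coxeq (rep_wd d u). Qed.
Lemma rho1 : rho 1%g = 1%:M.
Proof. by rewrite -wd0 rho_wd. Qed.
Lemma rhoM (x y : W) : rho (x * y)%g = rho x *m rho y.
Proof. by rewrite -[x]repK -[y]repK -wd_cat !rho_wd rep_word_cat. Qed.
Lemma mv_simple s : mv rho (wd d [:: s]) = - (coroot s *m root s).
Proof. by rewrite /mv rho_wd /= mulmx1 /srefl addrC addKr. Qed.
Lemma rho_refl (t : W) : refl t -> (\rank (rho t - 1%:M)%R <= 1)%N.
Proof.
case=> w [s ->]; set g := wd d w; rewrite /cj.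
have -> : rho (g * wd d [:: s] * g^-1)%g - 1%:M = rho g *m mv rho (wd d [:: s]) *m rho g^-1%g.
  by rewrite /mv mulmxBr mulmx1 mulmxBl -!rhoM mulgV rho1.
apply: leq_trans (mxrankM_maxl _ _) _; apply: leq_trans (mxrankM_maxr _ _) _.
by rewrite mv_simple mxrank_opp mulmx_max_rank.
Qed.

(** The second block of [coroots] supplies a row vector on which the coroot of [s] takes the value
    1. *)
Lemma root_mv s : (root s <= mv rho (wd d [:: s]))%MS.
Proof.
rewrite mv_simple eqmx_opp; apply/submxP; exists (row (enum_rank s) (row_mx 0 1%:M)).
by rewrite mulmxA row_mul_col mul_row_col mul0mx mul1mx add0r mxE eqxx mul1mx.
Qed.

Lemma fixed_coroot k (X : 'M[F]_(k, n + n)) s : X *m mv rho (wd d [:: s]) = 0 -> X *m coroot s = 0.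
Proof.
move=> e; have := congr1 (mulmx^~ (col (enum_rank s) (col_mx 1%:M 0))) e.
rewrite /= mul0mx mv_simple mulmxN mulNmx -!mulmxA row_mul_col mul_row_col mul1mx mul0mx addr0 mxE eqxx.
by rewrite mulmx1 => /eqP; rewrite oppr_eq0 => /eqP.
Qed.

Variable h : seq I.
Hypothesis hh : coxeter_word h.
Local Notation sg := [seq wd d [:: s] | s <- h].

Lemma mem_word s : s \in h.
Proof. by rewrite (perm_mem hh) mem_enum. Qed.
Lemma size_word : size h = n.
Proof. by rewrite (perm_size hh) cardE. Qed.

Lemma rfac_word : rfac (G := W) (wd d h) sg.
Proof. by split; [move=> t /mapP[s _ ->]; exact: coxrefl_simple|rewrite -wd_gp]. Qed.

Lemma rank_word : \rank (spn rho sg) = size sg.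
Proof.
apply/eqP; rewrite eqn_leq (spn_rank rho_refl); last exact: rfac_word.1.
rewrite size_map size_word -{1}(mxrank1 F n) -(rank_row_mx0 n) /=; apply: mxrankS.
apply/row_subP => i; rewrite -[i]enum_valK -/(root _); apply: submx_trans (root_mv _) _.
by apply: mv_spn; apply/map_f/mem_word.
Qed.

(** A vector fixed by all simple reflections is killed by every coroot, and the coroots have rank
    [n] by their second block. *)
Lemma common_fixed k (X : 'M[F]_(k, n + n)) : (forall t, t \in sg -> X *m mv rho t = 0) ->
  (\rank X + size sg <= n + n)%N.
Proof.
move=> H; have XC : X *m coroots = 0.
  apply/matrixP => i j; have := fixed_coroot (H _ (map_f (fun s => wd d [:: s]) (mem_word (enum_val j)))).
  by rewrite /coroot enum_valK colE mulmxA -colE => /matrixP/(_ i 0); rewrite !mxE.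
have rc : \rank coroots = n.
  apply/eqP; rewrite eqn_leq rank_leq_col -{1}(mxrank1 F n).
  have <- : row_mx 0 1%:M *m coroots = 1%:M by rewrite mul_row_col mul0mx mul1mx add0r.
  exact: mxrankM_maxr.
have := mxrankS (introT sub_kermxP XC); rewrite mxrank_ker rc size_map size_word; lia.
Qed.

Lemma indep_word : pan_transitive m h -> indep (wd d h : W).
Proof.
move=> /(pant_wd d) P.
exact: (indep_lin rho1 rhoM rho_refl P rfac_word rank_word common_fixed).
Qed.
End ReflectionRepresentation.

(** The representation is taken over the algebraic numbers, where the roots of unity needed for the
    finite orders exist. *)
Lemma coxeter_indep (I : finType) (m : I -> I -> nat) (d : forall s, m s s = 1%N) (h : seq I) :
  coxeter_matrix m -> coxeter_word h -> pan_transitive m h -> indep (wd d h : csys d).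
Proof.
move=> [msym [_ mne]] hh P.
(* A primitive root of unity of order [2k] has a square of exact order [k]; for infinite order,
   encoded by 0, and on the diagonal, 1 will do. *)
have ex (k : nat) : exists q : algC, [/\ q != 0%R, (1 < k)%N -> (q ^+ 2 != 1)%R & (1 < k)%N -> ((q ^+ 2) ^+ k = 1)%R].
  have [k1|k1] := ssrnat.ltnP 1%N k; last by exists 1%R; split=> //; exact: GRing.oner_neq0.
  have [z hz] := C_prim_root_exists (n := k.*2) (ltac:(lia)).
  exists z; split=> [|_|_].
  - apply/eqP => z0; have := prim_expr_order hz.
    rewrite z0 GRing.expr0n double_eq0 eqn0Ngt (ltnW k1) => /eqP.
    by rewrite eq_sym GRing.oner_eq0.
  - by rewrite -(prim_order_dvd hz) gtnNdvd // -muln2; lia.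
  - by rewrite -GRing.exprM mul2n prim_expr_order.
have [q hq] := choice ex.
apply: (@indep_word I m msym d mne _ q) => // k; by case: (hq k).
Qed.

Theorem theorem5p5 (I1 I2 : finType) (m1 : I1 -> I1 -> nat) (m2 : I2 -> I2 -> nat)
  (h1 : seq I1) (h2 : seq I2) :
  coxeter_matrix m1 -> coxeter_matrix m2 ->
  coxeter_word h1 -> coxeter_word h2 ->
  pan_transitive m1 h1 -> pan_transitive m2 h2 ->
  pan_transitive (free_prod_matrix m1 m2) (map inl h1 ++ map inr h2).
Proof.
move=> c1 c2 hh1 hh2 p1 p2; have d1 := c1.2.1; have d2 := c2.2.1.
have g1 : pant_indep (wd d1 h1 : csys d1) by split; [exact/pant_wd|exact: coxeter_indep].
have g2 : pant_indep (wd d2 h2 : csys d2) by split; [exact/pant_wd|exact: coxeter_indep].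
exact: pant_free_prod (pant_indep_fp g1 g2).1.
Qed.
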